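(* Let $R\in\mathcal R_A$ be a random map, given by maps $\{T_j:I\to I\}_{j\in\Omega}$ and a positive probability vector $\mathbf p=(p_j)_{j\in\Omega}$. If $R$ has strong random matching, then there exists an invariant probability measure $m_{\mathbf p}\times\mu_{\mathbf p}$ for $R$ with $\mu_{\mathbf p}$ absolutely continuous with respect to Lebesgue measure and such that its density $f_{\mathbf p}$ is piecewise constant. If moreover every map $T_j$ is expanding, i.e., if $|k_{i,j}|>1$ for each $1\le i\le N$ and $j\in\Omega$ (where $k_{i,j}$ is the slope of $T_j$ on $(c_{i-1},c_i)$), then any invariant probability density $f_{\mathbf p}$ of $R$ is piecewise constant.
   Context: Random maps. Let $\Omega\subseteq\mathbb N$, let $I=[c_0,c_N]\subset\mathbb R$ be an interval, let $\{T_j:I\to I\}_{j\in\Omega}$ be maps and let $\mathbf p=(p_j)_{j\in\Omega}$ be a probability vector with $p_j>0$ for all $j$. With $\sigma$ the left shift on $\Omega^{\mathbb N}$, the random map is $R:\Omega^{\mathbb N}\times I\to\Omega^{\mathbb N}\times I$, $R(\omega,x)=(\sigma(\omega),T_{\omega_1}(x))$. Let $m_{\mathbf p}$ be the $\mathbf p$-Bernoulli measure on $\Omega^{\mathbb N}$. If $\mu_{\mathbf p}$ is a probability measure on $I$, absolutely continuous with respect to Lebesgue measure, with $\mu_{\mathbf p}(B)=\sum_{j\in\Omega}p_j\,\mu_{\mathbf p}(T_j^{-1}B)$ for every Borel set $B\subseteq I$, then $m_{\mathbf p}\times\mu_{\mathbf p}$ is $R$-invariant; the density $f_{\mathbf p}$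 of such a $\mu_{\mathbf p}$ is called an invariant (probability) density of $R$. ''Piecewise constant'' means (up to Lebesgue null sets) constant on each interval of a finite partition of $I$ into intervals. The class $\mathcal R_A$. $R\in\mathcal R_A$ if the following hold. (c1) There are points $c_0<c_1<\dots<c_N$ such that for each $j\in\Omega$, $1\le i\le N$, $T_j(x)=k_{i,j}x+d_{i,j}$ on $(c_{i-1},c_i)$ for constants $k_{i,j},d_{i,j}$. The partition is chosen as small as possible, i.e. each $c_i$ with $1\le i\le N-1$ is a discontinuity of $T_j$ or of $T_j'$ for at least one $j\in\Omega$. Set $C=\{c_1,\dots,c_{N-1}\}$, the set of critical points of $R$. (a2) (Expanding on average) There is $0<\rho<1$ such that $\sum_{j\in\Omega}\frac{p_j}{|T_j'(x)|}\le\rho$ for each $x\in I\setminus C$. (c2) For each $1\le i\le N$ there is $1\le n\le N$ such that $$\frac{\sum_{j\in\Omega}\frac{p_j}{k_{i,j}}d_{i,j}}{1-\sum_{j\in\Omega}\frac{p_j}{k_{i,j}}}\neq\frac{\sum_{j\in\Omega}\frac{p_j}{k_{n,j}}d_{n,j}}{1-\sum_{j\in\Omega}\frac{p_j}{k_{n,j}}}.$$ (c3) For each $1\le i\le N$, $\sum_{j\in\Omega}\frac{p_j}{k_{i,j}}\ne0$. (Two further conditions are part of the general framework but are automatic in this piecewise affine setting: each $T_j$ is $C^1$ and monotone on the interior of each partition interval, and the functions $x\mapsto p_j/|T_j'(x)|$, set to $0$ at critical points, are of bounded variation.) Notation. For a string $\mathbf u=u_1\cdots u_k\in\Omega^k$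 let $T_{\mathbf u}=T_{u_k}\circ\cdots\circ T_{u_1}$, $p_{\mathbf u}=p_{u_1}\cdots p_{u_k}$, and $\mathbf u_1^{n}=u_1\cdots u_n$ ($\mathbf u_1^0$ is the empty string, with $T_{\mathbf u_1^0}=\mathrm{id}$). For $\omega\in\Omega^{\mathbb N}$ put $T_\omega^k=T_{\omega_1\cdots\omega_k}$. For $c\in C$: $T_{\mathbf u}(c^-)=\lim_{x\uparrow c}T_{\mathbf u}(x)$, $T_{\mathbf u}(c^+)=\lim_{x\downarrow c}T_{\mathbf u}(x)$, $T_{\mathbf u}'(c^-)=\lim_{x\uparrow c}\prod_{n=1}^kT_{u_n}'(T_{\mathbf u_1^{n-1}}(x))$, and $T_{\mathbf u}'(c^+)=\lim_{x\downarrow c}\prod_{n=1}^kT_{u_n}'(T_{\mathbf u_1^{n-1}}(x))$. Random matching. $R$ has random matching if for every $c\in C$ there exist $M=M_c\in\mathbb N$ and a set $$Y=Y_c\subseteq\{T_\omega^k(c^-):\omega\in\Omega^{\mathbb N},1\le k\le M\}\cap\{T_\omega^k(c^+):\omega\in\Omega^{\mathbb N},1\le k\le M\}$$ such that for every $\omega\in\Omega^{\mathbb N}$ there exist $1\le k_c(\omega),\ell_c(\omega)\le M$ with $T_\omega^{k_c(\omega)}(c^-)\in Y$ and $T_\omega^{\ell_c(\omega)}(c^+)\in Y$. Strong random matching. $R$ has strong random matching if it has random matching and (for the choices of $M_c,Y_c,k_c,\ell_c$ made there) for each $c\in C$ and $y\in Y_c$, $$\sum_{\mathbf u\in\Omega(y)^-}\frac{p_{\mathbf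 u}}{T_{\mathbf u}'(c^-)}=\sum_{\mathbf u\in\Omega(y)^+}\frac{p_{\mathbf u}}{T_{\mathbf u}'(c^+)},$$ where $\Omega(y)^-$ is the set of $\mathbf u\in\bigcup_{k=1}^M\Omega^k$ for which there is $\omega\in\Omega^{\mathbb N}$ with $\mathbf u=\omega_1\cdots\omega_{k_c(\omega)}$ and $T_{\mathbf u}(c^-)=y$, and $\Omega(y)^+$ is the set of $\mathbf u\in\bigcup_{k=1}^M\Omega^k$ for which there is $\omega\in\Omega^{\mathbb N}$ with $\mathbf u=\omega_1\cdots\omega_{\ell_c(\omega)}$ and $T_{\mathbf u}(c^+)=y$.
   Formalization: Added, as the claim fails otherwise: k_c(ω), ℓ_c(ω) depend only on the first k_c(ω), resp. ℓ_c(ω), letters of ω; and the points T_ω^n(c^-), 1≤n<k_c(ω), and T_ω^n(c^+), 1≤n<ℓ_c(ω), form finite sets (automatic for finite Ω). *)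

(* Defs.v *)
From HB Require Import structures.
From mathcomp Require Import all_boot all_order all_algebra.
From mathcomp Require Import all_classical all_reals all_analysis.

Set Implicit Arguments.
Unset Strict Implicit.
Unset Printing Implicit Defensive.

Import Order.TTheory GRing.Theory Num.Theory.
Import numFieldNormedType.Exports.

Local Open Scope classical_set_scope.
Local Open Scope ring_scope.

(* Sum of an absolutely convergent real series indexed by a set.  All the
   signed series below converge absolutely under [expanding_on_average]. *)
Definition rsum (R : realType) (S : choiceType) (D : set S) (f : S -> R) : R :=
  fine (\esum_(i in D) ((EFin \o f)^\+ i) - \esum_(i in D) ((EFin \o f)^\- i))%E.

Section Sequences.
Variable Omega : set nat.

(* Sequences are indexed from 0: w 0 is the first letter of w, and
   [mkseq w n] is the word made of the first n letters of w. *)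
Definition seqs : set (nat -> nat) := [set w | forall n, Omega (w n)].

Definition words : set (seq nat) := [set u | forall j, j \in u -> Omega j].

Definition cylinder (u : seq nat) : set (nat -> nat) :=
  [set w | mkseq w (size u) = u].

(* [t w] is decided by the first [t w] letters of w, so that the words
   [mkseq w (t w)] form a prefix-free family.  Times of first entrance have
   this property, see [first_entrance_stopping]. *)
Definition stopping_rule (t : (nat -> nat) -> nat) : Prop :=
  forall w w', seqs w -> seqs w' ->
    mkseq w' (t w) = mkseq w (t w) -> t w' = t w.

End Sequences.

(* The sigma-algebra generated by the cylinders. *)
Notation seqType := (g_sigma_algebraType (range cylinder)).

Section RandomMap.
Variable R : realType.
Variables (Omega : set nat) (p : nat -> R).
Variables (N : nat) (c : nat -> R) (T : nat -> R -> R).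

Definition Idom : set R := `[c 0%N, c N].

(* Values of p and T at indices outside Omega, of T j outside Idom, and of c at
   indices above N are irrelevant. *)
Record random_map : Prop := RandomMap {
  interval_nondegenerate : (0 < N)%N;
  points_increasing : forall i, (i < N)%N -> c i < c i.+1;
  maps_into : forall j x, Omega j -> Idom x -> Idom (T j x);
  weight_gt0 : forall j, Omega j -> 0 < p j;
  weight_sum : (\esum_(j in Omega) (p j)%:E = 1)%E }.

Definition crit : set R := [set c i | i in [set i | (0 < i < N)%N]].

(* Branch i : 'I_N is the open interval (c i, c i.+1). *)
Record class_RA (k d : 'I_N -> nat -> R) : Prop := ClassRA {
  affine_branches : forall (i : 'I_N) j x, Omega j ->
    c i < x < c i.+1 -> T j x = k i j * x + d i j;
  minimal_partition : forall z, crit z -> exists2 j, Omega j &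
    ~ {for z, continuous (T j)} \/
    ~ (derivable (T j) z 1 /\ {for z, continuous (derive1 (T j))});
  (* The derivative is required to be nonzero since 1 / 0 = 0 in R. *)
  expanding_on_average : exists2 rho : R, 0 < rho < 1 &
    forall x, c 0%N < x < c N -> ~ crit x ->
      (forall j, Omega j -> derive1 (T j) x != 0) /\
      (\esum_(j in Omega) (p j / `|derive1 (T j) x|)%:E <= rho%:E)%E;
  fixed_points_differ : forall i : 'I_N, exists n : 'I_N,
    rsum Omega (fun j => p j / k i j * d i j)
      / (1 - rsum Omega (fun j => p j / k i j)) !=
    rsum Omega (fun j => p j / k n j * d n j)
      / (1 - rsum Omega (fun j => p j / k n j));
  mean_inverse_slope_neq0 : forall i : 'I_N,
    rsum Omega (fun j => p j / k i j) != 0 }.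

Definition word_map (u : seq nat) (x : R) : R :=
  foldl (fun y j => T j y) x u.

Definition word_weight (u : seq nat) : R := \prod_(j <- u) p j.

Definition word_deriv (u : seq nat) (x : R) : R :=
  \prod_(n < size u) derive1 (T (nth 0%N u n)) (word_map (take n u) x).

(* One-sided values and derivatives; F is z^'- or z^'+ for a critical z. *)
Definition val_at (F : set_system R) (u : seq nat) : R := lim (word_map u @ F).

Definition der_at (F : set_system R) (u : seq nat) : R := lim (word_deriv u @ F).

Definition orbit_upto (F : set_system R) (M : nat) : set R :=
  [set y | exists w n, [/\ seqs Omega w, (1 <= n <= M)%N &
                           y = val_at F (mkseq w n)]].

Section Matching.
(* For a critical point z: the bound M z, the set Y z, and the matching times
   kc z w and lc z w of the left and right limits along the sequence w. *)
Variables (M : R -> nat) (Y : R -> set R).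
Variables (kc lc : R -> (nat -> nat) -> nat).

Definition random_matching : Prop := forall z, crit z ->
  Y z `<=` orbit_upto z^'- (M z) `&` orbit_upto z^'+ (M z) /\
  forall w, seqs Omega w ->
    [/\ (1 <= kc z w <= M z)%N, Y z (val_at z^'- (mkseq w (kc z w))),
        (1 <= lc z w <= M z)%N & Y z (val_at z^'+ (mkseq w (lc z w)))].

(* Omega(y)^- for F = z^'- and t = kc z, Omega(y)^+ for F = z^'+ and t = lc z. *)
Definition matched_words (F : set_system R) (m : nat)
    (t : (nat -> nat) -> nat) (y : R) : set (seq nat) :=
  [set u | [/\ words Omega u, (1 <= size u <= m)%N,
               exists2 w, seqs Omega w & u = mkseq w (t w) &
               val_at F u = y]].

Definition strong_random_matching : Prop :=
  random_matching /\
  forall z y, crit z -> Y z y ->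
    rsum (matched_words z^'- (M z) (kc z) y)
      (fun u => word_weight u / der_at z^'- u) =
    rsum (matched_words z^'+ (M z) (lc z) y)
      (fun u => word_weight u / der_at z^'+ u).

End Matching.

(* The points visited strictly between time 0 and the matching time t.  They
   are in general discontinuities of an invariant density, while the points
   visited from time t on cancel.  There are finitely many of them whenever
   Omega is finite, see [finite_prematching_orbit]. *)
Definition prematching_orbit (F : set_system R)
    (t : (nat -> nat) -> nat) : set R :=
  [set y | exists w n, [/\ seqs Omega w, (1 <= n < t w)%N &
                           y = val_at F (mkseq w n)]].

Lemma finite_prematching_orbit (F : set_system R)
    (t : (nat -> nat) -> nat) (m : nat) :
  finite_set Omega -> (forall w, seqs Omega w -> (t w <= m)%N) ->
  finite_set (prematching_orbit F t).
Proof.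
move=> finO tm.
have finW n : finite_set [set u | size u = n /\ words Omega u].
  elim: n => [|n IH].
    by apply: (sub_finite_set _ (finite_set1 [::])) => u /= [/size0nil -> _].
  have := finite_image (fun ju : nat * seq nat => ju.1 :: ju.2)
    (finite_setX finO IH).
  apply: sub_finite_set => -[|j u] /= [su ju] //; case: su => su.
  exists (j, u) => //=; split; first by apply: ju; rewrite inE eqxx.
  by split=> // i iu; apply: ju; rewrite inE iu orbT.
have := bigcup_finite (finite_II m)
  (fun n _ => finite_image (val_at F) (finW n)).
apply: sub_finite_set => y [w [n [Ow /andP[_ nt] ->]]].
exists n => /=; first exact: leq_trans nt (tm _ Ow).
exists (mkseq w n) => //; rewrite size_mkseq; split=> // j /mapP[i _ ->].
exact: Ow.
Qed.

Lemma first_entrance_stopping (F : set_system R) (Y : set R)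
    (t : (nat -> nat) -> nat) :
  (forall w, seqs Omega w ->
     [/\ (1 <= t w)%N, Y (val_at F (mkseq w (t w))) &
         forall n, (1 <= n < t w)%N -> ~ Y (val_at F (mkseq w n))]) ->
  stopping_rule Omega t.
Proof.
move=> H w w' Ow Ow' e; have [t1 Yt nY] := H _ Ow.
have [t1' Yt' nY'] := H _ Ow'.
case: (ltngtP (t w') (t w)) => // lt.
- case: (nY (t w')); first by rewrite t1' lt.
  suff -> : mkseq w (t w') = mkseq w' (t w') by [].
  have tk v : mkseq v (t w') = take (t w') (mkseq v (t w)).
    by rewrite -map_take take_iota (minn_idPl (ltnW lt)).
  by rewrite !tk e.
- by case: (nY' (t w)); rewrite ?t1 ?lt// e.
Qed.

Definition skew_product (wx : seqType * measurableTypeR R) :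
    seqType * measurableTypeR R :=
  (fun n => wx.1 n.+1, T (wx.1 0%N) wx.2).

Definition bernoulli_measure (m : probability seqType R) : Prop :=
  forall u, words Omega u -> m (cylinder u) = (word_weight u)%:E.

Definition R_invariant (m : probability seqType R)
    (mu : probability (measurableTypeR R) R) : Prop :=
  forall A : set (seqType * measurableTypeR R),
    measurable A -> A `<=` seqs Omega `*` Idom ->
    ((m \x mu) ((seqs Omega `*` Idom) `&` skew_product @^-1` A) = (m \x mu) A)%E.

Definition stationary (mu : probability (measurableTypeR R) R) : Prop :=
  forall B : set (measurableTypeR R), measurable B -> B `<=` Idom ->
    (mu B = \esum_(j in Omega) ((p j)%:E * mu (Idom `&` T j @^-1` B)))%E.

(* A probability measure on Idom is encoded as one on R giving Idom mass 1. *)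
Definition stationary_acim (mu : probability (measurableTypeR R) R) : Prop :=
  [/\ mu Idom = 1%E, mu `<< (@lebesgue_measure R) & stationary mu].

Definition density_of (mu : probability (measurableTypeR R) R) (f : R -> R) :=
  lebesgue_measure.-integrable Idom (EFin \o f) /\
  forall B : set (measurableTypeR R), measurable B -> B `<=` Idom ->
    mu B = (\int[lebesgue_measure]_(x in B) (f x)%:E)%E.

Definition invariant_density (f : R -> R) : Prop :=
  exists2 mu, stationary_acim mu & density_of mu f.

Definition piecewise_constant (f : R -> R) : Prop :=
  exists n (J : 'I_n -> interval R) (a : 'I_n -> R),
    [/\ trivIset setT (fun i => [set` J i]),
        \bigcup_i [set` J i] = Idom &
        forall i, {ae lebesgue_measure, forall x, x \in J i -> f x = a i}].

End RandomMap.

(* Main.v *)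
Require Import Defs.
From HB Require Import structures.
From mathcomp Require Import all_boot all_order all_algebra.
From mathcomp Require Import all_classical all_reals all_analysis.
From mathcomp Require Import measurable_realfun lra.
Set Implicit Arguments.
Unset Strict Implicit.
Unset Printing Implicit Defensive.
Import Order.TTheory GRing.Theory Num.Theory.
Import numFieldNormedType.Exports.
Local Open Scope classical_set_scope.
Local Open Scope ring_scope.

(* Let Psi be the primitive of a test function psi, and let W Psi be the primitive
   of its average  sum_j p_j psi(T_j x).  Then
     W Psi (y) = Q Psi (y) + sum_m 1[c_m < y] J_m(Psi) - Q Psi (c_0),
   where  Q phi (x) = sum_j p_j / k_ij phi(T_j x)  is a contraction for the sup
   norm, the map being expanding on average, and J_m(Psi) is the difference of
   the two one-sided values of Q Psi at c_m.  Put S = (1 - Q)^-1.  The functional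
   Lam = sum_m kap_m J_m o S satisfies  Lam o W = Lam  as soon as kap solves a
   linear system  kap (1 - B) = 0.

   Expanding S along the matching times shows that strong random matching gives
   J_m(S eta) = 0 for every bounded eta vanishing on the finite set D formed by
   c_0, c_N, the critical points and the prematching orbits.  Hence Lam(Psi)
   depends only on the values of Psi on D, i.e. it is the integral of psi against
   a function that is constant between consecutive points of D.  A kap <> 0
   exists: otherwise every evaluation Psi(y) would be a coboundary
   A(Psi) - A(W Psi), which fails for psi = 1.  The absolute value of this step
   function, normalised, is an invariant density.

   In general Psi(y) = Lam(Psi) + A(Psi) - A(W Psi) for suitable Lam and A.  So if
   Psi1 = Psi2 on D, the sums of (W^t Psi1 - W^t Psi2)(y) over t < N are bounded
   in N, and every absolutely continuous stationary probability gives psi1 and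
   psi2 the same integral.  For psi1 = 1_B with B inside a cell of D and psi2 a
   multiple of the indicator of that cell, this says that any invariant density
   is constant on the cell. *)

(** * Algebra and estimates for absolutely convergent signed sums *)

Section AbsolutelyConvergentSums.
Variable R : realType.

(** The identity J_m(S eta) = 0 cannot be read off from matching directly. Expanding S eta up to the
    matching times leaves its values at the matched points, reached from either side, and the two
    expansions cancel only if S eta is already known not to depend on the side. The circle is broken
    on one-sided points: strong matching cancels the part of S eta common to both sides, the weights
    of the words read up to matching sum in absolute value to at most rho, and so the side
    dependence is at most rho times itself.

    Primitives are used rather than densities because on them averaging is a sup norm contraction
    plus an operator of finite rank, which reduces invariance to linear algebra in n unknowns. That
    algebra rests on one alternative: a nonzero invariant functional cannot be a coboundary, since
    its sums over N steps would be both bounded and proportional to N. A dimension count then writes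
    each evaluation at a point as an invariant functional plus a coboundary. *)

Definition abs_sum_le (S : choiceType) (D : set S) (f : S -> R) (C : R) : Prop :=
  (\esum_(i in D) `|f i|%:E <= C%:E)%E.

Lemma abs_sum_le_summable (S : choiceType) (D : set S) f C :
  abs_sum_le D f C -> summable D (EFin \o f).
Proof. by move=> h; rewrite /summable; apply: le_lt_trans h _; rewrite ltry. Qed.

Lemma abs_sum_leW (S : choiceType) (D D' : set S) (f g : S -> R) C C' :
  D `<=` D' -> (forall i, D i -> `|f i| <= `|g i|) -> C' <= C ->
  abs_sum_le D' g C' -> abs_sum_le D f C.
Proof.
move=> DD fg CC h; rewrite /abs_sum_le (le_trans _ (le_trans h _))// ?lee_fin//.
apply: (@le_trans _ _ (\esum_(i in D) `|g i|%:E)%E).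
  by apply: le_esum => i Di; rewrite lee_fin fg.
rewrite esum_mkcond [leRHS]esum_mkcond; apply: le_esum => i _.
case: ifPn => //; last by case: ifP.
by rewrite inE => /DD; rewrite -inE => ->.
Qed.

Lemma esum_mulr (S : choiceType) (D : set S) (f : S -> R) B : 0 <= B ->
  (forall i, D i -> 0 <= f i) ->
  (\esum_(i in D) (f i * B)%:E = (\esum_(i in D) (f i)%:E) * B%:E)%E.
Proof.
move=> B0 f0; have [->|Bn0] := eqVneq B 0.
  by rewrite mule0 esum1// => i _; rewrite mulr0.
have Bp : 0 < B by rewrite lt_neqAle eq_sym Bn0.
rewrite /esum muleC -ereal_sup_pZl; last exact: Bp.
congr ereal_sup; apply/seteqP; split => x /=.
  move=> [X [finX XD] <-]; exists (\sum_(x \in X) (f x)%:E)%E; first by exists X.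
  by rewrite !fsbig_finite//= !sumEFin -EFinM mulr_sumr; congr EFin; apply: eq_bigr => i _; rewrite mulrC.
move=> [_ [X [finX XD] <-] <-]; exists X => //.
by rewrite !fsbig_finite//= !sumEFin -EFinM mulr_sumr; congr EFin; apply: eq_bigr => i _; rewrite mulrC.
Qed.

(** The constant is kept explicit, instead of mere summability, because with [C = rho] this estimate
    is the contraction property of Q. *)
Lemma abs_sum_leM (S : choiceType) (D : set S) (q g : S -> R) C B :
  (forall i, D i -> `|g i| <= B) -> 0 <= B -> abs_sum_le D q C ->
  abs_sum_le D (fun i => q i * g i) (C * B).
Proof.
move=> gB B0 h; rewrite /abs_sum_le.
apply: (@le_trans _ _ (\esum_(i in D) (`|q i| * B)%:E)%E).
  by apply: le_esum => i Di; rewrite lee_fin normrM ler_wpM2l// gB.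
by rewrite esum_mulr// EFinM lee_wpmul2r.
Qed.

Lemma abs_sum_leD (S : choiceType) (D : set S) (f g : S -> R) C B :
  abs_sum_le D f C -> abs_sum_le D g B ->
  abs_sum_le D (fun i => f i + g i) (C + B).
Proof.
move=> h1 h2; rewrite /abs_sum_le EFinD.
apply: (@le_trans _ _ (\esum_(i in D) (`|f i|%:E + `|g i|%:E))%E).
  by apply: le_esum => i Di; rewrite -EFinD lee_fin ler_normD.
by rewrite esumD//; apply: leeD.
Qed.

Lemma rsumB (S : choiceType) (D : set S) (f g : S -> R) :
  (forall i, D i -> 0 <= f i) -> (forall i, D i -> 0 <= g i) ->
  summable D (EFin \o f) -> summable D (EFin \o g) ->
  rsum D (fun i => f i - g i) =
  fine (\esum_(i in D) (f i)%:E) - fine (\esum_(i in D) (g i)%:E).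
Proof.
move=> f0 g0 sf sg; rewrite /rsum.
have -> : EFin \o (fun i => f i - g i) = ((EFin \o f) \- (EFin \o g))%E by [].
rewrite esumB//.
rewrite fineB//.
- move: sf; rewrite summableE (@eq_esum _ _ _ _ (EFin \o f))// => i Di.
  by rewrite gee0_abs// lee_fin f0.
- move: sg; rewrite summableE (@eq_esum _ _ _ _ (EFin \o g))// => i Di.
  by rewrite gee0_abs// lee_fin g0.
Qed.

Lemma eq_rsum (S : choiceType) (D : set S) (f g : S -> R) :
  (forall i, D i -> f i = g i) -> rsum D f = rsum D g.
Proof.
by move=> fg; rewrite /rsum; congr (fine (_ - _)%E); apply: eq_esum => i Di;
  rewrite ?funeposE ?funenegE /= fg.
Qed.

(** Real-valued positive part. [rsum] is a difference of extended-real sums; through [pp] its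
    properties become properties of sums of nonnegative reals, whose finiteness is supplied by
    [abs_sum_le]. *)
Let pp (x : R) := Num.max x 0.

Let pp_ge0 x : 0 <= pp x.
Proof. by rewrite /pp le_max lexx orbT. Qed.

#[local] Hint Resolve pp_ge0 : core.

Let ppB x : pp x - pp (- x) = x.
Proof.
rewrite /pp; case/orP: (le_total 0 x) => x0.
  by rewrite max_l// max_r ?subr0// oppr_le0.
by rewrite max_r// max_l ?sub0r ?opprK// oppr_ge0.
Qed.

Let ppD x : pp x + pp (- x) = `|x|.
Proof.
rewrite /pp; case/orP: (le_total 0 x) => x0.
  by rewrite max_l// max_r ?addr0 ?oppr_le0// ger0_norm.
by rewrite max_r// max_l ?add0r ?oppr_ge0// ler0_norm.
Qed.

Let pp_le x : `|pp x| <= `|x|.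
Proof. by rewrite ger0_norm// -ppD lerDl. Qed.

Let ppN_le x : `|pp (- x)| <= `|x|.
Proof. by rewrite -[leRHS]normrN. Qed.

Let abs_pp (S : choiceType) (D : set S) (f : S -> R) C :
  abs_sum_le D f C -> abs_sum_le D (pp \o f) C.
Proof. by move=> h; apply: (@abs_sum_leW _ D D _ f C C) => // i _; exact: pp_le. Qed.

Let abs_ppN (S : choiceType) (D : set S) (f : S -> R) C :
  abs_sum_le D f C -> abs_sum_le D (fun i => pp (- f i)) C.
Proof. by move=> h; apply: (@abs_sum_leW _ D D _ f C C) => // i _; exact: ppN_le. Qed.

Lemma rsum_posneg (S : choiceType) (D : set S) (f : S -> R) C :
  abs_sum_le D f C ->
  rsum D f = fine (\esum_(i in D) (pp (f i))%:E)
           - fine (\esum_(i in D) (pp (- f i))%:E).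
Proof.
move=> h; rewrite -rsumB.
- by apply: eq_rsum => i _; rewrite ppB.
- by move=> i _.
- by move=> i _.
- exact: abs_sum_le_summable (abs_pp h).
- exact: abs_sum_le_summable (abs_ppN h).
Qed.

Lemma fin_esum (S : choiceType) (D : set S) (f : S -> R) C :
  (forall i, D i -> 0 <= f i) -> abs_sum_le D f C ->
  (\esum_(i in D) (f i)%:E)%E \is a fin_num.
Proof.
move=> f0 h; have := abs_sum_le_summable h.
rewrite summableE (@eq_esum _ _ _ _ (EFin \o f))// => i Di.
by rewrite gee0_abs// lee_fin f0.
Qed.

Let fin_pp (S : choiceType) (D : set S) (f : S -> R) C : abs_sum_le D f C ->
  (\esum_(i in D) (pp (f i))%:E)%E \is a fin_num.
Proof. by move=> /abs_pp /fin_esum; apply => i _; exact: pp_ge0. Qed.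

Let fin_ppN (S : choiceType) (D : set S) (f : S -> R) C : abs_sum_le D f C ->
  (\esum_(i in D) (pp (- f i))%:E)%E \is a fin_num.
Proof. by move=> /abs_ppN /fin_esum; apply => i _; exact: pp_ge0. Qed.

Lemma rsum_ge0E (S : choiceType) (D : set S) (f : S -> R) :
  (forall i, D i -> 0 <= f i) -> rsum D f = fine (\esum_(i in D) (f i)%:E).
Proof.
move=> f0; rewrite /rsum [X in (_ - X)%E]esum1; last first.
  move=> i Di; rewrite funenegE /= -EFin_max; congr EFin.
  by rewrite max_r// oppr_le0 f0.
rewrite sube0; congr fine; apply: eq_esum => i Di.
by rewrite funeposE /= -EFin_max max_l// f0.
Qed.

Lemma ler_norm_rsum (S : choiceType) (D : set S) (f : S -> R) C :
  abs_sum_le D f C -> `|rsum D f| <= C.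
Proof.
move=> h; rewrite (rsum_posneg h).
set a := (\esum_(i in D) (pp (f i))%:E)%E.
set b := (\esum_(i in D) (pp (- f i))%:E)%E.
have a0 : (0 <= a)%E by rewrite /a; apply: esum_ge0 => i _; rewrite lee_fin.
have b0 : (0 <= b)%E by rewrite /b; apply: esum_ge0 => i _; rewrite lee_fin.
have abC : (a + b <= C%:E)%E.
  rewrite /a /b -esumD; [|by move=> i _; rewrite lee_fin..].
  rewrite (le_trans _ h)//; apply: le_esum => i _; by rewrite -EFinD ppD.
have fa : a \is a fin_num by exact: fin_pp h.
have fb : b \is a fin_num by exact: fin_ppN h.
have := fine_ge0 a0; have := fine_ge0 b0; move: abC.
rewrite -(fineK fa) -(fineK fb) -EFinD lee_fin /= => h1 h2 h3.
by rewrite ler_norml; apply/andP; split; lra.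
Qed.

Lemma rsumD (S : choiceType) (D : set S) (f g : S -> R) C B :
  abs_sum_le D f C -> abs_sum_le D g B ->
  rsum D (fun i => f i + g i) = rsum D f + rsum D g.
Proof.
move=> hf hg; rewrite (rsum_posneg hf) (rsum_posneg hg).
rewrite (@eq_rsum _ _ _ (fun i => (pp (f i) + pp (g i)) -
   (pp (- f i) + pp (- g i)))); last first.
  by move=> i _; rewrite opprD addrACA !ppB.
rewrite rsumB; last 4 first.
- by move=> i _; rewrite addr_ge0.
- by move=> i _; rewrite addr_ge0.
- by apply: abs_sum_le_summable (abs_sum_leD (abs_pp hf) (abs_pp hg)).
- by apply: abs_sum_le_summable (abs_sum_leD (abs_ppN hf) (abs_ppN hg)).
have ED (u v : S -> R) U V : (forall i, 0 <= u i) -> (forall i, 0 <= v i) ->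
    abs_sum_le D u U -> abs_sum_le D v V ->
  fine (\esum_(i in D) (u i + v i)%:E) =
  fine (\esum_(i in D) (u i)%:E) + fine (\esum_(i in D) (v i)%:E).
  move=> u0 v0 hu hv; under eq_esum do rewrite EFinD.
  rewrite esumD; [|by move=> i _; rewrite lee_fin..].
  by rewrite fineD// ?(fin_esum _ hu)// (fin_esum _ hv).
rewrite (ED _ _ _ _ _ _ (abs_pp hf) (abs_pp hg))//; [|by move=> i; exact: pp_ge0..].
rewrite (ED _ _ _ _ _ _ (abs_ppN hf) (abs_ppN hg))//.
by rewrite opprD addrACA.
Qed.

Lemma rsumN (S : choiceType) (D : set S) (f : S -> R) C :
  abs_sum_le D f C -> rsum D (fun i => - f i) = - rsum D f.
Proof.
move=> hf; have hN : abs_sum_le D (fun i => - f i) C.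
  by apply: (@abs_sum_leW _ D D _ f C C) => // i _; rewrite normrN.
rewrite (rsum_posneg hf) (rsum_posneg hN) opprB; congr (_ - fine _).
by apply: eq_esum => i _; rewrite opprK.
Qed.

Lemma rsumMr (S : choiceType) (D : set S) (f : S -> R) C a :
  abs_sum_le D f C -> rsum D (fun i => f i * a) = rsum D f * a.
Proof.
wlog a0 : a / 0 <= a => [hw|] hf.
  have [a0|a0] := leP 0 a; first exact: hw.
  have aN : 0 <= - a by rewrite oppr_ge0 ltW.
  have := hw _ aN hf; under eq_rsum do rewrite mulrN.
  rewrite mulrN (rsumN (C := C * `|a|)); first by move/oppr_inj.
  by apply: abs_sum_leM hf => //.
have hfa : abs_sum_le D (fun i => f i * a) (C * a).
  by apply: abs_sum_leM hf => // i _; rewrite ger0_norm.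
rewrite (rsum_posneg hf) (rsum_posneg hfa) mulrBl.
have mx x : pp (x * a) = pp x * a.
  rewrite /pp; case/orP: (le_total 0 x) => x0; first by rewrite !max_l// mulr_ge0.
  by rewrite !max_r ?mul0r// -(mul0r a) ler_wpM2r.
congr (_ - _).
  under eq_esum do rewrite mx; rewrite esum_mulr// fineM//.
  exact: fin_pp hf.
under eq_esum do rewrite -mulNr mx; rewrite esum_mulr// fineM//.
exact: fin_ppN hf.
Qed.

Lemma rsum_set1 (S : choiceType) (x : S) (f : S -> R) : rsum [set x] f = f x.
Proof.
have h : abs_sum_le [set x] f `|f x| by rewrite /abs_sum_le esum_set1// lee_fin.
by rewrite (rsum_posneg h) !esum_set1 ?lee_fin//= ppB.
Qed.

Lemma esum_fibers (S J : choiceType) (D : set S) (K : set J) (g : S -> J)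
    (a : S -> \bar R) :
  (forall i, D i -> K (g i)) -> (forall i, D i -> (0 <= a i)%E) ->
  (\esum_(i in D) a i =
   \esum_(j in K) \esum_(i in D `&` g @^-1` [set j]) a i)%E.
Proof.
move=> DK a0; rewrite esum_esum; last by move=> j i _ [Di _]; exact: a0.
apply/esym; rewrite (reindex_esum D _ (fun i => (g i, i)))//=.
split => [i Di|i j _ _ [_ ->]//|[j i] /= [Kj [Di gij]]].
  by split => //=; exact: DK.
by exists i => //; rewrite gij.
Qed.

Lemma rsum_image (S S' : choiceType) (D : set S) (e : S -> S') (f : S' -> R) :
  set_inj D e -> rsum (e @` D) f = rsum D (f \o e).
Proof.
move=> inj_e; rewrite /rsum !esum_image//; congr (fine (_ - _)%E);
by apply: eq_esum => i _; rewrite ?funeposE ?funenegE.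
Qed.

(** Fubini for a partition of the index set, applied separately to the positive and negative parts.
    Words are grouped in this way by first letter and, for matched words, by end point. *)
Lemma rsum_fibers (S J : choiceType) (D : set S) (K : set J) (g : S -> J)
    (f : S -> R) C :
  (forall i, D i -> K (g i)) -> abs_sum_le D f C ->
  rsum D f = rsum K (fun j => rsum (D `&` g @^-1` [set j]) f).
Proof.
move=> DK h.
have hj j : abs_sum_le (D `&` g @^-1` [set j]) f C.
  by apply: (@abs_sum_leW _ _ D _ f C C) => // i [].
have key (u : S -> R) : (forall i, 0 <= u i) -> abs_sum_le D u C ->
    fine (\esum_(i in D) (u i)%:E)%E =
    fine (\esum_(j in K) (fine (\esum_(i in D `&` g @^-1` [set j]) (u i)%:E))%:E)%E /\
    summable K (EFin \o (fun j => fine (\esum_(i in D `&` g @^-1` [set j]) (u i)%:E))).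
  move=> u0 hu.
  have ufin j : (\esum_(i in D `&` g @^-1` [set j]) (u i)%:E)%E \is a fin_num.
    by apply: (@fin_esum _ _ _ C) => //; apply: (@abs_sum_leW _ _ D _ u C C) => // i [].
  have E : (\esum_(i in D) (u i)%:E)%E =
    (\esum_(j in K) (fine (\esum_(i in D `&` g @^-1` [set j]) (u i)%:E))%:E)%E.
    rewrite (esum_fibers DK); last by move=> i _; rewrite lee_fin.
    by apply: eq_esum => j _; rewrite fineK.
  rewrite E; split => //; rewrite /summable.
  rewrite (eq_esum (b := fun j => (fine (\esum_(i in D `&` g @^-1` [set j]) (u i)%:E))%:E)%E).
    by rewrite -E -ge0_fin_numE ?(fin_esum _ hu)//; apply: esum_ge0 => i _; rewrite lee_fin.
  move=> j _; rewrite /= ger0_norm// fine_ge0//.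
  by apply: esum_ge0 => i _; rewrite lee_fin.
rewrite (rsum_posneg h) (eq_rsum (g := fun j =>
   fine (\esum_(i in D `&` g @^-1` [set j]) (pp (f i))%:E) -
   fine (\esum_(i in D `&` g @^-1` [set j]) (pp (- f i))%:E))); last first.
  by move=> j _; rewrite (rsum_posneg (hj j)).
have [E1 s1] := key (pp \o f) (fun=> pp_ge0 _) (abs_pp h).
have [E2 s2] := key (fun i => pp (- f i)) (fun=> pp_ge0 _) (abs_ppN h).
rewrite rsumB//; first by rewrite E1 E2.
- by move=> j _; apply: fine_ge0; apply: esum_ge0 => i _; rewrite lee_fin.
- by move=> j _; apply: fine_ge0; apply: esum_ge0 => i _; rewrite lee_fin.
Qed.

End AbsolutelyConvergentSums.

(** * The weighted composition operator Q and its resolvent *)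

Section WeightedComposition.
Variables (R : realType) (Omega : set nat) (X : Type).
Variables (q : X -> nat -> R) (st : X -> nat -> X) (rho : R).
Hypotheses (rho0 : 0 <= rho) (rho1 : rho < 1).
Hypothesis abs_q : forall x, abs_sum_le Omega (q x) rho.
Implicit Types (phi psi V : X -> R) (D : set X).

Definition norm_bounded phi := exists C, forall x, `|phi x| <= C.

(** The operator Q of the overview on an abstract state space, since it acts both on functions on
    the line and on functions of one-sided points. *)
Definition wcomp phi (x : X) : R :=
  rsum Omega (fun j => q x j * phi (st x j)).

Lemma norm_boundedP phi :
  norm_bounded phi -> exists2 C, 0 <= C & forall x, `|phi x| <= C.
Proof.
by move=> [C h]; exists `|C| => // x; apply: le_trans (h x) (ler_norm _).
Qed.

Lemma norm_bounded_lin phi psi a : norm_bounded phi -> norm_bounded psi ->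
  norm_bounded (fun x => phi x + a * psi x).
Proof.
move=> [C h] [B k]; exists (C + `|a| * B) => x.
by rewrite (le_trans (ler_normD _ _))// lerD// normrM ler_wpM2l.
Qed.

Lemma abs_wcomp phi C x : 0 <= C ->
  (forall j, Omega j -> `|phi (st x j)| <= C) ->
  abs_sum_le Omega (fun j => q x j * phi (st x j)) (rho * C).
Proof.
move=> C0 h.
exact: (abs_sum_leM (g := fun j => phi (st x j)) h C0 (abs_q x)).
Qed.

Lemma wcomp_le phi C x : 0 <= C ->
  (forall j, Omega j -> `|phi (st x j)| <= C) -> `|wcomp phi x| <= rho * C.
Proof. by move=> C0 h; exact: ler_norm_rsum (abs_wcomp C0 h). Qed.

Lemma bounded_wcomp phi : norm_bounded phi -> norm_bounded (wcomp phi).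
Proof.
by move=> /norm_boundedP[C C0 h]; exists (rho * C) => x; exact: wcomp_le.
Qed.

Lemma wcomp_lin phi psi a x : norm_bounded phi -> norm_bounded psi ->
  wcomp (fun x => phi x + a * psi x) x = wcomp phi x + a * wcomp psi x.
Proof.
move=> /norm_boundedP[C C0 h] /norm_boundedP[B B0 k].
have h1 := @abs_wcomp phi C x C0 (fun j _ => h (st x j)).
have h2 := @abs_wcomp psi B x B0 (fun j _ => k (st x j)).
rewrite /wcomp [in RHS]mulrC -(rsumMr a h2).
have h3 : abs_sum_le Omega (fun j => q x j * psi (st x j) * a) (rho * B * `|a|).
  exact: (abs_sum_leM (g := fun=> a) _ _ h2).
by rewrite -(rsumD h1 h3); apply: eq_rsum => j _; rewrite mulrDr mulrCA [a * _]mulrC.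
Qed.

Lemma eq_wcomp phi psi x :
  (forall j, Omega j -> phi (st x j) = psi (st x j)) ->
  wcomp phi x = wcomp psi x.
Proof. by move=> h; apply: eq_rsum => j /h ->. Qed.

(** Every bound on [z] improves by the factor rho, so [|z| <= rho ^ n C] for all n. It is relative
    to a set because the improvement may be available only at points of I. *)
Lemma contraction_eq0 (Y : Type) (D : set Y) (z : Y -> R) C : 0 <= C ->
  (forall y, D y -> `|z y| <= C) ->
  (forall Z, 0 <= Z -> (forall y, D y -> `|z y| <= Z) ->
     forall y, D y -> `|z y| <= rho * Z) ->
  forall y, D y -> z y = 0.
Proof.
move=> C0 zC contr.
have zn n : forall y, D y -> `|z y| <= rho ^+ n * C.
  elim: n => [|n IH]; first by move=> y Dy; rewrite mul1r zC.
  move=> y Dy; rewrite exprS -mulrA; apply: contr => //.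
  by rewrite mulr_ge0// exprn_ge0.
move=> y Dy; apply/eqP; rewrite -normr_le0.
have lim0 : (fun n => rho ^+ n * C) @ \oo --> (0 : R).
  rewrite -(mul0r C); apply: cvgMl; apply: cvg_expr.
  by rewrite ger0_norm.
rewrite -(cvg_lim _ lim0)//; apply: limr_ge; first by apply/cvg_ex; exists 0.
by apply: nearW => n; exact: zn.
Qed.

(** The Neumann partial sum phi + Q phi + ... + Q^n phi in Horner form, so that the error at one
    step is Q applied to the error at the step before. *)
Definition witer phi n : X -> R :=
  iter n (fun V x => phi x + wcomp V x) phi.

(* The solution of [V = phi + wcomp V], see [resolventE]. *)
Definition resolvent phi (x : X) : R := limn (fun n => witer phi n x).

Lemma witer_le phi C n x : 0 <= C -> (forall x, `|phi x| <= C) ->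
  `|witer phi n x| <= C / (1 - rho).
Proof.
move=> C0 h; have r0 : 0 < 1 - rho by rewrite subr_gt0.
have CC : C <= C / (1 - rho).
  by rewrite ler_pdivlMr// ler_piMr// gerBl.
elim: n x => [|n IH] x /=; first exact: le_trans (h x) CC.
rewrite (le_trans (ler_normD _ _))//.
have k := @wcomp_le (witer phi n) _ x (le_trans C0 CC) (fun j _ => IH (st x j)).
apply: le_trans (lerD (h x) k) _.
have -> : C = C / (1 - rho) * (1 - rho) by rewrite divfK// gt_eqF.
set D := C / (1 - rho); rewrite -[leLHS]/(D * (1 - rho) + rho * ((D * (1 - rho))/(1-rho))).
by rewrite mulfK ?gt_eqF//; lra.
Qed.

Lemma bounded_witer phi n : norm_bounded phi -> norm_bounded (witer phi n).
Proof.
by move=> /norm_boundedP[C C0 h]; exists (C / (1 - rho)) => x; exact: witer_le.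
Qed.

Lemma witer_cauchy phi C n m x : 0 <= C -> (forall x, `|phi x| <= C) ->
  `|witer phi (n + m) x - witer phi n x| <= rho ^+ n * (2 * (C / (1 - rho))).
Proof.
move=> C0 h; elim: n x => [|n IH] x.
  rewrite expr0 mul1r (le_trans (ler_normB _ _))//.
  by have := witer_le (0 + m) x C0 h; have := witer_le 0 x C0 h; lra.
have bphi : norm_bounded phi by exists C.
rewrite addSn /= [phi x + _]addrC addrKA.
have -> : wcomp (witer phi (n + m)) x - wcomp (witer phi n) x =
    wcomp (fun x => witer phi (n + m) x + -1 * witer phi n x) x.
  by rewrite wcomp_lin ?mulN1r//; exact: bounded_witer.
rewrite exprS -mulrA; apply: wcomp_le => [|j _]; last by rewrite mulN1r.
by rewrite mulr_ge0 ?exprn_ge0// mulr_ge0// divr_ge0// subr_ge0 ltW.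
Qed.

Lemma witer_cvg phi x : norm_bounded phi -> cvgn (fun n => witer phi n x).
Proof.
move=> /norm_boundedP[C C0 h]; apply/cauchy_cvgP; apply: cauchy_exP => e e0.
have lim0 : (fun n => rho ^+ n * (2 * (C / (1 - rho)))) @ \oo --> (0 : R).
  rewrite -(mul0r (2 * (C / (1 - rho)))); apply: cvgMl; apply: cvg_expr.
  by rewrite ger0_norm.
have [N _ NP] := cvgr0_norm_lt _ lim0 _ e0.
exists (witer phi N x); exists N => // n /= Nn.
rewrite /ball /= distrC -(subnKC Nn).
apply: le_lt_trans (witer_cauchy N (n - N) x C0 h) _.
by apply: le_lt_trans (ler_norm _) (NP N _) => /=.
Qed.

Lemma resolvent_dist phi C n x : 0 <= C -> (forall x, `|phi x| <= C) ->
  `|resolvent phi x - witer phi n x| <= rho ^+ n * (2 * (C / (1 - rho))).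
Proof.
move=> C0 h; have cv : cvgn (fun m => witer phi m x) by apply: witer_cvg; exists C.
have cv2 : (fun m => `|witer phi m x - witer phi n x|) @ \oo -->
    `|resolvent phi x - witer phi n x|.
  by apply: cvg_norm; apply: cvgB; [exact: cv|exact: cvg_cst].
rewrite -(cvg_lim _ cv2)//; apply: limr_le; first by apply/cvg_ex; eexists; exact: cv2.
by exists n => // m /= nm; rewrite -(subnKC nm); exact: witer_cauchy.
Qed.

Lemma resolvent_le phi C x : 0 <= C -> (forall x, `|phi x| <= C) ->
  `|resolvent phi x| <= C / (1 - rho).
Proof.
move=> C0 h; have cv : cvgn (fun m => witer phi m x) by apply: witer_cvg; exists C.
rewrite -(cvg_lim _ (cvg_norm cv))//; apply: limr_le.
  by apply/cvg_ex; eexists; exact: cvg_norm cv.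
by apply: nearW => n; exact: witer_le.
Qed.

Lemma bounded_resolvent phi : norm_bounded phi -> norm_bounded (resolvent phi).
Proof.
by move=> /norm_boundedP[C C0 h]; exists (C / (1 - rho)) => x; exact: resolvent_le.
Qed.

(** The limit passes through the infinite sum in Q because the error bound [resolvent_dist] is
    uniform in the point: comparing both sides with [witer phi n.+1] leaves at most twice
    [rho ^+ n.+1 * K]. *)
Lemma resolventE phi x : norm_bounded phi ->
  resolvent phi x = phi x + wcomp (resolvent phi) x.
Proof.
move=> bphi; have [C C0 h] := norm_boundedP bphi.
pose K := 2 * (C / (1 - rho)).
have K0 : 0 <= K by rewrite mulr_ge0// divr_ge0// subr_ge0 ltW.
have lim0 : (fun n => 2 * (rho ^+ n.+1 * K)) @ \oo --> (0 : R).
  rewrite -(mulr0 2); apply: cvgMr; rewrite -(mul0r K); apply: cvgMl.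
  rewrite (cvg_shiftS (fun n => rho ^+ n)); apply: cvg_expr.
  by rewrite ger0_norm.
apply/eqP; rewrite -subr_eq0 -normr_le0.
rewrite -(cvg_lim _ lim0)//; apply: limr_ge; first by apply/cvg_ex; exists 0.
apply: nearW => n.
have h1 := resolvent_dist n.+1 x C0 h.
have : `|wcomp (fun x => witer phi n x + -1 * resolvent phi x) x| <= rho * (rho ^+ n * K).
  apply: wcomp_le => [|j _]; first by rewrite mulr_ge0// exprn_ge0.
  by rewrite mulN1r distrC; exact: resolvent_dist.
rewrite wcomp_lin; [|exact: bounded_witer|exact: bounded_resolvent].
rewrite mulrA -exprS => h2.
have -> : resolvent phi x - (phi x + wcomp (resolvent phi) x) =
   (resolvent phi x - witer phi n.+1 x) +
   (wcomp (witer phi n) x + -1 * wcomp (resolvent phi) x).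
  by rewrite /=; lra.
by rewrite (le_trans (ler_normD _ _))// mulr2n mulrDl mul1r lerD.
Qed.

(** The difference of two solutions is reproduced by Q, so it contracts to 0. Working on a forward
    invariant set allows functions known only on I to be compared. *)
Lemma resolvent_unique D phi V C :
  (forall x j, D x -> Omega j -> D (st x j)) -> norm_bounded phi ->
  (forall x, D x -> `|V x| <= C) ->
  (forall x, D x -> V x = phi x + wcomp V x) ->
  forall x, D x -> V x = resolvent phi x.
Proof.
move=> Dst bphi VC VE x Dx; apply/eqP; rewrite -subr_eq0; apply/eqP.
have [B B0 h] := norm_boundedP (bounded_resolvent bphi).
move: x Dx; apply: (@contraction_eq0 _ D _ (`|C| + B)); first by rewrite addr_ge0.
  move=> x Dx; rewrite (le_trans (ler_normB _ _))// lerD//.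
  exact: le_trans (VC _ Dx) (ler_norm _).
move=> Z Z0 hZ x Dx; rewrite VE// resolventE// opprD addrACA subrr add0r.
have bV : abs_sum_le Omega (fun j => q x j * V (st x j)) (rho * `|C|).
  by apply: abs_wcomp => // j Oj; apply: le_trans (VC _ (Dst _ _ Dx Oj)) (ler_norm _).
have bR : abs_sum_le Omega (fun j => q x j * resolvent phi (st x j)) (rho * B).
  by apply: abs_wcomp.
have bRN : abs_sum_le Omega (fun j => - (q x j * resolvent phi (st x j))) (rho * B).
  by apply: abs_sum_leW bR => // j _; rewrite normrN.
rewrite /wcomp -(rsumN bR) -(rsumD bV bRN).
under eq_rsum do rewrite -mulrBr.
by apply: (wcomp_le (phi := fun x => V x - resolvent phi x)) => // j Oj; apply: hZ; exact: Dst.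
Qed.

Lemma eq_resolvent D phi psi : (forall x j, D x -> Omega j -> D (st x j)) ->
  norm_bounded phi -> norm_bounded psi -> (forall x, D x -> phi x = psi x) ->
  forall x, D x -> resolvent phi x = resolvent psi x.
Proof.
move=> Dst bphi bpsi e; have [C h] := bounded_resolvent bphi.
apply: (resolvent_unique (C := C)) => // x Dx.
by rewrite -e// -resolventE.
Qed.

Lemma resolvent_lin phi psi a x : norm_bounded phi -> norm_bounded psi ->
  resolvent (fun x => phi x + a * psi x) x = resolvent phi x + a * resolvent psi x.
Proof.
move=> bp bq; have br := bounded_resolvent bp; have bs := bounded_resolvent bq.
have [C h] := norm_bounded_lin a br bs.
apply/esym; apply: (resolvent_unique (D := setT) (C := C)
  (V := fun x => resolvent phi x + a * resolvent psi x)) => //.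
- exact: norm_bounded_lin.
- move=> y _; rewrite wcomp_lin//.
  by rewrite {1}resolventE// {1}(resolventE y bq); lra.
Qed.

(** S Q = S - 1, both sides being solutions of V = Q phi + Q V. The term -phi is the source of the
    coboundaries below. *)
Lemma resolvent_wcomp phi x : norm_bounded phi ->
  resolvent (wcomp phi) x = resolvent phi x - phi x.
Proof.
move=> bp; have br := bounded_resolvent bp; have bq := bounded_wcomp bp.
have [C h] := norm_bounded_lin (-1) br bp.
apply/esym; apply: (resolvent_unique (D := setT) (C := C)
  (V := fun x => resolvent phi x - phi x)) => //.
- by move=> y _; rewrite -mulN1r.
- move=> y _; rewrite {1}resolventE//.
  have -> : wcomp (fun x => resolvent phi x - phi x) y =
      wcomp (fun x => resolvent phi x + -1 * phi x) y.
    by apply: eq_wcomp => j _; rewrite mulN1r.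
  by rewrite wcomp_lin//; lra.
Qed.

End WeightedComposition.

(** * Expansion of a solution of V = Q V along a stopping rule *)

Section StoppingExpansion.
Variables (R : realType) (Omega : set nat) (X : Type).
Variables (q : X -> nat -> R) (st : X -> nat -> X) (rho : R).
Hypotheses (rho0 : 0 <= rho) (rho1 : rho < 1).
Hypothesis abs_q : forall x, abs_sum_le Omega (q x) rho.

Definition path_weight (x : X) (u : seq nat) : R :=
  (fix F x u := if u is j :: u' then q x j * F (st x j) u' else 1) x u.

Definition path_end (x : X) (u : seq nat) : X := foldl st x u.

Definition stopped_words (t : (nat -> nat) -> nat) : set (seq nat) :=
  [set u | exists2 w, seqs Omega w & u = mkseq w (t w)].

Definition seq_cons (j : nat) (w : nat -> nat) (n : nat) : nat :=
  if n is n'.+1 then w n' else j.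

Lemma mkseq_seq_cons j w n : mkseq (seq_cons j w) n.+1 = j :: mkseq w n.
Proof. by rewrite /mkseq /= (iotaDl 1 0) -map_comp; congr cons; apply: eq_map. Qed.

Lemma seq_cons_split w : w = seq_cons (w 0%N) (fun n => w n.+1).
Proof. by apply/funext => -[]. Qed.

Lemma seqs_cons j w : seqs Omega (seq_cons j w) <-> Omega j /\ seqs Omega w.
Proof.
split=> [h|[Oj h] [|n] //]; last exact: (h n).
by split=> [|n]; [exact: (h 0%N)|exact: (h n.+1)].
Qed.

(* One-step analysis: a stopping rule that is not immediate restricts, after
   each first letter j, to the stopping rule [fun w => (t (j w)).-1]. *)
Lemma stopping_expansion (m : nat) (t : (nat -> nat) -> nat) (x : X)
    (V : X -> R) (C : R) :
  Omega !=set0 -> 0 <= C -> (forall y, `|V y| <= C) ->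
  stopping_rule Omega t -> (forall w, seqs Omega w -> (t w <= m)%N) ->
  (forall w n, seqs Omega w -> (n < t w)%N ->
     V (path_end x (mkseq w n)) = wcomp Omega q st V (path_end x (mkseq w n))) ->
  [/\ abs_sum_le (stopped_words t) (path_weight x) 1,
      (forall w, seqs Omega w -> (0 < t w)%N) ->
        abs_sum_le (stopped_words t) (path_weight x) rho &
      V x = rsum (stopped_words t) (fun u => path_weight x u * V (path_end x u))].
Proof.
move=> [j0 Oj0] C0 VC; pose w0 : nat -> nat := fun=> j0.
have Ow0 : seqs Omega w0 by [].
elim: m t x => [|m IH] t x st_t tm tV; case: (posnP (t w0)) => [t0|t0].
all: try by move: (tm _ Ow0); rewrite leqn0 => /eqP t0'; rewrite t0' in t0.
(* The two remaining cases with [t w0 = 0]: a stopping rule that is 0 at one sequence is 0 at all of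
   them, and the empty word is the only stopped word. *)
1,2: have tz w : seqs Omega w -> t w = 0%N by
  move=> Ow; rewrite -t0; apply: (st_t w0) => //; rewrite t0.
1,2: have -> : stopped_words t = [set [::]] by
  apply/seteqP; split => [u [w Ow ->]|u ->] /=; [rewrite tz|exists w0 => //; rewrite tz].
1,2: split; [by rewrite /abs_sum_le esum_set1 ?lee_fin//= normr1| |by rewrite rsum_set1 /= mul1r].
1,2: by move=> /(_ _ Ow0); rewrite t0.
have tp w : seqs Omega w -> (0 < t w)%N.
  move=> Ow; case: (posnP (t w)) => // tw0.
  by move: t0; rewrite (st_t w w0)// tw0.
pose tj j w := (t (seq_cons j w)).-1.
have tjE j w : Omega j -> seqs Omega w -> t (seq_cons j w) = (tj j w).+1.
  by move=> Oj Ow; rewrite /tj prednK// tp//; apply/seqs_cons.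
have IHj j : Omega j ->
  [/\ abs_sum_le (stopped_words (tj j)) (path_weight (st x j)) 1,
      (forall w, seqs Omega w -> (0 < tj j w)%N) ->
        abs_sum_le (stopped_words (tj j)) (path_weight (st x j)) rho &
      V (st x j) = rsum (stopped_words (tj j))
        (fun u => path_weight (st x j) u * V (path_end (st x j) u))].
  move=> Oj; apply: IH.
  - move=> w w' Ow Ow' e; apply/eq_add_S; rewrite -!tjE//.
    apply: st_t; [exact/seqs_cons|exact/seqs_cons|].
    by rewrite tjE// !mkseq_seq_cons e.
  - by move=> w Ow; rewrite -ltnS -tjE//; apply: tm; apply/seqs_cons.
  - move=> w n Ow n_lt.
    have := tV (seq_cons j w) n.+1; rewrite mkseq_seq_cons tjE// ltnS.
    by apply => //; apply/seqs_cons.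
have headE j : Omega j ->
  stopped_words t `&` head 0%N @^-1` [set j] = cons j @` stopped_words (tj j).
  move=> Oj; apply/seteqP; split => [u [[w Ow ->]]|_ [u [w Ow ->] <-]] /=.
    rewrite (seq_cons_split w) => hj.
    have [Ow0' Ow'] : Omega (w 0%N) /\ seqs Omega (fun n => w n.+1).
      by apply/seqs_cons; rewrite -seq_cons_split.
    move: hj; rewrite tjE// mkseq_seq_cons /= => hj; rewrite hj.
    by eexists; [|reflexivity]; exists (fun n => w n.+1).
  split=> //; exists (seq_cons j w); first exact/seqs_cons.
  by rewrite tjE// mkseq_seq_cons.
have headO u : stopped_words t u -> Omega (head 0%N u).
  move=> [w Ow ->]; case E : (t w) (tp _ Ow) => // _.
  by rewrite (seq_cons_split w) mkseq_seq_cons; exact: Ow.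
have inj_cons (j : nat) (A : set (seq nat)) : set_inj A (cons j).
  by move=> u v _ _ [].
(* The factor rho is gained at the first letter alone; the tails are bounded by 1 only, since [tj j]
   may be 0. *)
have W1 : abs_sum_le (stopped_words t) (path_weight x) rho.
  rewrite /abs_sum_le (esum_fibers headO); last by move=> u _; rewrite lee_fin.
  apply: le_trans (abs_q x); apply: le_esum => j Oj.
  rewrite headE// esum_image//; have [h _ _] := IHj j Oj.
  under eq_esum do rewrite /= normrM mulrC.
  rewrite esum_mulr//; apply: le_trans (lee_wpmul2r _ h) _; first by rewrite lee_fin.
  by rewrite mul1e.
split=> //.
  apply: le_trans W1 _; by rewrite lee_fin ltW.
have bV : abs_sum_le (stopped_words t)
    (fun u => path_weight x u * V (path_end x u)) (rho * C).
  exact: (abs_sum_leM (g := fun u => V (path_end x u)) _ _ W1).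
rewrite (tV w0 0%N Ow0 t0) /= (rsum_fibers headO bV) /wcomp.
apply: eq_rsum => j Oj; rewrite headE//.
have [h _ ->] := IHj j Oj.
rewrite [RHS]rsum_image//=.
have hV : abs_sum_le (stopped_words (tj j)) (fun u =>
   path_weight (st x j) u * V (path_end (st x j) u)) (1 * C).
  exact: (abs_sum_leM (g := fun u => V (path_end (st x j) u)) _ _ h).
by rewrite mulrC -(rsumMr _ hV); apply: eq_rsum => u _; rewrite mulrC mulrA.
Qed.

End StoppingExpansion.

(** * One-sided points of the line and their neighbourhoods *)

Section OneSidedPoints.
Variable R : realType.

(* The one-sided point [x = (y, s)] is [y^+] if [s = true] and [y^-] otherwise. *)
Definition side (s : bool) : R := if s then 1 else -1.

Definition side_nbhs (x : R * bool) : set_system R :=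
  if x.2 then x.1^'+ else x.1^'-.

(** Both sides are described by the signed distance [side s * (u - y)], the form in which an affine
    map is easiest to follow. *)
Lemma side_nbhsP (x : R * bool) (P : set R) :
  side_nbhs x P <->
  exists2 e, 0 < e & forall u, 0 < side x.2 * (u - x.1) < e -> P u.
Proof.
case: x => y s /=; split.
- case: s => /= -[e /= e0 h]; exists e => // u.
    rewrite mul1r subr_gt0 => /andP[yu ue]; apply: (h u) => //=.
    by rewrite distrC ger0_norm// subr_ge0 ltW.
  rewrite mulN1r opprB subr_gt0 => /andP[yu ue]; apply: (h u) => //=.
  by rewrite ger0_norm// subr_ge0 ltW.
- case: s => /= -[e /= e0 h]; exists e => //= u /= ue yu; apply: h.
    by rewrite mul1r subr_gt0 yu/=; rewrite distrC ger0_norm// in ue; rewrite subr_ge0 ltW.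
  by rewrite mulN1r opprB subr_gt0 yu/=; rewrite ger0_norm// in ue; rewrite subr_ge0 ltW.
Qed.

Global Instance side_nbhs_proper x : ProperFilter (side_nbhs x).
Proof. by rewrite /side_nbhs; case: x.2; [exact: at_right_proper_filter|exact: at_left_proper_filter]. Qed.

Lemma side_nbhs_cvg x : side_nbhs x --> x.1.
Proof. by rewrite /side_nbhs; case: x.2 => A; exact: cvg_within. Qed.

End OneSidedPoints.

(** Reads a count as a threshold. Applied to the critical points lying to the left of a point, it
    recovers from their number which ones they are. *)
Lemma downward_closed_count (P : pred nat) n : (forall m, P m.+1 -> P m) ->
  (\sum_(m < n) P m <= n)%N /\
  forall m, (m < n)%N -> P m = (m < \sum_(m < n) P m)%N.
Proof.
move=> dP; elim: n => [|n [IH1 IH2]]; first by rewrite big_ord0.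
rewrite big_ord_recr/=; case Pn : (P n); last first.
  rewrite addn0; split; first exact: leqW.
  move=> m; rewrite ltnS leq_eqVlt => /predU1P[->|/IH2//].
  by rewrite Pn ltnNge IH1.
have Pall m : (m <= n)%N -> P m.
  move=> mn; suff H i : P (n - i)%N by rewrite -(subKn mn).
  elim: i => [|i IH]; first by rewrite subn0.
  case: (ltnP i n) => iN; first by apply: dP; rewrite subnSK.
  by move: IH; rewrite (eqP iN) (eqP (leqW iN)).
have -> : (\sum_(m < n) P m)%N = n.
  rewrite (eq_bigr (fun=> 1%N)) ?sum1_card ?card_ord// => i _.
  by rewrite Pall// ltnW.
by rewrite addn1; split => // m; rewrite ltnS => mn; rewrite Pall.
Qed.

(** Needed at end points of branches, where the affine formula is a one-sided limit and not a value
    of T_j. The segment from y to the midpoint is inside the open interval except possibly at y; if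
    a bound failed at y by some amount, it would still fail by half that amount at a point of the
    segment. *)
Lemma affine_itv (R : realType) (a b A B k d : R) : a < b ->
  (forall u, a < u < b -> A <= k * u + d <= B) ->
  forall y, a <= y <= b -> A <= k * y + d <= B.
Proof.
move=> ab h y /andP[ay yb]; pose m := (a + b) / 2.
have [am mb] : a < m /\ m < b by rewrite /m; split; lra.
have /andP[hA hB] : A <= k * m + d <= B by apply: h; rewrite am.
have hx t : 0 < t -> t <= 1 ->
    A <= (k * y + d) + t * ((k * m + d) - (k * y + d)) <= B.
  move=> t0 t1.
  have -> : (k * y + d) + t * ((k * m + d) - (k * y + d)) =
    k * (y + t * (m - y)) + d by lra.
  have h1 : 0 <= (1 - t) * (y - a) by rewrite mulr_ge0 ?subr_ge0.
  have h2 : 0 < t * (m - a) by rewrite mulr_gt0 ?subr_gt0.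
  have h3 : 0 <= (1 - t) * (b - y) by rewrite mulr_ge0 ?subr_ge0.
  have h4 : 0 < t * (b - m) by rewrite mulr_gt0 ?subr_gt0.
  by apply: h; apply/andP; split; lra.
move: hx hA hB; set f := k * y + d; set g := k * m + d => hx hA hB.
have tE (x z : R) : 0 < z -> x / (2 * z) * z = x / 2.
  by move=> z0; rewrite invfM mulrA -mulrA [_^-1 * z]mulVf ?mulr1// gt_eqF.
apply/andP; split; rewrite leNgt; apply/negP => fl.
  have D : 0 < g - f by lra.
  have /andP[+ _] : A <= f + (A - f) / (2 * (g - f)) * (g - f) <= B.
    apply: hx; first by rewrite divr_gt0 ?subr_gt0// mulr_gt0.
    by rewrite ler_pdivrMr ?mulr_gt0// mul1r; lra.
  by rewrite tE//; lra.
have D : 0 < f - g by lra.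
have /andP[_] : A <= f + (f - B) / (2 * (f - g)) * (g - f) <= B.
  apply: hx; first by rewrite divr_gt0 ?subr_gt0// mulr_gt0.
  by rewrite ler_pdivrMr ?mulr_gt0// mul1r; lra.
by rewrite -[g - f]opprB mulrN tE//; lra.
Qed.

(** * Branches, dynamics of one-sided points, and derivatives of words *)

Section Geometry.
Variables (R : realType) (Omega : set nat) (p : nat -> R) (n : nat).
Variables (c : nat -> R) (T : nat -> R -> R) (k d : 'I_n.+1 -> nat -> R).
Hypothesis HR : random_map Omega p n.+1 c T.
Hypothesis HA : class_RA Omega p c T k d.

Let I : set R := Idom n.+1 c.

Definition slope (i j : nat) : R := k (inord i) j.
Definition offset (i j : nat) : R := d (inord i) j.

(** The index of the branch carrying a one-sided point, as the number of critical points to its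
    left: c counts as being to the left of c^+ but not of c^-. The value is at most n at every point
    of the line. *)
Definition branch (x : R * bool) : nat :=
  (\sum_(m < n) (if x.2 then c m.+1 <= x.1 else c m.+1 < x.1)%R)%N.

Definition sided_step (x : R * bool) (j : nat) : R * bool :=
  (slope (branch x) j * x.1 + offset (branch x) j,
   if slope (branch x) j < 0 then ~~ x.2 else x.2).

Definition sided_weight (x : R * bool) (j : nat) : R :=
  if `[< I x.1 >] then p j / slope (branch x) j else 0.

(** The version of T_j that is left continuous on I except at c_0, where the first branch is used.
    On I it differs from T_j at most at the points c_i. *)
Definition left_step (y : R) (j : nat) : R := (sided_step (y, false) j).1.
Definition left_weight (y : R) (j : nat) : R := sided_weight (y, false) j.

Lemma IdomE y : I y <-> c 0 <= y <= c n.+1.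
Proof. by rewrite /I /Idom /= in_itv. Qed.

Lemma points_lt i j : (i < j <= n.+1)%N -> c i < c j.
Proof.
move=> /andP[]; elim: j => // j IH; rewrite ltnS leq_eqVlt => /predU1P[->|ij] jn.
  exact: points_increasing HR _ jn.
by apply: lt_trans (IH ij (ltnW jn)) (points_increasing HR jn).
Qed.

Lemma points_le i j : (i <= j <= n.+1)%N -> c i <= c j.
Proof.
move=> /andP[]; rewrite leq_eqVlt => /predU1P[->//|ij] jn.
by apply: ltW; apply: points_lt; rewrite ij.
Qed.

Let P (x : R * bool) m := if x.2 then c m.+1 <= x.1 else c m.+1 < x.1.

Let dP x m : (m < n)%N -> P x m.+1 -> P x m.
Proof.
move=> mn; have cc : c m.+1 < c m.+2 by apply: points_increasing HR _ _.
by rewrite /P; case: x.2 => h; [exact/ltW/(lt_le_trans cc h)|exact: lt_trans cc h].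
Qed.

Lemma branch_le x : (branch x <= n)%N.
Proof.
rewrite /branch -[leqRHS](card_ord n) -sum1_card.
by apply: leq_sum => i _; exact: leq_b1.
Qed.

Lemma branchP x m : (m < n)%N -> P x m = (m < branch x)%N.
Proof.
move=> mn; pose P' m := (m < n)%N && P x m.
have := @downward_closed_count P' n; case.
  move=> i /andP[i1n Pi]; rewrite /P' (ltnW i1n)/=; apply: dP => //.
  exact: ltnW.
move=> _ /(_ _ mn); rewrite /P' mn /= => ->; congr (_ < _)%N.
by apply: eq_bigr => i _; rewrite ltn_ord.
Qed.

Lemma branch_bounds x : I x.1 ->
  c (branch x) <= x.1 <= c (branch x).+1.
Proof.
move=> /IdomE/andP[x0 xN]; apply/andP; split.
  case E : (branch x) => [//|m].
  have mn : (m < n)%N by rewrite -ltnS -E ltnS branch_le.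
  have := branchP x mn; rewrite E ltnSn /P.
  by case: x.2 => // /ltW.
have := branch_le x; rewrite leq_eqVlt => /predU1P[->//|bn].
have := branchP x bn; rewrite ltnn /P.
by case: x.2 => /negbT; rewrite -?ltNge -?leNgt// => /ltW.
Qed.

Lemma branch_left_gt y : c 0 < y -> c (branch (y, false)) < y.
Proof.
move=> y0; case E : (branch _) => [//|m].
have mn : (m < n)%N by rewrite -ltnS -E ltnS branch_le.
by have := branchP (y, false) mn; rewrite E ltnSn.
Qed.

Lemma branch_right_lt y : y < c n.+1 -> y < c (branch (y, true)).+1.
Proof.
move=> yN; have := branch_le (y, true); rewrite leq_eqVlt => /predU1P[->//|bn].
by have := branchP (y, true) bn; rewrite ltnn /P /= => /negbT; rewrite -ltNge.
Qed.

Lemma branch_unique x i : (i <= n)%N ->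
  (forall m, (m < n)%N -> P x m = (m < i)%N) -> branch x = i.
Proof.
move=> iN h; apply/eqP; rewrite eqn_leq; apply/andP; split; rewrite leqNgt; apply/negP => lt.
  have in' : (i < n)%N by apply: leq_trans lt (branch_le x).
  by have := h _ in'; rewrite branchP// lt ltnn.
have bn : (branch x < n)%N by apply: leq_trans lt iN.
by have := h _ bn; rewrite branchP// lt ltnn.
Qed.

Lemma branch_interior y s i : (i <= n)%N -> c i < y < c i.+1 -> branch (y, s) = i.
Proof.
move=> iN /andP[iy yi]; apply: branch_unique => // m mn; rewrite /P /=.
case: (ltnP m i) => mi.
  have h : c m.+1 < y.
    by apply: le_lt_trans iy; apply: points_le; rewrite mi (leq_trans iN).
  by rewrite h ltW//; case: s.
have h : y < c m.+1.
  by apply: lt_le_trans yi _; apply: points_le; rewrite !ltnS mi (ltnW mn).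
by case: s; apply: negbTE; rewrite -?ltNge -?leNgt// ltW.
Qed.

Lemma branch_left_crit i : (i <= n)%N -> branch (c i.+1, false) = i.
Proof.
move=> iN; apply: branch_unique => // m mn; rewrite /P /=.
case: (ltnP m i) => mi; first by rewrite points_lt// !ltnS mi iN.
by apply: negbTE; rewrite -leNgt points_le// !ltnS mi ltnW.
Qed.

Lemma branch_right_crit i : (i <= n)%N -> branch (c i, true) = i.
Proof.
move=> iN; apply: branch_unique => // m mn; rewrite /P /=.
case: (ltnP m i) => mi; first by rewrite points_le// mi (leq_trans iN).
by apply: negbTE; rewrite -ltNge points_lt// !ltnS mi ltnW.
Qed.

Lemma branch_start s : branch (c 0, s) = 0%N.
Proof.
apply: branch_unique => // m mn; rewrite /P /=; have cm : c 0 < c m.+1.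
  by rewrite points_lt//= ltnW.
by case: s; apply: negbTE; rewrite -?ltNge -?leNgt// ltW.
Qed.

Lemma affine_branch i j u : (i <= n)%N -> Omega j -> c i < u < c i.+1 ->
  T j u = slope i j * u + offset i j.
Proof.
move=> iN Oj ui; rewrite /slope /offset; apply: (affine_branches HA) => //.
by rewrite inordK.
Qed.

Lemma affine_into i j y : (i <= n)%N -> Omega j -> c i <= y <= c i.+1 ->
  I (slope i j * y + offset i j).
Proof.
move=> iN Oj yi; apply/IdomE; apply: affine_itv yi; first exact: points_increasing HR _ _.
move=> u ui; rewrite -affine_branch//.
apply/IdomE; apply: (maps_into HR) => //; apply/IdomE.
case/andP: ui => /ltW iu /ltW ui; apply/andP; split.
  by apply: le_trans iu; apply: points_le; rewrite /= leqW.
by apply: le_trans ui _; apply: points_le; rewrite ltnS iN /=.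
Qed.

Lemma sided_step_into x j : I x.1 -> Omega j -> I (sided_step x j).1.
Proof. by move=> Ix Oj; apply: affine_into => //; [exact: branch_le|exact: branch_bounds]. Qed.

Lemma left_step_into y j : I y -> Omega j -> I (left_step y j).
Proof. by move=> Iy Oj; exact: (@sided_step_into (y, false)). Qed.

Lemma derive1_affine_branch i j u : (i <= n)%N -> Omega j ->
  c i < u < c i.+1 -> derive1 (T j) u = slope i j.
Proof.
move=> iN Oj ui.
have h : is_derive u (1:R) (T j) (slope i j).
  apply: (@near_eq_is_derive _ _ _ (fun v => slope i j * v + offset i j)).
    have : \forall v \near u, v \in `]c i, c i.+1[%R.
      by apply: near_in_itvoo; rewrite in_itv.
    by apply: filterS => v; rewrite in_itv /= => vi; rewrite (affine_branch iN Oj vi).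
  by apply: is_derive_eq; rewrite addr0 /GRing.scale /= mulr1.
by rewrite derive1E; case: h.
Qed.

(** The average expansion is evaluated at the midpoint of the branch, which is not critical and
    where the derivative of T_j is the slope. *)
Lemma expanding_branches : exists2 rho : R, 0 < rho < 1 &
  forall i, (i <= n)%N -> (forall j, Omega j -> slope i j != 0) /\
    abs_sum_le Omega (fun j => p j / slope i j) rho.
Proof.
have [rho rho01 h] := expanding_on_average HA; exists rho => // i iN.
pose y := (c i + c i.+1) / 2.
have cc : c i < c i.+1 by exact: points_increasing HR _ _.
have yi : c i < y < c i.+1 by rewrite /y; apply/andP; split; lra.
have [y1 y2] := andP yi.
have [||h1 h2] := h y.
- apply/andP; split.
    by apply: le_lt_trans y1; apply: points_le; rewrite leqW.
  by apply: lt_le_trans y2 _; apply: points_le; rewrite ltnS iN /=.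
- move=> [m /= /andP[m0 mN] my]; move: yi; rewrite -my => /andP[im mi].
  case: (leqP m i) => mi'.
    by move: im; rewrite ltNge points_le// mi' leqW.
  by move: mi; rewrite ltNge points_le// mi' ltnW.
split=> [j Oj|]; first by rewrite -(derive1_affine_branch iN Oj yi) h1.
apply: le_trans h2; apply: le_esum => j Oj.
rewrite (derive1_affine_branch iN Oj yi) lee_fin normrM normfV.
by rewrite gtr0_norm// (weight_gt0 HR).
Qed.

(* Inside [I], i.e. excluding [c_0^-] and [c_N^+]. *)
Definition inner_side (x : R * bool) : Prop :=
  I x.1 /\ if x.2 then x.1 < c n.+1 else c 0 < x.1.

Lemma near_branch x : inner_side x ->
  exists2 e, 0 < e & forall u, 0 < side R x.2 * (u - x.1) < e ->
    c (branch x) < u < c (branch x).+1.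
Proof.
case: x => y s [/= Iy ys]; have /andP[] := branch_bounds (x := (y, s)) Iy.
case: s ys => /= ys b1 b2.
  exists (c (branch (y, true)).+1 - y); first by rewrite subr_gt0 branch_right_lt.
  by move=> u /andP[u1 u2]; apply/andP; split; lra.
exists (y - c (branch (y, false))); first by rewrite subr_gt0 branch_left_gt.
by move=> u /andP[u1 u2]; apply/andP; split; lra.
Qed.

Lemma map_side_nbhs x j : inner_side x -> Omega j ->
  (T j @ side_nbhs x --> side_nbhs (sided_step x j)) /\
  inner_side (sided_step x j).
Proof.
move=> ix Oj; have [rho _ /(_ _ (branch_le x))[/(_ _ Oj) kn0 _]] := expanding_branches.
have [e e0 he] := near_branch ix.
have TE u : 0 < side R x.2 * (u - x.1) < e ->
    T j u = slope (branch x) j * u + offset (branch x) j.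
  by move=> /he; apply: affine_branch => //; exact: branch_le.
(* The branch multiplies signed distances by the absolute value of its slope, the flip of the side
   absorbing the sign. *)
have sE u : side R (sided_step x j).2 *
    ((slope (branch x) j * u + offset (branch x) j) - (sided_step x j).1) =
    `|slope (branch x) j| * (side R x.2 * (u - x.1)).
  rewrite /sided_step /side /=; case: (ltP (slope _ _) 0) => k0.
    by rewrite ltr0_norm//; case: x.2 => /=; lra.
  by rewrite ger0_norm//; case: x.2 => /=; lra.
split.
  move=> A /side_nbhsP[e' e'0 he']; apply/side_nbhsP.
  exists (Num.min e (e' / `|slope (branch x) j|)).
    by rewrite lt_min e0 divr_gt0// normr_gt0.
  move=> u /andP[u0]; rewrite lt_min => /andP[ue ue'].
  rewrite /= TE ?u0//; apply: he'; rewrite sE mulr_gt0 ?normr_gt0//=.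
  by rewrite mulrC -ltr_pdivlMr ?normr_gt0.
have Ist := sided_step_into ix.1 Oj; split=> //.
(* The image of this nearby point lies in I and strictly on the relevant side of the image point, so
   the image cannot be c_0^- or c_N^+. *)
pose u := x.1 + side R x.2 * (e / 2).
have su : side R x.2 * (u - x.1) = e / 2 by rewrite /u /side; case: x.2; lra.
have ue : 0 < side R x.2 * (u - x.1) < e by rewrite su; apply/andP; split; lra.
have : I (T j u).
  apply: (maps_into HR) => //; apply/IdomE; have /andP[u1 u2] := he _ ue.
  have bN := branch_le x; apply/andP; split.
    by apply: le_trans (ltW u1); apply: points_le; rewrite leqW.
  by apply: le_trans (ltW u2) _; apply: points_le; rewrite ltnS bN /=.
rewrite TE// => /IdomE; have : 0 < `|slope (branch x) j| * (e / 2).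
  by rewrite mulr_gt0 ?normr_gt0// divr_gt0.
rewrite -su -sE => h /andP[h1 h2]; move: h; rewrite /side.
by case: ((sided_step x j).2) => h; lra.
Qed.

Lemma word_map_side_nbhs u x : words Omega u -> inner_side x ->
  (word_map T u @ side_nbhs x --> side_nbhs (path_end sided_step x u)) /\
  inner_side (path_end sided_step x u).
Proof.
elim: u x => [|j u IH] x Ou ix; first by split.
have Oj : Omega j by apply: Ou; rewrite inE eqxx.
have Ou' : words Omega u by move=> i iu; apply: Ou; rewrite inE iu orbT.
have [h1 h2] := map_side_nbhs ix Oj; have [h3 h4] := IH _ Ou' h2.
by split=> //; apply: (cvg_comp (T j) (word_map T u) h1 h3).
Qed.

Lemma val_at_side u x : words Omega u -> inner_side x ->
  val_at T (side_nbhs x) u = (path_end sided_step x u).1.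
Proof.
move=> Ou ix; have [h1 _] := word_map_side_nbhs Ou ix.
apply/cvg_lim => //; apply: cvg_trans h1 _; exact: side_nbhs_cvg.
Qed.

Lemma word_deriv_cons j u y :
  word_deriv T (j :: u) y = derive1 (T j) y * word_deriv T u (T j y).
Proof. by rewrite /word_deriv /= big_ord_recl. Qed.

(** Close to a one-sided point a word follows a fixed itinerary of branches, so its derivative is
    constant there. This identifies the weights in the expansion of Q with the quotients in the
    strong matching condition. *)
Lemma near_word_deriv u x : words Omega u -> inner_side x ->
  exists2 D, path_weight sided_weight sided_step x u = word_weight p u / D &
    side_nbhs x [set y | word_deriv T u y = D].
Proof.
elim: u x => [|j u IH] x Ou ix.
  exists 1; first by rewrite /word_weight big_nil divr1.
  by apply: filterE => y /=; rewrite /word_deriv big_ord0.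
have Oj : Omega j by apply: Ou; rewrite inE eqxx.
have Ou' : words Omega u by move=> i iu; apply: Ou; rewrite inE iu orbT.
have [h1 h2] := map_side_nbhs ix Oj.
have [D DE hD] := IH _ Ou' h2; exists (slope (branch x) j * D).
  rewrite [LHS]/= DE /word_weight big_cons /sided_weight ifT; last by apply/asboolP; case: ix.
  by rewrite invfM mulrACA.
have hx : side_nbhs x [set y | derive1 (T j) y = slope (branch x) j].
  have [e e0 he] := near_branch ix; apply/side_nbhsP; exists e => // y /he yb /=.
  by apply: derive1_affine_branch => //; exact: branch_le.
apply: filterS2 hx (h1 _ hD) => y /= e1 e2.
by rewrite word_deriv_cons e1 e2.
Qed.

Lemma der_at_side u x : words Omega u -> inner_side x ->
  word_weight p u / der_at T (side_nbhs x) u =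
  path_weight sided_weight sided_step x u.
Proof.
move=> Ou ix; have [D -> hD] := near_word_deriv Ou ix.
congr (_ / _); apply/cvg_lim => //.
by apply: cvg_near_cst.
Qed.

End Geometry.

(** * Strong matching and the vanishing of the jumps of the resolvent *)

Section Matching.
Variables (R : realType) (Omega : set nat) (p : nat -> R) (n : nat).
Variables (c : nat -> R) (T : nat -> R -> R) (k d : 'I_n.+1 -> nat -> R).
Hypothesis HR : random_map Omega p n.+1 c T.
Hypothesis HA : class_RA Omega p c T k d.
Variable rho : R.
Hypotheses (rho0 : 0 <= rho) (rho1 : rho < 1).
Hypothesis abs_branch : forall i, (i <= n)%N ->
  abs_sum_le Omega (fun j => p j / slope k i j) rho.

Let I : set R := Idom n.+1 c.
Let q := sided_weight p c k.
Let st := sided_step c k d.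
Let ql := left_weight p c k.
Let stl := left_step c k d.

Definition branch_sum (i : nat) (phi : R -> R) (y : R) : R :=
  rsum Omega (fun j => p j / slope k i j * phi (slope k i j * y + offset d i j)).

Definition jump (m : nat) (phi : R -> R) : R :=
  branch_sum m phi (c m.+1) - branch_sum m.+1 phi (c m.+1).

Lemma Omega_neq0 : Omega !=set0.
Proof.
apply/set0P/negP => /eqP O0; have := weight_sum HR.
by rewrite O0 esum_set0 => /eqP; rewrite eqe eq_sym oner_eq0.
Qed.

Lemma abs_sided_weight x : abs_sum_le Omega (q x) rho.
Proof.
rewrite /q /sided_weight; case: asboolP => Ix; first exact/abs_branch/branch_le.
by rewrite /abs_sum_le esum1 ?lee_fin// => j _; rewrite normr0.
Qed.

Lemma abs_left_weight y : abs_sum_le Omega (ql y) rho.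
Proof. exact: abs_sided_weight. Qed.

Lemma sided_wcompE V x : I x.1 -> wcomp Omega q st V x =
  rsum Omega (fun j => p j / slope k (branch n c x) j * V (st x j)).
Proof. by move=> Ix; rewrite /wcomp /q /sided_weight asboolT. Qed.

Lemma left_wcompE V y : I y ->
  wcomp Omega ql stl V y = branch_sum (branch n c (y, false)) V y.
Proof. by move=> Iy; rewrite /wcomp /ql /left_weight /sided_weight asboolT. Qed.

Lemma crit_in m : (m < n)%N -> I (c m.+1).
Proof.
move=> mn; apply/IdomE; apply/andP; split; apply: (points_le HR).
  by rewrite leq0n ltnS (ltnW mn).
by rewrite (ltnW (mn : (m.+1 < n.+1)%N)) leqnn. Qed.

Lemma crit_inner m s : (m < n)%N -> inner_side n c (c m.+1, s).
Proof.
move=> mn; split; first exact: crit_in.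
case: s => /=; apply: (points_lt HR); first by rewrite ltnS mn /=.
by rewrite /= ltnS (ltnW mn).
Qed.

Variables (M : R -> nat) (Y : R -> set R).
Variables (kc lc : R -> (nat -> nat) -> nat).
Hypothesis HM : strong_random_matching Omega p n.+1 c T M Y kc lc.
Hypothesis Hstop : forall z, crit n.+1 c z ->
  stopping_rule Omega (kc z) /\ stopping_rule Omega (lc z).

Variable D : set R.
Hypothesis D_crit : forall m, (m < n)%N -> D (c m.+1).
Hypothesis D_pre : forall z, crit n.+1 c z ->
  prematching_orbit Omega T z^'- (kc z) `<=` D /\
  prematching_orbit Omega T z^'+ (lc z) `<=` D.

Let mtime (s : bool) := if s then lc else kc.

Lemma path_end_into u x : words Omega u -> I x.1 -> I (path_end st x u).1.
Proof.
elim: u x => //= j u IH x Ou Ix; apply: IH.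
  by move=> i iu; apply: Ou; rewrite inE iu orbT.
by apply: (sided_step_into HR HA) => //; apply: Ou; rewrite inE eqxx.
Qed.

Lemma words_mkseq w i : seqs Omega w -> words Omega (mkseq w i).
Proof. by move=> Ow j /mapP[m _ ->]. Qed.

(** The points visited before the matching time lie in [D], where [eta] vanishes, so V = Q V holds
    along the path and the stopping expansion applies. Matching times are at least 1, which gives
    the bound rho. *)
Lemma matched_expansion (V : R * bool -> R) (eta : R -> R) C m s :
  (m < n)%N -> 0 <= C -> (forall x, `|V x| <= C) ->
  (forall x, V x = eta x.1 + wcomp Omega q st V x) ->
  (forall y, D y -> eta y = 0) ->
  let z := c m.+1 in let W := stopped_words Omega (mtime s z) in
  abs_sum_le W (path_weight q st (z, s)) rho /\
  V (z, s) = rsum W (fun u => path_weight q st (z, s) u * V (path_end st (z, s) u)).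
Proof.
move=> mn C0 VC VE eta0 z W.
have cz : crit n.+1 c z by exists m.+1.
have [Mk Mr] := HM.1 _ cz.
have [|||h1 h2 h3] := @stopping_expansion R Omega _ q st rho rho1
  abs_sided_weight (M z) (mtime s z) (z, s) V C Omega_neq0 C0 VC.
- by have [] := Hstop cz; rewrite /mtime; case: (s).
- by move=> w Ow; have [/andP[_ h] _ /andP[_ h'] _] := Mr _ Ow; rewrite /mtime; case: (s).
- move=> w i Ow it; rewrite {1}VE eta0 ?add0r//.
  case: (posnP i) => [->/=|i0]; first exact: D_crit.
  have [d1 d2] := D_pre cz.
  rewrite -(val_at_side HR HA (words_mkseq (i := i) Ow) (crit_inner s mn)).
  move: it; rewrite /mtime /side_nbhs; case: (s) => /= it; [apply: d2|apply: d1];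
  by exists w, i; split => //; rewrite i0.
by split=> //; apply: h2 => w Ow;
  have [/andP[h _] _ /andP[h' _] _] := Mr _ Ow; rewrite /mtime; case: (s).
Qed.

(** When the summand depends on the end point only through its base point y, the words may be
    grouped by y. The groups are the sets Omega(y)^- and Omega(y)^+, and the inner sums are the two
    sides of the strong matching identity. *)
Lemma matched_sum (f : R -> R) C m s : (m < n)%N -> 0 <= C ->
  (forall y, `|f y| <= C) ->
  let z := c m.+1 in let W := stopped_words Omega (mtime s z) in
  abs_sum_le W (path_weight q st (z, s)) rho ->
  rsum W (fun u => path_weight q st (z, s) u * f (path_end st (z, s) u).1) =
  rsum (Y z) (fun y => f y * rsum
    (matched_words Omega T (side_nbhs (z, s)) (M z) (mtime s z) y)
    (fun u => word_weight p u / der_at T (side_nbhs (z, s)) u)).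
Proof.
move=> mn C0 fC z W hW.
have cz : crit n.+1 c z by exists m.+1.
have [Mk Mr] := HM.1 _ cz.
have iz := crit_inner s mn.
have valE u : words Omega u -> val_at T (side_nbhs (z, s)) u = (path_end st (z, s) u).1.
  by move=> Ou; rewrite (val_at_side HR HA Ou iz).
have WY u : W u -> Y z (path_end st (z, s) u).1.
  move=> [w Ow ->]; rewrite -valE; last exact: words_mkseq.
  by have [_ h1 _ h2] := Mr _ Ow; rewrite /mtime /side_nbhs; case: s {W hW iz valE}.
have hWf : abs_sum_le W (fun u => path_weight q st (z, s) u * f (path_end st (z, s) u).1) (rho * C).
  exact: (abs_sum_leM (g := fun u => f (path_end st (z, s) u).1) _ _ hW).
rewrite (rsum_fibers WY hWf); apply: eq_rsum => y Yy.
have -> : W `&` (fun u => (path_end st (z, s) u).1) @^-1` [set y] =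
   matched_words Omega T (side_nbhs (z, s)) (M z) (mtime s z) y.
  apply/seteqP; split => u /=.
    move=> [[w Ow uE] ey]; split.
    - by rewrite uE; exact: words_mkseq.
    - rewrite uE size_mkseq; have [] := Mr _ Ow; rewrite /mtime.
      by case: s {W hW iz valE WY hWf uE ey}.
    - by exists w.
    - by rewrite valE// uE; exact: words_mkseq.
  by move=> [Ou _ Wu vy]; split => //; rewrite -valE.
set W' := matched_words _ _ _ _ _ _.
have W'W : W' `<=` W by move=> u [].
have hW' : abs_sum_le W' (path_weight q st (z, s)) rho.
  by apply: abs_sum_leW hW.
rewrite mulrC (eq_rsum (g := fun u => path_weight q st (z, s) u * f y)).
  rewrite (rsumMr _ hW'); congr (_ * _); apply: eq_rsum => u [Ou _ _ _].
  by rewrite (der_at_side HR HA Ou iz).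
by move=> u [Ou _ _]; rewrite valE// => ->.
Qed.

(** Let [Z] bound the difference of the two sides of V over I. Where both sides lie on one branch, Q
    contracts the difference. At a critical point V is expanded up to the matching times and split
    into [Vb], the mean of the two sides, and [g], bounded by [Z / 2]. Strong matching makes the
    contributions of [Vb] equal, and [g] contributes at most [rho * (Z / 2)] from each side. Either
    way [rho * Z] is again a bound, so the difference is 0. *)
Lemma sided_resolvent_unsided (eta : R -> R) y : norm_bounded eta ->
  (forall y, D y -> eta y = 0) -> I y ->
  let V := resolvent Omega q st (fun x => eta x.1) in
  V (y, false) = V (y, true).
Proof.
move=> [E0 hE] eta0 Iy V.
have bE : norm_bounded (fun x : R * bool => eta x.1) by exists E0 => x; exact: hE.
have [C C0 VC] := norm_boundedP (bounded_resolvent st rho0 rho1 abs_sided_weight bE).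
have VE x : V x = eta x.1 + wcomp Omega q st V x.
  exact: (resolventE _ rho0 rho1 abs_sided_weight).
apply/eqP; rewrite -subr_eq0; apply/eqP; move: y Iy.
apply: (contraction_eq0 rho0 rho1 (C := C + C)); first by rewrite addr_ge0.
  by move=> y _; rewrite (le_trans (ler_normB _ _))// lerD.
move=> Z Z0 hZ y Iy.
have [eb|nb] := eqVneq (branch n c (y, false)) (branch n c (y, true)).
  rewrite (VE (y, false)) (VE (y, true)) /= opprD addrACA subrr add0r !sided_wcompE//.
  rewrite eb; set i := branch n c (y, true).
  have hi := abs_branch (branch_le n c (y, true)).
  pose g s j := V (st (y, s) j).
  have hg s : abs_sum_le Omega (fun j => p j / slope k i j * g s j) (rho * C).
    exact: (abs_sum_leM (g := g s) (fun j _ => VC _) C0 hi).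
  have hgN : abs_sum_le Omega (fun j => - (p j / slope k i j * g true j)) (rho * C).
    by apply: abs_sum_leW (hg true) => // j _; rewrite normrN.
  rewrite -(rsumN (hg true)) -(rsumD (hg false) hgN).
  under eq_rsum do rewrite -mulrBr.
  apply: ler_norm_rsum.
  apply: (abs_sum_leM (g := fun j => g false j - g true j) _ Z0 hi) => j Oj.
  have Iz : I (st (y, true) j).1 by apply: (sided_step_into HR HA).
  (* The two images share their base point; a negative slope merely exchanges their sides. *)
  have := hZ _ Iz; rewrite /g /st /sided_step /= eb.
  by case: ifP => _ //=; rewrite distrC.
have [m mn yE] : exists2 m, (m < n)%N & y = c m.+1.
  have le : (branch n c (y, false) <= branch n c (y, true))%N.
    by apply: leq_sum => i _ /=; case E : (_ < y) => //; rewrite ltW.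
  have lt : (branch n c (y, false) < branch n c (y, true))%N by rewrite ltn_neqAle nb.
  have mn := leq_trans lt (branch_le n c (y, true)).
  exists (branch n c (y, false)) => //.
  have := branchP HR (y, false) mn; have := branchP HR (y, true) mn.
  rewrite ltnn lt /= => h1 /negbT; rewrite -leNgt => h2.
  by apply/eqP; rewrite eq_le h2 h1.
have cz : crit n.+1 c (c m.+1) by exists m.+1.
pose Vb y := (V (y, false) + V (y, true)) / 2.
have VbC y' : `|Vb y'| <= C.
  have := VC (y', false); have := VC (y', true); rewrite -/V /Vb => h1 h2.
  rewrite normrM [`|2^-1|]gtr0_norm ?invr_gt0// ler_pdivrMr//.
  by rewrite (le_trans (ler_normD _ _))// mulr_natr mulr2n lerD.
pose g x := V x - Vb x.1.
have gZ x : I x.1 -> `|g x| <= Z / 2.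
  case: x => x s /= /hZ h; suff -> : `|g (x, s)| = `|V (x, false) - V (x, true)| / 2.
    by rewrite ler_pM2r ?invr_gt0.
  rewrite -[X in _ / X]gtr0_norm// -normfV -normrM /g /Vb /=; case: s.
    by rewrite -normrN; congr (`|_|); lra.
  by congr (`|_|); lra.
have key s : let z := c m.+1 in let W := stopped_words Omega (mtime s z) in
    exists2 r, `|r| <= rho * (Z / 2) &
    V (z, s) = rsum (Y z) (fun y => Vb y * rsum
    (matched_words Omega T (side_nbhs (z, s)) (M z) (mtime s z) y)
    (fun u => word_weight p u / der_at T (side_nbhs (z, s)) u)) + r.
  move=> z W; have [h1 h2] := matched_expansion s mn C0 VC VE eta0.
  exists (rsum W (fun u => path_weight q st (z, s) u * g (path_end st (z, s) u))).
    apply: ler_norm_rsum.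
    apply: (abs_sum_leM (g := fun u => g (path_end st (z, s) u)) _ _ h1); last by rewrite divr_ge0.
    move=> u [w Ow ->]; apply: gZ; apply: path_end_into; first exact: words_mkseq.
    exact: crit_in.
  rewrite -(matched_sum mn C0 VbC h1) [LHS](h2 : V (z, s) = _).
  have h3 : abs_sum_le W (fun u => path_weight q st (z, s) u * Vb (path_end st (z, s) u).1) (rho * C).
    exact: (abs_sum_leM (g := fun u => Vb (path_end st (z, s) u).1) _ _ h1).
  have h4 : abs_sum_le W (fun u => path_weight q st (z, s) u * g (path_end st (z, s) u)) (rho * (C + C)).
    apply: (abs_sum_leM (g := fun u => g (path_end st (z, s) u)) _ _ h1); last by rewrite addr_ge0.
    by move=> u _; rewrite /g (le_trans (ler_normB _ _))// lerD//; exact: VC.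
  rewrite -/W -(rsumD h3 h4); apply: eq_rsum => u _.
  by rewrite -mulrDr /g subrKC.
rewrite yE; have [r1 hr1 ->] := key false; have [r2 hr2 ->] := key true.
have -> : rsum (Y (c m.+1)) (fun y => Vb y * rsum
    (matched_words Omega T (side_nbhs (c m.+1, false)) (M (c m.+1)) (mtime false (c m.+1)) y)
    (fun u => word_weight p u / der_at T (side_nbhs (c m.+1, false)) u)) =
  rsum (Y (c m.+1)) (fun y => Vb y * rsum
    (matched_words Omega T (side_nbhs (c m.+1, true)) (M (c m.+1)) (mtime true (c m.+1)) y)
    (fun u => word_weight p u / der_at T (side_nbhs (c m.+1, true)) u)).
  apply: eq_rsum => y' Yy'; congr (_ * _); exact: HM.2 cz Yy'.
rewrite [_ + r1]addrC [_ + r2]addrC opprD addrACA subrr addr0.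
rewrite (le_trans (ler_normB _ _))// (le_trans (lerD hr1 hr2))//.
by rewrite -mulrDr ler_wpM2l//; lra.
Qed.

(** Since the one-sided solution V does not depend on the side, it solves the equation on I and
    equals the resolvent there by uniqueness. The two values of Q in the jump are then V(c^-) -
    eta(c) and V(c^+) - eta(c), which agree. *)
Lemma jump_resolvent_eq0 (eta : R -> R) m : norm_bounded eta ->
  (forall y, D y -> eta y = 0) -> (m < n)%N ->
  jump m (resolvent Omega ql stl eta) = 0.
Proof.
move=> bE eta0 mn; have [E0 hE] := bE.
have bEs : norm_bounded (fun x : R * bool => eta x.1) by exists E0 => x; exact: hE.
pose V := resolvent Omega q st (fun x => eta x.1).
have [C C0 VC] := norm_boundedP (bounded_resolvent st rho0 rho1 abs_sided_weight bEs).
have VE x : V x = eta x.1 + wcomp Omega q st V x.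
  exact: (resolventE _ rho0 rho1 abs_sided_weight).
have Vs y s : I y -> V (y, s) = V (y, false).
  by move=> Iy; case: s => //; rewrite /V -sided_resolvent_unsided.
have VR y : I y -> V (y, false) = resolvent Omega ql stl eta y.
  move=> Iy; apply: (resolvent_unique rho0 rho1 abs_left_weight
    (D := I) (C := C) (V := fun y => V (y, false))) => //.
    by move=> x j Ix Oj; exact: (left_step_into HR HA).
  move=> x Ix; rewrite VE /= left_wcompE// sided_wcompE//; congr (_ + _).
  apply: eq_rsum => j Oj; rewrite [X in V X]surjective_pairing Vs//.
  exact: (sided_step_into HR HA).
have Iz := crit_in mn.
have bs s : branch_sum (branch n c (c m.+1, s)) (resolvent Omega ql stl eta) (c m.+1) =
    wcomp Omega q st V (c m.+1, s).
  rewrite sided_wcompE//; apply: eq_rsum => j Oj; congr (_ * _).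
  have Ist : I (st (c m.+1, s) j).1 by apply: (sided_step_into HR HA).
  by rewrite [X in V X]surjective_pairing Vs// VR.
have b1 : branch n c (c m.+1, false) = m := branch_left_crit HR (ltnW mn).
have b2 : branch n c (c m.+1, true) = m.+1 := branch_right_crit HR mn.
have e1 := bs false; have e2 := bs true; rewrite b1 in e1; rewrite b2 in e2.
rewrite /jump e1 e2.
have := VE (c m.+1, true); have := VE (c m.+1, false).
by rewrite (Vs _ true Iz) /= => h1 h2; lra.
Qed.

End Matching.

(** The hypothesis says that [L] is injective on the left kernel of [A] and sends it to a subspace
    meeting the row space of [A] only in 0. The dimensions of these two subspaces add up to n. *)
Lemma kernel_image_decomposition (F : fieldType) (n : nat) (A L : 'M[F]_n) :
  (forall kap gam : 'rV[F]_n, kap *m A = 0 -> kap *m L = gam *m A -> kap = 0) ->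
  forall v : 'rV[F]_n, exists kap gam : 'rV[F]_n,
    kap *m A = 0 /\ v = kap *m L + gam *m A.
Proof.
move=> ND v; pose K := kermx A.
have cap0 : (K *m L :&: A)%MS = 0.
  apply/eqP/rowV0P => u; rewrite sub_capmx => /andP[/submxP[w uw] /submxP[g ug]].
  have wK0 : w *m K = 0.
    by apply: (ND _ g); [rewrite -mulmxA mulmx_ker mulmx0|rewrite -ug uw mulmxA].
  by rewrite uw mulmxA wK0 mul0mx.
have ker0 : (K :&: kermx L)%MS = 0.
  apply/eqP/rowV0P => u; rewrite sub_capmx => /andP[/submxP[w uw] /sub_kermxP uL].
  by apply: (ND u 0); [rewrite uw -mulmxA mulmx_ker mulmx0|rewrite uL mul0mx].
have full : row_full (K *m L + A)%MS.
  rewrite /row_full mxrank_disjoint_sum//.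
  have := mxrank_mul_ker K L; rewrite ker0 mxrank0 addn0 => ->.
  by rewrite /K mxrank_ker subnK// rank_leq_row.
have /sub_addsmxP[[w g] /= vE] : (v <= K *m L + A)%MS by exact: submx_full.
exists (w *m K), g; split; first by rewrite -mulmxA mulmx_ker mulmx0.
by rewrite vE mulmxA.
Qed.

(** * Functionals solving the coboundary equation for W *)

Section Coboundary.
Variables (R : realType) (Omega : set nat) (p : nat -> R) (n : nat).
Variables (c : nat -> R) (T : nat -> R -> R) (k d : 'I_n.+1 -> nat -> R).
Hypothesis HR : random_map Omega p n.+1 c T.
Hypothesis HA : class_RA Omega p c T k d.
Variable rho : R.
Hypotheses (rho0 : 0 <= rho) (rho1 : rho < 1).
Hypothesis abs_branch : forall i, (i <= n)%N ->
  abs_sum_le Omega (fun j => p j / slope k i j) rho.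

Let I : set R := Idom n.+1 c.
Let q := left_weight p c k.
Let st := left_step c k d.
Let res := resolvent Omega q st.
Let Q := wcomp Omega q st.
Let J := jump Omega p c k d.
Let abs_q : forall y, abs_sum_le Omega (q y) rho.
Proof. exact: abs_left_weight abs_branch. Qed.

Definition heav (x y : R) : R := (x < y)%R%:R.

Lemma bounded_heav x : norm_bounded (heav x).
Proof. by exists 1 => y; rewrite /heav normr_nat lern1 leq_b1. Qed.

Lemma bounded_cst (a : R) : norm_bounded (fun _ : R => a).
Proof. by exists `|a|. Qed.

(* How [fun y => \int_(c 0)^y psi] changes when [psi] is averaged over one
   step of the random map, see [primitive_average]. *)
Definition transfer (Psi : R -> R) (y : R) : R :=
  Q Psi y + \sum_(m < n) heav (c m.+1) y * J m Psi - Q Psi (c 0).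

Let abs_bs i phi C y : (i <= n)%N -> 0 <= C -> (forall x, `|phi x| <= C) ->
  abs_sum_le Omega (fun j => p j / slope k i j * phi (slope k i j * y + offset d i j)) (rho * C).
Proof.
move=> iN C0 h.
exact: (abs_sum_leM (g := fun j => phi _) (fun j _ => h _) C0 (abs_branch iN)).
Qed.

Let bs_lin i phi psi a y : (i <= n)%N -> norm_bounded phi -> norm_bounded psi ->
  branch_sum Omega p k d i (fun x => phi x + a * psi x) y =
  branch_sum Omega p k d i phi y + a * branch_sum Omega p k d i psi y.
Proof.
move=> iN /norm_boundedP[C C0 h] /norm_boundedP[B B0 h'].
have h1 := abs_bs y iN C0 h; have h2 := abs_bs y iN B0 h'.
rewrite /branch_sum [a * _]mulrC -(rsumMr a h2).
have h3 := abs_sum_leM (g := fun=> a) (fun _ _ => lexx _) (normr_ge0 a) h2.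
by rewrite -(rsumD h1 h3); apply: eq_rsum => j _; rewrite mulrDr mulrCA [a * _]mulrC.
Qed.

Lemma jump_lin m phi psi a : (m < n)%N -> norm_bounded phi -> norm_bounded psi ->
  J m (fun x => phi x + a * psi x) = J m phi + a * J m psi.
Proof.
move=> mn bp bq; rewrite /J /jump (bs_lin a _ (ltnW mn) bp bq) (bs_lin a _ mn bp bq).
by lra.
Qed.

Lemma jump_le m phi C : (m < n)%N -> 0 <= C -> (forall x, `|phi x| <= C) ->
  `|J m phi| <= 2 * C.
Proof.
move=> mn C0 h.
have h1 := ler_norm_rsum (abs_bs (c m.+1) (ltnW mn) C0 h).
have h2 := ler_norm_rsum (abs_bs (c m.+1) mn C0 h).
rewrite (le_trans (ler_normB _ _))// (le_trans (lerD h1 h2))//.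
have : rho * C <= C by rewrite ler_piMl// ltW.
lra.
Qed.

Lemma eq_jump m phi psi : (m < n)%N -> (forall x, I x -> phi x = psi x) ->
  J m phi = J m psi.
Proof.
move=> mn e; have cin i : (i = m \/ i = m.+1) -> c i <= c m.+1 <= c i.+1.
  by case=> ->; rewrite !(points_le HR)// ?leqnn ?leqnSn ?ltnS ?(ltnW mn)//= ltnS (ltnW mn).
rewrite /J /jump; congr (_ - _); apply: eq_rsum => j Oj; congr (_ * _); apply: e.
  by apply: (affine_into HR HA) => //; [exact: ltnW|apply: cin; left].
by apply: (affine_into HR HA) => //; apply: cin; right.
Qed.

Lemma sum_heav (a : nat -> R) y :
  \sum_(m < n) heav (c m.+1) y * (a m - a m.+1) = a 0%N - a (branch n c (y, false)).
Proof.
have := telescope_sumr (fun i => - a i) (leq0n (branch n c (y, false))).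
rewrite opprK addrC => <-.
rewrite big_mkord (big_ord_widen n (fun m => - a m.+1 - - a m)) ?branch_le//.
rewrite [RHS]big_mkcond; apply: eq_bigr => m _.
have := branchP HR (y, false) (ltn_ord m); rewrite /= /heav => ->.
by case: ifP => _; rewrite ?mul1r ?mul0r// opprK addrC.
Qed.

(** A list of coefficients and pairs of points. Only increments are combined, so that constants are
    sent to 0; this is what determines the value of [functional] at 1. *)
Definition comb (s : seq (R * (R * R))) (phi : R -> R) : R :=
  \sum_(t <- s) t.1 * (phi t.2.1 - phi t.2.2).

Definition comb_in (s : seq (R * (R * R))) : Prop :=
  forall t, t \in s -> I t.2.1 /\ I t.2.2.

(** With [s] empty this is the functional Lam of the overview. In general it is the A with A(Psi) -
    A(W Psi) = [comb s Psi], provided [gam] is chosen as in [functional_transfer]. *)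
Definition functional (s : seq (R * (R * R))) (gam : 'rV[R]_n) (phi : R -> R) : R :=
  comb s (res phi) + \sum_(m < n) gam 0 m * J m (res phi).

Lemma comb_lin s phi psi a :
  comb s (fun x => phi x + a * psi x) = comb s phi + a * comb s psi.
Proof. by rewrite /comb mulr_sumr -big_split; apply: eq_bigr => t _ /=; lra. Qed.

Lemma functional_lin s gam phi psi a : norm_bounded phi -> norm_bounded psi ->
  functional s gam (fun x => phi x + a * psi x) =
  functional s gam phi + a * functional s gam psi.
Proof.
move=> bp bq; rewrite /functional.
have -> : res (fun x => phi x + a * psi x) = fun x => res phi x + a * res psi x.
  by apply/funext => x; exact: (resolvent_lin _ rho0 rho1 abs_q).
rewrite comb_lin mulrDr addrACA; congr (_ + _).
rewrite mulr_sumr -big_split; apply: eq_bigr => m _ /=.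
by rewrite jump_lin//; [lra|exact: (bounded_resolvent _ rho0 rho1 abs_q)..].
Qed.

Lemma functional_sum s gam (E : Type) (r : seq E) (h : E -> R -> R) (a : E -> R)
    phi : norm_bounded phi -> (forall i, norm_bounded (h i)) ->
  norm_bounded (fun y => phi y + \sum_(i <- r) h i y * a i) /\
  functional s gam (fun y => phi y + \sum_(i <- r) h i y * a i) =
  functional s gam phi + \sum_(i <- r) functional s gam (h i) * a i.
Proof.
move=> bp bh; elim: r => [|i r [bI IH]].
  by under eq_fun do rewrite big_nil addr0; rewrite big_nil addr0.
have -> : (fun y => phi y + \sum_(j <- i :: r) h j y * a j) =
   fun y => (phi y + \sum_(j <- r) h j y * a j) + a i * h i y.
  by apply/funext => y; rewrite big_cons; lra.
split; first exact: norm_bounded_lin.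
by rewrite functional_lin// IH big_cons; lra.
Qed.

Lemma st_into x j : I x -> Omega j -> I (st x j).
Proof. exact: (left_step_into HR HA). Qed.

Lemma eq_functional s gam phi psi : comb_in s ->
  norm_bounded phi -> norm_bounded psi ->
  (forall x, I x -> phi x = psi x) -> functional s gam phi = functional s gam psi.
Proof.
move=> sI bp bq e; have SE x : I x -> res phi x = res psi x.
  exact: (eq_resolvent rho0 rho1 abs_q st_into).
rewrite /functional; congr (_ + _).
  rewrite /comb big_seq [RHS]big_seq; apply: eq_bigr => t /sI[h1 h2].
  by rewrite !SE.
by apply: eq_bigr => m _; rewrite (eq_jump (ltn_ord m) SE).
Qed.

Lemma functional_le s gam : exists2 K, 0 <= K & forall phi C, 0 <= C ->
  (forall x, `|phi x| <= C) -> `|functional s gam phi| <= K * C.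
Proof.
exists ((\sum_(t <- s) `|t.1| * 2 + \sum_(m < n) `|gam 0 m| * 2) / (1 - rho)).
  rewrite divr_ge0 ?subr_ge0 ?(ltW rho1)// addr_ge0//; apply: sumr_ge0 => *;
  exact: mulr_ge0.
move=> phi C C0 h; rewrite mulrAC -mulrA mulrDl.
have hS x : `|res phi x| <= C / (1 - rho) by exact: (resolvent_le _ rho0 rho1 abs_q).
have B0 : 0 <= C / (1 - rho) by rewrite divr_ge0 ?subr_ge0 ?(ltW rho1).
rewrite /functional; set B := C / (1 - rho) in hS B0 *.
rewrite (le_trans (ler_normD _ _))// !mulr_suml; apply: lerD.
  rewrite (le_trans (ler_norm_sum _ _ _))//; apply: ler_sum => t _.
  rewrite normrM -mulrA ler_wpM2l// (le_trans (ler_normB _ _))//.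
  by rewrite mulr2n mulrDl mul1r lerD.
rewrite (le_trans (ler_norm_sum _ _ _))//; apply: ler_sum => m _.
by rewrite normrM -mulrA ler_wpM2l//; exact: jump_le.
Qed.

Lemma bounded_transfer Psi : norm_bounded Psi -> norm_bounded (transfer Psi).
Proof.
move=> bP; have /norm_boundedP[B B0 hB] := bounded_wcomp st abs_q bP.
exists (B + \sum_(m < n) `|J m Psi| + B) => y; rewrite /transfer.
apply: le_trans (ler_normB _ _) _; apply: lerD; last exact: hB.
apply: le_trans (ler_normD _ _) _; apply: lerD; first exact: hB.
rewrite (le_trans (ler_norm_sum _ _ _))//; apply: ler_sum => m _.
rewrite normrM ler_piMl// /heav normr_nat lern1; exact: leq_b1.
Qed.

(** Q 1 is constant on each branch and its jumps at the critical points telescope, so that W depends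
    on Psi through its increments only. *)
Lemma transfer1 y : I y -> transfer (fun=> 1) y = 0.
Proof.
move=> Iy; pose a i := rsum Omega (fun j => p j / slope k i j).
have bsE i z : branch_sum Omega p k d i (fun=> 1) z = a i.
  by apply: eq_rsum => j _; rewrite mulr1.
rewrite /transfer; under eq_bigr do rewrite /J /jump !bsE.
have I0 : I (c 0) by apply/IdomE; rewrite lexx (points_le HR (i := 0)) ?leq0n ?leqnn.
rewrite (sum_heav a) /Q !left_wcompE// !bsE (branch_start HR); lra.
Qed.

Lemma functional_transfer_gen s gam Psi : norm_bounded Psi ->
  functional s gam (transfer Psi) =
  functional s gam Psi - comb s Psi - \sum_(m < n) gam 0 m * J m Psi
  + \sum_(m < n) functional s gam (heav (c m.+1)) * J m Psi
  - functional s gam (fun=> 1) * Q Psi (c 0).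
Proof.
move=> bP; have bQ := bounded_wcomp st abs_q bP.
have b1 := bounded_cst 1.
have [bS SE] := functional_sum s gam (index_enum 'I_n)
  (fun m : 'I_n => J m Psi) bQ (fun m : 'I_n => bounded_heav (c m.+1)).
have -> : transfer Psi = fun y =>
    (Q Psi y + \sum_(m < n) heav (c m.+1) y * J m Psi) + (- Q Psi (c 0)) * 1.
  by apply/funext => y; rewrite mulr1.
rewrite functional_lin// SE; suff -> : functional s gam (Q Psi) =
  functional s gam Psi - comb s Psi - \sum_(m < n) gam 0 m * J m Psi by lra.
rewrite /functional.
have -> : res (Q Psi) = fun x => res Psi x + -1 * Psi x.
  by apply/funext => x; rewrite /res (resolvent_wcomp _ rho0 rho1 abs_q)// mulN1r.
rewrite comb_lin.
rewrite (eq_bigr (fun m : 'I_n => gam 0 m * J m (res Psi) - gam 0 m * J m Psi)).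
  by rewrite sumrB; lra.
move=> m _; rewrite jump_lin//; first lra.
exact: (bounded_resolvent _ rho0 rho1 abs_q).
Qed.

(** The condition on [gam] cancels all jump terms and leaves A(1) Q Psi(c_0). For Psi = 1, where W
    Psi and [comb s Psi] vanish, the identity reads A(1) (1 - Q 1(c_0)) = 0; since |Q 1(c_0)| <= rho
    < 1, this forces A(1) = 0. *)
Lemma functional_transfer s (gam : 'rV[R]_n) (Psi : R -> R) : comb_in s -> norm_bounded Psi ->
  (forall m : 'I_n, gam 0 m = functional s gam (heav (c m.+1))) ->
  functional s gam (transfer Psi) = functional s gam Psi - comb s Psi.
Proof.
move=> sI bP gE; have b1 := bounded_cst 1.
have key phi : norm_bounded phi -> functional s gam (transfer phi) =
    functional s gam phi - comb s phi - functional s gam (fun=> 1) * Q phi (c 0).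
  move=> bphi; rewrite functional_transfer_gen//.
  rewrite [X in _ - _ - X + _](eq_bigr (fun m : 'I_n =>
    functional s gam (heav (c m.+1)) * J m phi)); first lra.
  by move=> m _; rewrite gE.
suff A1 : functional s gam (fun=> 1) = 0 by rewrite key// A1 mul0r subr0.
have c1 : comb s (fun=> 1) = 0.
  by rewrite /comb big1// => t _; rewrite subrr mulr0.
have f0 : functional s gam (fun=> 0) = 0.
  have := functional_lin s gam (-1) (bounded_cst 0) (bounded_cst 0).
  have -> : (fun _ : R => 0 + -1 * 0) = (fun=> 0) :> (R -> R) by apply/funext => ?; lra.
  lra.
have := key _ b1; rewrite c1 subr0.
have -> : functional s gam (transfer (fun=> 1)) = functional s gam (fun=> 0).
  apply: eq_functional => //.
  - exact: bounded_transfer.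
  - exact: bounded_cst.
  - exact: transfer1.
rewrite f0 => /esym/eqP; rewrite -{1}[functional s gam _]mulr1 -mulrBr mulf_eq0.
case/orP => [/eqP//|]; rewrite subr_eq0 => /eqP h.
have hle : `|Q (fun=> 1) (c 0)| <= rho * 1.
  by apply: wcomp_le => // j _; rewrite normr1.
by move: hle; rewrite -h normr1 mulr1 leNgt rho1.
Qed.

End Coboundary.

Lemma bounded_multiples_eq0 (R : realType) (x C : R) :
  (forall N : nat, `|N%:R * x| <= C) -> x = 0.
Proof.
move=> h; apply/eqP; rewrite -normr_eq0; apply/negPn/negP => x0.
have xp : 0 < `|x| by rewrite lt_neqAle eq_sym x0 normr_ge0.
have := h (Num.bound (`|C| / `|x|)).
rewrite normrM normr_nat leNgt => /negP; apply.
rewrite -ltr_pdivrMr//; apply: (@le_lt_trans _ _ (`|C| / `|x|)).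
  by rewrite ler_wpM2r ?invr_ge0// ler_norm.
by apply: archi_boundP; rewrite divr_ge0.
Qed.

(** * Invariant functionals and coboundaries on the grid *)

Section GridDensities.
Variables (R : realType) (Omega : set nat) (p : nat -> R) (n : nat).
Variables (c : nat -> R) (T : nat -> R -> R) (k d : 'I_n.+1 -> nat -> R).
Hypothesis HR : random_map Omega p n.+1 c T.
Hypothesis HA : class_RA Omega p c T k d.
Variable rho : R.
Hypotheses (rho0 : 0 <= rho) (rho1 : rho < 1).
Hypothesis abs_branch : forall i, (i <= n)%N ->
  abs_sum_le Omega (fun j => p j / slope k i j) rho.

Let I : set R := Idom n.+1 c.
Let q := left_weight p c k.
Let st := left_step c k d.
Let res := resolvent Omega q st.
Let J := jump Omega p c k d.
Let fnl := functional Omega p c k d.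
Let W := transfer Omega p c k d.

Variables (K : nat) (ds : nat -> R).
Hypothesis ds0 : ds 0%N = c 0%N.
Hypothesis ds_lt : forall i, (i < K)%N -> ds i < ds i.+1.
Hypothesis ds_in : forall i, (i <= K)%N -> I (ds i).
Hypothesis ds_crit : forall m, (m < n)%N -> exists2 i, (i < K)%N & ds i = c m.+1.
Hypothesis jump_res0 : forall eta m, norm_bounded eta ->
  (forall i, (i <= K)%N -> eta (ds i) = 0) -> (m < n)%N -> J m (res eta) = 0.

(** Lam evaluated at the function 1[x < .]. As Psi(y) is the integral of psi(x) 1[x < y] over x in
    I, this is the density that should represent Lam. *)
Definition density_at (kap : 'rV[R]_n) (x : R) : R :=
  \sum_(m < n) kap 0 m * J m (res (heav x)).

Definition grid_comb (kap : 'rV[R]_n) : seq (R * (R * R)) :=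
  [seq (density_at kap (ds i), (ds i.+1, ds i)) | i <- iota 0 K].

(* [kap *m (1%:M - flux_mx) = 0] makes [density_at kap] an invariant density,
   see [grid_comb_invariant]. *)
Definition flux_mx : 'M[R]_n := \matrix_(m, l) J m (res (heav (c l.+1))).

(** The matrix whose product with [kap] lists the values of the grid functional at S 1[c_l < .], see
    [comb_grid_res]: the right-hand side of the system whose solvability would make that functional
    a coboundary. *)
Definition grid_mx : 'M[R]_n := \matrix_(m, l)
  \sum_(i < K) J m (res (heav (ds i))) *
    (res (heav (c l.+1)) (ds i.+1) - res (heav (c l.+1)) (ds i)).

(* [P t] is the primitive of the t-fold average of a test function. *)
Definition transfer_orbit (P : nat -> R -> R) (C : R) : Prop :=
  [/\ 0 <= C, forall t y, `|P t y| <= C, forall t, P t (c 0%N) = 0 &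
      forall t y, I y -> P t.+1 y = W (P t) y].

Lemma ds_mono i j : (i < j <= K)%N -> ds i < ds j.
Proof.
move=> /andP[]; elim: j => // j IH; rewrite ltnS leq_eqVlt => /predU1P[->|ij] jn.
  exact: ds_lt.
by apply: lt_trans (IH ij (ltnW jn)) (ds_lt jn).
Qed.

Lemma comb_grid kap phi : comb (grid_comb kap) phi =
  \sum_(i < K) density_at kap (ds i) * (phi (ds i.+1) - phi (ds i)).
Proof. by rewrite /comb big_map -{1}(subn0 K) -/(index_iota 0 K) big_mkord. Qed.

Lemma grid_comb_in kap : comb_in n c (grid_comb kap).
Proof.
move=> t /mapP[i]; rewrite mem_iota add0n => /andP[_ iK] -> /=.
by split; apply: ds_in => //; exact: ltnW.
Qed.

Lemma functional_nil kap phi :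
  fnl [::] kap phi = \sum_(m < n) kap 0 m * J m (res phi).
Proof. by rewrite /fnl /functional /comb big_nil add0r. Qed.

(* By matching only the values of [Psi] on the grid matter. *)
Lemma functional_grid kap Psi : norm_bounded Psi -> Psi (c 0%N) = 0 ->
  fnl [::] kap Psi = comb (grid_comb kap) Psi.
Proof.
move=> bP P0; rewrite comb_grid.
pose a (i : 'I_K) := - (Psi (ds i.+1) - Psi (ds i)).
(* Psi minus the step function with the same increments between grid points. As [heav] is strict,
   [eta (ds i)] telescopes to Psi(c_0) = 0. *)
pose eta := fun y => Psi y + \sum_(i < K) heav (ds i) y * a i.
have [bE E] := functional_sum c d rho0 rho1 abs_branch [::] kap (index_enum 'I_K) a bP
  (fun i : 'I_K => bounded_heav (ds i)).
have eta0 i : (i <= K)%N -> eta (ds i) = 0.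
  move=> iK; rewrite /eta.
  rewrite (eq_bigr (fun j : 'I_K => if (j < i)%N then a j else 0)); last first.
    move=> j _; rewrite /heav; case: ltnP => ji.
      by rewrite ds_mono ?mul1r// ji.
    have -> : (ds j < ds i) = false.
      apply: negbTE; rewrite -leNgt; move: ji; rewrite leq_eqVlt => /predU1P[->//|ij].
      by apply/ltW/ds_mono; rewrite ij ltnW.
    by rewrite mul0r.
  rewrite -big_mkcond -(big_ord_widen K (fun j => - (Psi (ds j.+1) - Psi (ds j))) iK).
  rewrite sumrN -(big_mkord xpredT (fun j => Psi (ds j.+1) - Psi (ds j))).
  by rewrite (telescope_sumr (fun j => Psi (ds j))) ?ds0 ?P0//; lra.
have : fnl [::] kap eta = 0.
  rewrite functional_nil big1// => m _.
  by rewrite jump_res0 ?mulr0.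
rewrite /fnl E => /eqP; rewrite addr_eq0 => /eqP ->.
rewrite -sumrN; apply: eq_bigr => i _.
by rewrite mulrN opprK -/fnl functional_nil.
Qed.

Lemma grid_comb_invariant kap P C t :
  kap *m (1%:M - flux_mx) = 0 -> transfer_orbit P C ->
  comb (grid_comb kap) (P t.+1) = comb (grid_comb kap) (P t).
Proof.
move=> kA [C0 PC P0 PW].
have bP s : norm_bounded (P s) by exists C.
have kE (m : 'I_n) : kap 0 m = fnl [::] kap (heav (c m.+1)).
  rewrite functional_nil.
  move/eqP: kA; rewrite mulmxBr mulmx1 subr_eq0 => /eqP/matrixP/(_ 0 m) ->.
  by rewrite mxE; apply: eq_bigr => l _; rewrite mxE.
rewrite -!functional_grid//.
have c0 : comb_in n c [::] by [].
rewrite -[RHS]subr0 -[X in _ = _ - X](_ : comb [::] (P t) = 0); last by rewrite /comb big_nil.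
rewrite /fnl -(functional_transfer HR HA rho0 rho1 abs_branch c0 (bP t) kE).
apply: (eq_functional HR HA rho0 rho1 abs_branch) => //.
- exact: (bounded_transfer _ _ rho0 abs_branch).
- exact: PW.
Qed.

(** The system for [gam] is the condition of [functional_transfer] in matrix form, so the sum over t
    telescopes to two values of one bounded functional. *)
Lemma comb_coboundary_le s (gam : 'rV[R]_n) : comb_in n c s ->
  gam *m (1%:M - flux_mx) = \row_l comb s (res (heav (c l.+1))) ->
  exists2 B, 0 <= B & forall P C N, transfer_orbit P C ->
    `|\sum_(t < N) comb s (P t)| <= B * C.
Proof.
move=> sI gE; have [B B0 hB] := functional_le c d rho0 rho1 abs_branch s gam.
exists (2 * B) => [|P C N [C0 PC P0 PW]]; first exact: mulr_ge0.
have bP t : norm_bounded (P t) by exists C.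
have gF (m : 'I_n) : gam 0 m = fnl s gam (heav (c m.+1)).
  move/matrixP/(_ 0 m): gE; rewrite mulmxBr mulmx1 !mxE => /eqP.
  rewrite subr_eq => /eqP ->; rewrite /fnl /functional; congr (_ + _).
  by apply: eq_bigr => l _; rewrite mxE.
rewrite (eq_bigr (fun t : 'I_N => - (fnl s gam (P t.+1) - fnl s gam (P t)))); last first.
  move=> t _; have -> : fnl s gam (P t.+1) = fnl s gam (P t) - comb s (P t).
    rewrite /fnl -(functional_transfer HR HA rho0 rho1 abs_branch sI (bP t) gF).
    apply: (eq_functional HR HA rho0 rho1 abs_branch) => //.
    - exact: (bounded_transfer _ _ rho0 abs_branch).
    - exact: PW.
  by lra.
rewrite sumrN -(big_mkord xpredT (fun t => fnl s gam (P t.+1) - fnl s gam (P t))).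
rewrite (telescope_sumr (fun t => fnl s gam (P t)))// normrN.
rewrite (le_trans (ler_normB _ _))// -mulrA mulr2n mulrDl mul1r.
by apply: lerD; apply: hB.
Qed.

Hypothesis bumps : forall i, (i < K)%N -> exists P C e, [/\ transfer_orbit P C,
  e != 0 & forall j, (j < K)%N -> P 0%N (ds j.+1) - P 0%N (ds j) = (j == i)%:R * e].

(** The kernel equation says that [kap] consists of the values of its own density at the critical
    points, all of which are grid points. *)
Lemma grid_density_eq0 kap : kap *m (1%:M - flux_mx) = 0 ->
  (forall i, (i < K)%N -> density_at kap (ds i) = 0) -> kap = 0.
Proof.
move=> kA F0; apply/rowP => m; rewrite [RHS]mxE.
move/eqP: kA; rewrite mulmxBr mulmx1 subr_eq0 => /eqP/matrixP/(_ 0 m) ->.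
have [i iK im] := ds_crit (ltn_ord m).
rewrite mxE -[RHS](F0 i iK) im; apply: eq_bigr => l _; by rewrite mxE.
Qed.

Lemma comb_grid_res kap : kap *m grid_mx =
  \row_l comb (grid_comb kap) (res (heav (c l.+1))).
Proof.
apply/rowP => l; rewrite !mxE comb_grid.
under [RHS]eq_bigr do rewrite mulr_suml.
rewrite exchange_big; apply: eq_bigr => m _.
by rewrite mxE mulr_sumr; apply: eq_bigr => i _; rewrite mulrA.
Qed.

Lemma comb_grid_orbit kap P C t : kap *m (1%:M - flux_mx) = 0 ->
  transfer_orbit P C -> comb (grid_comb kap) (P t) = comb (grid_comb kap) (P 0%N).
Proof.
by move=> kA oP; elim: t => // t IH; rewrite (grid_comb_invariant _ kA oP).
Qed.

(** The grid functional of [kap] would be both invariant and a coboundary: its sums over N steps are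
    N times its initial value, yet bounded, so it vanishes on every orbit. The orbits in [bumps]
    then isolate each cell and show that the density is 0 there. *)
Lemma nondegenerate (kap gam : 'rV[R]_n) : kap *m (1%:M - flux_mx) = 0 ->
  kap *m grid_mx = gam *m (1%:M - flux_mx) -> kap = 0.
Proof.
move=> kA; rewrite comb_grid_res => /esym gE.
have [B B0 hB] := comb_coboundary_le (@grid_comb_in kap) gE.
have E0 P C : transfer_orbit P C -> comb (grid_comb kap) (P 0%N) = 0.
  move=> oP; apply: (@bounded_multiples_eq0 _ _ (B * C)) => N.
  rewrite (le_trans _ (hB _ _ N oP))// mulr_natl.
  rewrite (eq_bigr (fun=> comb (grid_comb kap) (P 0%N))) ?sumr_const ?card_ord//.
  by move=> t _; exact: comb_grid_orbit oP.
apply: grid_density_eq0 => // i iK; have [P [C [e [oP e0 PE]]]] := bumps iK.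
have := E0 _ _ oP; rewrite comb_grid (bigD1 (Ordinal iK))//= PE// eqxx mul1r.
rewrite big1 ?addr0 => [/eqP|j ji]; first by rewrite mulf_eq0 (negbTE e0) orbF => /eqP.
rewrite PE// (_ : (nat_of_ord j == i) = false) ?mul0r ?mulr0//.
by apply: contra_neqF ji => /eqP ji; apply: val_inj.
Qed.

(** Evaluation at y is corrected by an invariant grid functional so that the linear system for [gam]
    becomes solvable; the remainder is then a coboundary, with bounded sums. *)
Lemma orbit_decomposition y : I y -> exists2 kap : 'rV[R]_n,
  kap *m (1%:M - flux_mx) = 0 &
  exists2 B, 0 <= B & forall P C N, transfer_orbit P C ->
   `|\sum_(t < N) P t y - N%:R * comb (grid_comb kap) (P 0%N)| <= B * C.
Proof.
move=> Iy.
have [kap [gam [kA vE]]] := kernel_image_decomposition nondegenerate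
  (\row_(l < n) (res (heav (c l.+1)) y - res (heav (c l.+1)) (c 0%N))).
exists kap => //.
(* The increment from c_0 to y, which is [P t y] because primitives vanish at c_0, minus the grid
   functional. *)
pose s := (1, (y, c 0%N)) :: [seq (- t.1, t.2) | t <- grid_comb kap].
have sE phi : comb s phi = phi y - phi (c 0%N) - comb (grid_comb kap) phi.
  rewrite /s /comb big_cons mul1r big_map -sumrN; congr (_ + _).
  by apply: eq_bigr => t _; rewrite mulNr.
have I0 : I (c 0%N) by rewrite -ds0; exact: ds_in.
have sI : comb_in n c s.
  move=> t; rewrite inE => /predU1P[->//|/mapP[u /grid_comb_in[h1 h2] ->]].
  by split.
have gE : gam *m (1%:M - flux_mx) = \row_l comb s (res (heav (c l.+1))).
  have := congr1 (fun M => M - kap *m grid_mx) vE; rewrite addrAC subrr add0r => <-.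
  by rewrite comb_grid_res; apply/rowP => l; rewrite !mxE sE; lra.
have [B B0 hB] := comb_coboundary_le sI gE.
exists B => // P C N oP; apply: le_trans (hB _ _ N oP); have [_ _ P0 _] := oP.
rewrite le_eqVlt; apply/orP; left; apply/eqP; congr (`|_|).
rewrite [RHS](eq_bigr (fun t : 'I_N => P t y - comb (grid_comb kap) (P 0%N))); last first.
  by move=> t _; rewrite sE P0 subr0 (comb_grid_orbit _ kA oP).
by rewrite sumrB sumr_const card_ord mulr_natl.
Qed.

End GridDensities.

(** * Lebesgue measure under affine changes of variable *)

Section AffineChangeOfVariable.
Variable R : realType.
Notation leb := (@lebesgue_measure R).

Lemma preimage_affine_itv (k d : R) (a b : R) : k != 0 ->
  (fun x => k * x + d) @^-1` `]a, b]%classic =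
  if 0 < k then `](a - d) / k, (b - d) / k]%classic
  else `[(b - d) / k, (a - d) / k[%classic.
Proof.
move=> k0; apply/seteqP; case: ifPn => kp; split => x /=; rewrite !in_itv /=.
- move=> /andP[ax xb]; apply/andP; split.
    by rewrite ltr_pdivrMr// mulrC; lra.
  by rewrite ler_pdivlMr// mulrC; lra.
- by rewrite ltr_pdivrMr// ler_pdivlMr// mulrC => /andP[ax xb]; apply/andP; split; lra.
- have kn : k < 0 by rewrite lt_neqAle k0 leNgt.
  move=> /andP[ax xb]; apply/andP; split.
    by rewrite ler_ndivrMr// mulrC; lra.
  by rewrite ltr_ndivlMr// mulrC; lra.
- have kn : k < 0 by rewrite lt_neqAle k0 leNgt.
  by rewrite ler_ndivrMr// ltr_ndivlMr// mulrC => /andP[ax xb]; apply/andP; split; lra.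
Qed.

Lemma measurable_affine (k d : R) :
  measurable_fun setT ((fun x => k * x + d) : measurableTypeR R -> measurableTypeR R).
Proof.
by apply: measurable_funD => //; apply: measurable_funM.
Qed.

(** Both sides are measures and agree on half-open intervals. For k < 0 the preimage is closed at
    the other end, which does not affect its length. *)
Lemma lebesgue_measure_affine (k d : R) (A : set (measurableTypeR R)) : k != 0 ->
  measurable A ->
  leb A = (`|k|%:E * leb ((fun x => k * x + d)%R @^-1` A))%E.
Proof.
move=> k0 mA.
pose f : measurableTypeR R -> measurableTypeR R := fun x => k * x + d.
have mf : measurable_fun setT f := measurable_affine k d.
pose m := mscale (NngNum (normr_ge0 k)) (pushforward leb f).
suff -> : leb A = m mf A by [].
apply: lebesgue_measure_unique => // _ [[a b] _ <-] /=.
rewrite /m /mscale /= /pushforward preimage_affine_itv//.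
have kn0 : 0 < `|k| by rewrite normr_gt0.
have E (x y : R) : (`|k|%:E * (x - y)%:E = (`|k| * (x - y))%:E)%E by [].
case: ifPn => kp; rewrite !lebesgue_measure_itv /= !lte_fin.
  rewrite ltr_pM2r ?invr_gt0// ltrD2r; case: ifP => _; last by rewrite mule0.
  by rewrite -!EFinB -EFinM -mulrBl gtr0_norm// mulrC divfK//; congr EFin; lra.
have kn : k < 0 by rewrite lt_neqAle k0 leNgt.
rewrite ltr_nM2r ?invr_lt0// ltrD2r; case: ifP => _; last by rewrite mule0.
rewrite -!EFinB -EFinM -mulrBl ltr0_norm// mulNr mulrC divfK//; congr EFin; lra.
Qed.

Lemma integral_affine (k d : R) (D : set (measurableTypeR R)) (psi : R -> R) :
  k != 0 -> measurable D -> measurable_fun setT psi -> (forall x, 0 <= psi x) ->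
  (\int[leb]_(x in D) (psi x)%:E =
   `|k|%:E * \int[leb]_(x in (fun x => k * x + d)%R @^-1` D) (psi (k * x + d)%R)%:E)%E.
Proof.
move=> k0 mD mpsi psi0.
pose f : measurableTypeR R -> measurableTypeR R := fun x => k * x + d.
have mf : measurable_fun setT f := measurable_affine k d.
pose m := pushforward leb f : {measure set (measurableTypeR R) -> \bar R}.
have mE : measurable_fun D (EFin \o psi) by apply/measurable_EFinP; exact: measurable_funTS.
have := @ge0_integral_pushforward _ _ _ _ R f mf leb D (EFin \o psi) mD mE.
move=> <-; last by move=> y _; rewrite lee_fin.
rewrite -(@ge0_integral_mscale _ _ R (m mf) D mD (NngNum (normr_ge0 k)))//; last first.
  by move=> y _; rewrite lee_fin.
apply: eq_measure_integral => A mA _.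
exact: lebesgue_measure_affine.
Qed.

End AffineChangeOfVariable.

(** * Test functions and their integrals over half-open intervals *)

Section IntervalIntegral.
Variable R : realType.
Notation leb := (@lebesgue_measure R).

(** Values in [0, 1] make integrals over bounded intervals and against probabilities finite, and the
    class is stable under averaging and under psi -> 1 - psi. *)
Definition test_fun (psi : R -> R) : Prop :=
  measurable_fun setT psi /\ forall x, 0 <= psi x <= 1.

Definition iint (psi : R -> R) (a b : R) : R :=
  fine (\int[leb]_(x in `]a, b]%classic) (psi x)%:E)%E.

Lemma test_fun_measurable psi D : test_fun psi ->
  measurable_fun D (EFin \o psi).
Proof. by move=> [m _]; apply/measurable_EFinP; exact: measurable_funTS. Qed.

Lemma test_fun_ge0 psi x : test_fun psi -> 0 <= psi x.
Proof. by move=> [_ /(_ x)/andP[]]. Qed.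

Lemma test_integral_le (mu : {measure set (measurableTypeR R) -> \bar R})
    psi D : test_fun psi -> measurable D ->
  (\int[mu]_(x in D) (psi x)%:E <= mu D)%E.
Proof.
move=> tp mD; rewrite -[leRHS]mul1e -integral_cst//.
apply: ge0_le_integral => //.
- by move=> x _; rewrite lee_fin test_fun_ge0.
- exact: test_fun_measurable.
- by move=> x _; rewrite lee_fin; case: tp => _ /(_ x)/andP[].
Qed.

Lemma test_integral_ge0 (mu : {measure set (measurableTypeR R) -> \bar R})
    psi D : test_fun psi -> (0 <= \int[mu]_(x in D) (psi x)%:E)%E.
Proof. by move=> tp; apply: integral_ge0 => x _; rewrite lee_fin test_fun_ge0. Qed.

Lemma iintE psi a b : test_fun psi ->
  (\int[leb]_(x in `]a, b]%classic) (psi x)%:E)%E = (iint psi a b)%:E.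
Proof.
move=> tp; rewrite /iint fineK// ge0_fin_numE; last exact: test_integral_ge0.
apply: le_lt_trans (test_integral_le leb tp _) _; first exact: measurable_itv.
by rewrite /= lebesgue_measure_itv /=; case: ifP => _; rewrite ?ltry// -EFinB ltry.
Qed.

Lemma iint_ge0 psi a b : test_fun psi -> 0 <= iint psi a b.
Proof. by move=> tp; rewrite -lee_fin -iintE//; exact: test_integral_ge0. Qed.

Lemma iint_le psi a b : test_fun psi -> a <= b -> iint psi a b <= b - a.
Proof.
move=> tp ab; rewrite -lee_fin -iintE//.
apply: le_trans (test_integral_le leb tp _) _; first exact: measurable_itv.
rewrite /= lebesgue_measure_itv /= lte_fin; case: ifP => _; first by rewrite -EFinB.
by rewrite lee_fin subr_ge0.
Qed.

Lemma iint_empty psi a b : b <= a -> iint psi a b = 0.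
Proof.
by move=> ba; rewrite /iint set_itv_ge ?integral_set0// bnd_simp -leNgt.
Qed.

Lemma iint_split psi a b e : test_fun psi -> a <= b -> b <= e ->
  iint psi a e = iint psi a b + iint psi b e.
Proof.
move=> tp ab be; apply: EFin_inj; rewrite EFinD -!iintE//.
rewrite (@itv_bndbnd_setU _ _ _ (BRight b)) ?bnd_simp//.
rewrite ge0_integral_setU//.
- exact: test_fun_measurable.
- by move=> x _; rewrite lee_fin test_fun_ge0.
- apply/disj_setPS => x [] /=; rewrite !in_itv /= => /andP[_ xb] /andP[bx _].
  by move: bx; rewrite ltNge xb.
Qed.

Lemma iint_affine psi k d a b : test_fun psi -> k != 0 -> a <= b ->
  (\int[leb]_(x in `]a, b]%classic) (psi (k * x + d)%R)%:E)%E =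
  ((if 0 < k then iint psi (k * a + d) (k * b + d)
    else iint psi (k * b + d) (k * a + d)) / `|k|)%:E.
Proof.
move=> tp k0 ab; have [mpsi _] := tp.
have kn0 : `|k| != 0 by rewrite normr_eq0.
have key u v : (\int[leb]_(x in (fun x => k * x + d)%R @^-1` `]u, v]%classic) (psi (k * x + d)%R)%:E)%E
   = (iint psi u v / `|k|)%:E.
  have := @integral_affine R k d `]u, v]%classic psi k0 (measurable_itv _) mpsi
    (fun x => test_fun_ge0 x tp).
  rewrite iintE// mulrC EFinM => ->; rewrite muleA -EFinM mulVf// mul1e//.
have := key (k * a + d) (k * b + d); have := key (k * b + d) (k * a + d).
rewrite !preimage_affine_itv//.
have cancel x : (k * x + d - d) / k = x by rewrite addrK mulrC mulKf.
case: ifPn => kp; rewrite !cancel // => e1 e2.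
have mpk (D : set R) : measurable_fun D (fun x => (psi (k * x + d))%:E).
  apply/measurable_EFinP; apply: measurable_funTS.
  apply: (measurableT_comp mpsi); exact: measurable_affine.
by rewrite integral_itv_bndoo// -e1 [RHS]integral_itv_bndoo.
Qed.

End IntervalIntegral.

(** * The average of a test function and the primitive of the average *)

Section Averaging.
Variables (R : realType) (Omega : set nat) (p : nat -> R) (n : nat).
Variables (c : nat -> R) (T : nat -> R -> R) (k d : 'I_n.+1 -> nat -> R).
Hypothesis HR : random_map Omega p n.+1 c T.
Hypothesis HA : class_RA Omega p c T k d.
Hypothesis slope_neq0 : forall i j, (i <= n)%N -> Omega j -> slope k i j != 0.
Variable rho : R.
Hypotheses (rho0 : 0 <= rho) (rho1 : rho < 1).
Hypothesis abs_branch : forall i, (i <= n)%N ->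
  abs_sum_le Omega (fun j => p j / slope k i j) rho.
Notation leb := (@lebesgue_measure R).

Let I : set R := Idom n.+1 c.
Let st := left_step c k d.

(** Uses [left_step] for T_j: it is measurable on the whole line and agrees with T_j on I off the
    points c_i. *)
Definition average (psi : R -> R) (x : R) : R :=
  rsum Omega (fun j => p j * psi (st x j)).

(** Truncated at c_N, and 0 to the left of c_0 where the interval is empty, so as to be bounded on
    the whole line as [transfer_orbit] demands. *)
Definition primitive (psi : R -> R) (y : R) : R :=
  iint psi (c 0%N) (Num.min y (c n.+1)).

Let c0N : c 0%N <= c n.+1.
Proof. by rewrite (points_le HR)// leqnn. Qed.

Lemma primitiveE psi y : I y -> primitive psi y = iint psi (c 0%N) y.
Proof. by move=> /IdomE/andP[_ h]; rewrite /primitive min_l. Qed.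

Lemma primitive_ge0 psi y : test_fun psi -> 0 <= primitive psi y.
Proof. exact: iint_ge0. Qed.

Lemma primitive_le psi y : test_fun psi -> primitive psi y <= c n.+1 - c 0%N.
Proof.
move=> tp; rewrite /primitive; have [ym|my] := leP (Num.min y (c n.+1)) (c 0%N).
  by rewrite iint_empty// subr_ge0.
apply: le_trans (iint_le tp (ltW my)) _.
by rewrite lerD2r ge_min lexx orbT.
Qed.

Lemma primitive0 psi : primitive psi (c 0%N) = 0.
Proof. by rewrite /primitive iint_empty// ge_min lexx. Qed.

Lemma primitiveB psi u v : test_fun psi -> I u -> I v -> u <= v ->
  primitive psi v - primitive psi u = iint psi u v.
Proof.
move=> tp Iu Iv uv; rewrite !primitiveE// (iint_split tp _ uv); first by lra.
by case/IdomE/andP: Iu.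
Qed.

Lemma measurable_branch i : measurable [set x | branch n c (x, false) = i].
Proof.
have mge m : measurable [set x : R | (m <= branch n c (x, false))%N].
  case: m => [|m]; first by rewrite (_ : [set _ | _] = setT)//; apply/seteqP; split.
  have [mn|nm] := ltnP m n.
    rewrite (_ : [set _ | _] = `]c m.+1, +oo[%classic); first exact: measurable_itv.
    apply/seteqP; split => x /=; rewrite in_itv /= andbT;
    by rewrite -(branchP HR (x, false) mn).
  rewrite (_ : [set _ | _] = set0)//; apply/seteqP; split => x //=.
  by rewrite ltnNge (leq_trans (branch_le n c (x, false)) nm).
rewrite (_ : [set _ | _] = [set x : R | (i <= branch n c (x, false))%N] `\`
   [set x : R | (i.+1 <= branch n c (x, false))%N]); first exact: measurableD.
apply/seteqP; split => x /=; first by move=> ->; rewrite leqnn ltnn.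
by move=> [h1 /negP]; rewrite -leqNgt => h2; apply/eqP; rewrite eqn_leq h1 h2.
Qed.

Lemma measurable_left_step j : measurable_fun setT (fun x : R => st x j).
Proof.
rewrite (_ : (fun x : R => st x j) = fun x => \sum_(i < n.+1)
  \1_[set x | branch n c (x, false) = i] x * (slope k i j * x + offset d i j)).
  apply: measurable_sum => i; apply: measurable_funM; last exact: measurable_affine.
  apply: measurable_indic; exact: measurable_branch.
apply/funext => x; have bn := branch_le n c (x, false); rewrite -ltnS in bn.
rewrite (bigD1 (Ordinal bn))//= big1 ?addr0 => [|i ib].
  by rewrite indicE mem_set// mul1r.
rewrite indicE memNset ?mul0r//= => e; move/eqP: ib; apply.
exact: val_inj.
Qed.

Lemma test_fun_step psi j : test_fun psi -> test_fun (fun x => psi (st x j)).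
Proof.
move=> [mpsi h]; split; last by move=> x; exact: h.
exact: (measurableT_comp mpsi (measurable_left_step j)).
Qed.

Lemma abs_weight : abs_sum_le Omega p 1.
Proof.
rewrite /abs_sum_le -(weight_sum HR); apply: le_esum => j Oj.
by rewrite gtr0_norm// (weight_gt0 HR).
Qed.

Lemma abs_average psi x : test_fun psi ->
  abs_sum_le Omega (fun j => p j * psi (st x j)) 1.
Proof.
move=> [_ h]; rewrite -[1]mulr1.
apply: (abs_sum_leM (g := fun j => psi (st x j)) _ ler01 abs_weight) => j _.
by have /andP[h0 h1] := h (st x j); rewrite ger0_norm.
Qed.

Lemma averageE psi x : test_fun psi ->
  (average psi x)%:E = (\esum_(j in Omega) (p j * psi (st x j))%:E)%E.
Proof.
move=> tp; have ge j : Omega j -> 0 <= p j * psi (st x j).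
  by move=> Oj; rewrite mulr_ge0 ?test_fun_ge0// ltW// (weight_gt0 HR).
by rewrite /average rsum_ge0E// fineK// (fin_esum ge (abs_average x tp)).
Qed.

Lemma esum_nneseries (a : nat -> \bar R) : (forall j, Omega j -> (0 <= a j)%E) ->
  (\esum_(j in Omega) a j = \sum_(j <oo) (if j \in Omega then a j else 0))%E.
Proof.
move=> a0; rewrite -[X in esum X _]set_mem_set -nneseries_esum ?eseries_mkcond//.
by move=> j /set_mem; exact: a0.
Qed.

Lemma test_average psi : test_fun psi -> test_fun (average psi).
Proof.
move=> tp; split; last first.
  move=> x; rewrite -!lee_fin averageE//; apply/andP; split.
    apply: esum_ge0 => j Oj; rewrite lee_fin mulr_ge0 ?test_fun_ge0//.
    by rewrite ltW// (weight_gt0 HR).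
  apply: le_trans (abs_average x tp); apply: le_esum => j _.
  by rewrite lee_fin ler_norm.
apply/measurable_EFinP.
rewrite (_ : EFin \o _ = fun x => (\sum_(j <oo | j \in Omega) (p j * psi (st x j))%:E)%E).
  apply: ge0_emeasurable_sum => j x.
    move=> _ /set_mem Oj; rewrite lee_fin mulr_ge0 ?test_fun_ge0//.
    by rewrite ltW// (weight_gt0 HR).
  apply/measurable_EFinP; apply: measurable_funM => //.
  by case: (test_fun_step j tp).
apply/funext => x /=; rewrite averageE// esum_nneseries; first by rewrite [RHS]eseries_mkcond.
move=> j Oj; rewrite lee_fin mulr_ge0 ?test_fun_ge0//.
by rewrite ltW// (weight_gt0 HR).
Qed.

Lemma integral_average (mu : {measure set (measurableTypeR R) -> \bar R}) psi D :
  test_fun psi -> measurable D ->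
  (\int[mu]_(x in D) (average psi x)%:E =
   \esum_(j in Omega) ((p j)%:E * \int[mu]_(x in D) (psi (st x j))%:E))%E.
Proof.
move=> tp mD.
have p0 j : Omega j -> 0 <= p j by move=> Oj; rewrite ltW// (weight_gt0 HR).
rewrite esum_nneseries; last first.
  by move=> j Oj; rewrite mule_ge0 ?lee_fin ?p0// test_integral_ge0//; exact: test_fun_step.
pose f j x := (if j \in Omega then (p j * psi (st x j))%:E else 0)%E.
transitivity (\int[mu]_(x in D) (\sum_(j <oo) f j x))%E.
  apply: eq_integral => x _; rewrite averageE// esum_nneseries// => j Oj.
  by rewrite lee_fin mulr_ge0 ?p0// test_fun_ge0.
rewrite integral_nneseries//; first last.
- move=> j x _; rewrite /f; case: ifPn => // /set_mem Oj.
  by rewrite lee_fin mulr_ge0 ?p0// test_fun_ge0.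
- move=> j; rewrite /f; case: (j \in Omega); last exact: measurable_cst.
  apply/measurable_EFinP; apply: measurable_funM => //.
  by apply: measurable_funTS; case: (test_fun_step j tp).
apply: congr_lim; apply/funext => m; apply: eq_bigr => j _; rewrite /f.
case: (boolP (j \in Omega)) => [/set_mem Oj|_]; last by rewrite integral0.
under eq_integral do rewrite EFinM.
rewrite ge0_integralZl_EFin ?p0//.
- by move=> x _; rewrite lee_fin test_fun_ge0.
- exact: test_fun_measurable (test_fun_step j tp).
Qed.

(** Substitution on one branch gives p_j / k_ij times an increment of the primitive. For k_ij < 0
    the sign of the slope and the reversed end points compensate. *)
Lemma average_branch_integral psi i a b : test_fun psi -> (i <= n)%N ->
  c i <= a -> a <= b -> b <= c i.+1 ->
  iint (average psi) a b = branch_sum Omega p k d i (primitive psi) b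
                         - branch_sum Omega p k d i (primitive psi) a.
Proof.
move=> tp iN ia ab bi; have ta := test_average tp.
apply: EFin_inj; rewrite -iintE// integral_average//.
have p0 j : Omega j -> 0 <= p j by move=> Oj; rewrite ltW// (weight_gt0 HR).
have Ia j y : Omega j -> c i <= y -> y <= c i.+1 -> I (slope k i j * y + offset d i j).
  by move=> Oj h1 h2; apply: (affine_into HR HA) => //; rewrite h1.
pose g j := p j / slope k i j * primitive psi (slope k i j * b + offset d i j) -
   p j / slope k i j * primitive psi (slope k i j * a + offset d i j).
have gE j : Omega j -> ((p j)%:E * \int[leb]_(x in `]a, b]%classic) (psi (st x j))%:E)%E
    = (g j)%:E.
  move=> Oj.
  have -> : (\int[leb]_(x in `]a, b]%classic) (psi (st x j))%:E =
     \int[leb]_(x in `]a, b]%classic) (psi (slope k i j * x + offset d i j)%R)%:E)%E.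
    apply: eq_integral => x; rewrite inE /= in_itv /= => /andP[ax xb].
    congr (psi _)%:E; rewrite /st /left_step /sided_step /=.
    (* The point x may be c_(i+1) itself: its left branch is still i, which is why the intervals are
       closed on the right. *)
    suff -> : branch n c (x, false) = i by [].
    move: xb; rewrite le_eqVlt => /predU1P[xE|xb].
      have : x <= c i.+1 by rewrite xE.
      rewrite le_eqVlt => /predU1P[->|xi]; first exact: branch_left_crit HR _ iN.
      by apply: (branch_interior HR) => //; rewrite xi (le_lt_trans ia ax).
    by apply: (branch_interior HR) => //; rewrite (le_lt_trans ia ax) (lt_le_trans xb).
  have kn0 := slope_neq0 iN Oj.
  rewrite iint_affine// -EFinM; congr EFin; rewrite /g -mulrBr.
  have Ib := Ia j b Oj (le_trans ia ab) bi; have Iaa := Ia j a Oj ia (le_trans ab bi).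
  case: ifPn => kp.
    rewrite primitiveB// ?lerD2r ?ler_pM2l// gtr0_norm//.
    by rewrite mulrA mulrAC.
  have kn : slope k i j < 0 by rewrite lt_neqAle kn0 leNgt.
  rewrite -[X in _ = _ * X]opprB primitiveB// ?lerD2r ?ler_nM2l// ltr0_norm//.
  by rewrite invrN !mulrN mulrA mulrAC.
rewrite (eq_esum gE).
have bb y : abs_sum_le Omega (fun j => p j / slope k i j *
    primitive psi (slope k i j * y + offset d i j)) (rho * (c n.+1 - c 0%N)).
  apply: (abs_sum_leM (g := fun j => primitive psi _) _ _ (abs_branch iN)).
    by move=> j _; rewrite ger0_norm ?primitive_ge0// primitive_le.
  by rewrite subr_ge0.
have bbN y : abs_sum_le Omega (fun j => - (p j / slope k i j *
    primitive psi (slope k i j * y + offset d i j))) (rho * (c n.+1 - c 0%N)).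
  by apply: abs_sum_leW (bb y) => // j _; rewrite normrN.
have g0 j : Omega j -> 0 <= g j.
  move=> Oj; rewrite -lee_fin -gE// mule_ge0 ?lee_fin ?p0// test_integral_ge0//.
  exact: test_fun_step.
have gb := abs_sum_leD (bb b) (bbN a).
rewrite -[LHS]fineK; last exact: (fin_esum g0 gb).
rewrite -rsum_ge0E// /branch_sum -(rsumN (bb a)).
by rewrite -(rsumD (bb b) (bbN a)).
Qed.

(** The branch integrals are added up from c_0. At each critical point the formula changes branch,
    and the mismatch between the two branch sums is the jump. *)
Lemma primitive_average psi y : test_fun psi -> I y ->
  primitive (average psi) y = transfer Omega p c k d (primitive psi) y.
Proof.
move=> tp Iy; have ta := test_average tp.
have [A AE] : exists A, forall i z, branch_sum Omega p k d i (primitive psi) z = A i z.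
  by exists (fun i z => branch_sum Omega p k d i (primitive psi) z).
pose Jm m := A m (c m.+1) - A m.+1 (c m.+1).
have Ic i : (i <= n.+1)%N -> I (c i).
  by move=> iN; apply/IdomE; rewrite !(points_le HR)// ?iN ?leqnn.
have G i : (i <= n)%N ->
    primitive (average psi) (c i) = A i (c i) - A 0%N (c 0%N) + \sum_(m < i) Jm m.
  elim: i => [|i IH] iN; first by rewrite primitive0 big_ord0; lra.
  have iN' := ltnW iN.
  have ci : c i <= c i.+1 by rewrite (points_le HR)// leqnSn /= ltnW.
  have := primitiveB ta (Ic i (leqW iN')) (Ic i.+1 (leqW iN)) ci.
  rewrite (average_branch_integral tp iN')// !AE big_ord_recr /= IH//.
  by move: (\sum_(m < i) Jm m) => s0; rewrite /Jm; lra.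
have iN := branch_le n c (y, false).
have /andP[iy yi] := branch_bounds HR (x := (y, false)) Iy.
have [i iE] : exists i, branch n c (y, false) = i by eexists.
rewrite iE /= in iN iy yi.
have := primitiveB ta (Ic i (leqW iN)) Iy iy; rewrite G//.
rewrite (average_branch_integral tp iN (lexx _) iy yi) !AE.
have I0 := Ic 0%N isT.
rewrite /transfer !left_wcompE// iE (branch_start HR) !AE.
rewrite [X in _ = _ + X - _](eq_bigr (fun m : 'I_n => if (m < i)%N then Jm m else 0)).
  rewrite -big_mkcond -(big_ord_widen n Jm iN).
  by move: (\sum_(m < i) Jm m) => s0; lra.
move=> m _; have := branchP HR (y, false) (ltn_ord m); rewrite /= /heav => ->.
by rewrite iE /jump !AE /Jm; case: ifP => _; rewrite ?mul1r ?mul0r.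
Qed.

End Averaging.

Lemma finite_set_grid (R : realType) (D : set R) (a b : R) : a < b ->
  finite_set D -> D a -> D b -> (forall x, D x -> a <= x <= b) ->
  exists (K : nat) (ds : nat -> R), [/\ ds 0%N = a, ds K = b,
    forall i, (i < K)%N -> ds i < ds i.+1,
    forall i, (i <= K)%N -> a <= ds i <= b &
    forall x, D x -> exists2 i, (i <= K)%N & ds i = x].
Proof.
move=> ab /finite_seqP[s Ds] Da Db Dab.
pose L := sort <=%R (undup s).
have Lu : uniq L by rewrite sort_uniq undup_uniq.
have Ls : sorted <%R L.
  by rewrite lt_sorted_uniq_le Lu sort_sorted//; exact: le_total.
have LD x : (x \in L) = (x \in D).
  by rewrite mem_sort mem_undup Ds; apply/idP/idP => [h|/set_mem//]; exact/mem_set.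
have aL : a \in L by rewrite LD; exact/mem_set.
have bL : b \in L by rewrite LD; exact/mem_set.
have L0 : (0 < size L)%N by case: (L) aL.
pose K := (size L).-1; have KL : K.+1 = size L by rewrite prednK.
pose ds := nth 0 L.
have inL i : (i <= K)%N -> a <= ds i <= b.
  by move=> iK; apply: Dab; apply/set_mem; rewrite -LD mem_nth// -KL ltnS.
have lts i j : (i < j <= K)%N -> ds i < ds j.
  move=> /andP[ij jK]; apply: (sorted_ltn_nth lt_trans _ Ls) => //;
  by rewrite inE -KL ltnS// (leq_trans (ltnW ij)).
have idx x : D x -> exists2 i, (i <= K)%N & ds i = x.
  move=> /mem_set; rewrite -LD => xL; exists (index x L).
    by rewrite -ltnS KL index_mem.
  by rewrite /ds nth_index.
exists K, ds; split => //.
- have [[|i] iK ia] := idx a Da => //.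
  have := lts 0%N i.+1; rewrite iK ia => /(_ isT).
  by have /andP[h _] := inL 0%N isT; rewrite ltNge h.
- have [i iK ib] := idx b Db; move: (iK); rewrite leq_eqVlt => /predU1P[iE|iK']; first by rewrite -iE.
  have := lts i K; rewrite iK' leqnn => /(_ isT); rewrite ib.
  by have /andP[_ h] := inL K (leqnn K); rewrite ltNge h.
- by move=> i iK; apply: lts; rewrite ltnSn.
Qed.

(** * Iterated averages and elementary test functions *)

Section TestOrbits.
Variables (R : realType) (Omega : set nat) (p : nat -> R) (n : nat).
Variables (c : nat -> R) (T : nat -> R -> R) (k d : 'I_n.+1 -> nat -> R).
Hypothesis HR : random_map Omega p n.+1 c T.
Hypothesis HA : class_RA Omega p c T k d.
Hypothesis slope_neq0 : forall i j, (i <= n)%N -> Omega j -> slope k i j != 0.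
Variable rho : R.
Hypotheses (rho0 : 0 <= rho) (rho1 : rho < 1).
Hypothesis abs_branch : forall i, (i <= n)%N ->
  abs_sum_le Omega (fun j => p j / slope k i j) rho.

Let I : set R := Idom n.+1 c.
Let avg := average Omega p c k d.
Let prim := primitive n c.

Lemma test_iter_average psi t : test_fun psi -> test_fun (iter t avg psi).
Proof. by move=> tp; elim: t => //= t IH; exact: (test_average k d HR IH). Qed.

Lemma average_orbit psi : test_fun psi ->
  transfer_orbit Omega p c k d (fun t => prim (iter t avg psi)) (c n.+1 - c 0%N).
Proof.
move=> tp; split.
- by rewrite subr_ge0 (points_le HR)// leqnn.
- move=> t y; have tt := test_iter_average t tp.
  by rewrite ger0_norm ?primitive_ge0// (primitive_le HR).
- by move=> t; exact: primitive0.
- move=> t y Iy; apply: (primitive_average HR HA slope_neq0 abs_branch) => //.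
  exact: test_iter_average.
Qed.

Lemma test_cst1 : test_fun (fun _ : R => 1).
Proof. by split => [|x]; [exact: measurable_cst|rewrite ler01 lexx]. Qed.

Lemma average_cst1 : avg (fun=> 1) = fun=> 1.
Proof.
apply/funext => x; apply: EFin_inj; rewrite (averageE k d HR); last exact: test_cst1.
by rewrite -(weight_sum HR); apply: eq_esum => j _; rewrite mulr1.
Qed.

Lemma average_le phi psi x : test_fun phi -> test_fun psi ->
  (forall y, phi y <= psi y) -> avg phi x <= avg psi x.
Proof.
move=> tf tp h; rewrite -lee_fin !(averageE k d HR)//; apply: le_esum => j Oj.
by rewrite lee_fin ler_wpM2l// ltW// (weight_gt0 HR).
Qed.

Lemma averageD phi psi chi x : test_fun phi -> test_fun psi ->
  (forall y, chi y = phi y + psi y) -> avg chi x = avg phi x + avg psi x.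
Proof.
move=> tf tp h; rewrite /avg /average.
rewrite -(rsumD (abs_average k d HR x tf) (abs_average k d HR x tp)).
by apply: eq_rsum => j _; rewrite h mulrDr.
Qed.

Lemma iint_cst1 a b : a <= b -> iint (fun _ : R => 1) a b = b - a.
Proof.
move=> ab; rewrite /iint integral_cst//= mul1e lebesgue_measure_itv /= lte_fin.
case: ifPn => [_|]; first by rewrite -EFinB.
by rewrite -leNgt => ba; rewrite (@le_anti _ _ a b) ?subrr// ab.
Qed.

Lemma iint_le_fun phi psi (a b : R) : test_fun phi -> test_fun psi ->
  (forall x, phi x <= psi x) -> iint phi a b <= iint psi a b.
Proof.
move=> tf tp h; rewrite -lee_fin -!iintE//; apply: ge0_le_integral => //.
- by move=> x _; rewrite lee_fin test_fun_ge0.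
- exact: test_fun_measurable.
- exact: test_fun_measurable.
- by move=> x _; rewrite lee_fin h.
Qed.

Lemma iintD_fun phi psi chi (a b : R) : test_fun phi -> test_fun psi ->
  (forall x, chi x = phi x + psi x) -> iint chi a b = iint phi a b + iint psi a b.
Proof.
move=> tf tp h; rewrite [in LHS]/iint.
under eq_integral do rewrite h EFinD.
rewrite ge0_integralD//=.
- by rewrite !iintE.
- by move=> x _; rewrite lee_fin test_fun_ge0.
- exact: test_fun_measurable.
- by move=> x _; rewrite lee_fin test_fun_ge0.
- exact: test_fun_measurable.
Qed.

Lemma test_indic (B : set (measurableTypeR R)) : measurable B -> test_fun (\1_B : R -> R).
Proof.
move=> mB; split; first exact: measurable_indic.
by move=> x; rewrite indicE ler0n /= lern1 leq_b1.
Qed.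

Lemma iint_indic (B : set (measurableTypeR R)) (a b : R) : measurable B ->
  (iint (\1_B : R -> R) a b)%:E = lebesgue_measure (B `&` `]a, b]%classic).
Proof.
by move=> mB; rewrite -iintE ?integral_indic//; exact: test_indic.
Qed.

End TestOrbits.

(** * The grid formed by the points c_i and the prematching orbits *)

Section MatchingGrid.
Variables (R : realType) (Omega : set nat) (p : nat -> R) (n : nat).
Variables (c : nat -> R) (T : nat -> R -> R) (k d : 'I_n.+1 -> nat -> R).
Hypothesis HR : random_map Omega p n.+1 c T.
Hypothesis HA : class_RA Omega p c T k d.
Variables (M : R -> nat) (Y : R -> set R).
Variables (kc lc : R -> (nat -> nat) -> nat).
Hypothesis HM : strong_random_matching Omega p n.+1 c T M Y kc lc.
Hypothesis Hstop : forall z, crit n.+1 c z ->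
  stopping_rule Omega (kc z) /\ stopping_rule Omega (lc z).
Hypothesis Hfin : forall z, crit n.+1 c z ->
  finite_set (prematching_orbit Omega T z^'- (kc z)) /\
  finite_set (prematching_orbit Omega T z^'+ (lc z)).

Let I : set R := Idom n.+1 c.
Let avg := average Omega p c k d.
Let prim := primitive n c.

Lemma prematching_into m s t : (m < n)%N ->
  prematching_orbit Omega T (side_nbhs (c m.+1, s)) t `<=` I.
Proof.
move=> mn _ [w [i [Ow _ ->]]]; have ix := crit_inner HR s mn.
rewrite (val_at_side HR HA (words_mkseq (i := i) Ow) ix).
by apply: (path_end_into HR HA); [exact: words_mkseq|case: ix].
Qed.

(** What matching yields in terms of integrals: a nonzero invariant step weight [F], of no definite
    sign, and bounded sums for the difference of two test functions whose primitives agree on the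
    grid, the invariant terms of their decompositions being equal. *)
Lemma matching_grid : exists (K : nat) (ds : nat -> R),
  [/\ [/\ ds 0%N = c 0%N, ds K = c n.+1,
          forall i, (i < K)%N -> ds i < ds i.+1 &
          forall i, (i <= K)%N -> I (ds i)],
      (exists F : nat -> R, (exists2 i, (i < K)%N & F i != 0) /\
        forall psi, test_fun psi ->
          \sum_(i < K) F i * iint (avg psi) (ds i) (ds i.+1) =
          \sum_(i < K) F i * iint psi (ds i) (ds i.+1)) &
      forall psi1 psi2, test_fun psi1 -> test_fun psi2 ->
        (forall i, (i <= K)%N -> prim psi1 (ds i) = prim psi2 (ds i)) ->
        forall y, I y -> exists B, forall N,
          `|\sum_(t < N) (prim (iter t avg psi1) y - prim (iter t avg psi2) y)| <= B].
Proof.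
have [rho /andP[rho0 rho1] hb] := expanding_branches HR HA.
have abs_branch i iN := (hb i iN).2.
have slope_neq0 i j iN Oj := (hb i iN).1 j Oj.
pose D := [set x | exists2 i, (i <= n.+1)%N & c i = x] `|`
  [set x | exists2 m, (m < n)%N &
    prematching_orbit Omega T (c m.+1)^'- (kc (c m.+1)) x \/
    prematching_orbit Omega T (c m.+1)^'+ (lc (c m.+1)) x].
have czm m : (m < n)%N -> crit n.+1 c (c m.+1) by move=> mn; exists m.+1.
have c0N : c 0%N < c n.+1 by apply: (points_lt HR); rewrite leqnn.
have finD : finite_set D.
  rewrite finite_setU; split.
    apply: (sub_finite_set _ (finite_image c (finite_II n.+2))) => _ [i iN <-].
    by exists i.
  apply: (@sub_finite_set _ _ (\bigcup_(m in `I_n)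
    (prematching_orbit Omega T (c m.+1)^'- (kc (c m.+1)) `|`
     prematching_orbit Omega T (c m.+1)^'+ (lc (c m.+1))))).
    by move=> x [m mn h]; exists m.
  apply: bigcup_finite; first exact: finite_II.
  by move=> m mn; rewrite finite_setU; apply: Hfin; exact: czm.
have DI x : D x -> c 0%N <= x <= c n.+1.
  case=> [[i iN <-]|[m mn [h|h]]].
  - by rewrite !(points_le HR)// ?iN ?leqnn.
  - by apply/IdomE; exact: (prematching_into (s := false) mn h).
  - by apply/IdomE; exact: (prematching_into (s := true) mn h).
have Dc i : (i <= n.+1)%N -> D (c i) by move=> iN; left; exists i.
have [K [ds [ds0 dsK ds_lt dsI dsD]]] :=
  finite_set_grid c0N finD (Dc 0%N isT) (Dc n.+1 (leqnn _)) DI.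
have ds_in i : (i <= K)%N -> I (ds i) by move=> /dsI h; exact/IdomE.
have ds_crit m : (m < n)%N -> exists2 i, (i < K)%N & ds i = c m.+1.
  move=> mn; have [i iK ic] := dsD _ (Dc m.+1 (leqW mn)).
  exists i => //; rewrite ltn_neqAle iK andbT; apply/eqP => iE.
  have : c m.+1 < c n.+1 by apply: (points_lt HR); rewrite ltnS mn leqnn.
  by rewrite -ic iE dsK ltxx.
have jump_res0 eta m : norm_bounded eta -> (forall i, (i <= K)%N -> eta (ds i) = 0) ->
    (m < n)%N -> jump Omega p c k d m
      (resolvent Omega (left_weight p c k) (left_step c k d) eta) = 0.
  move=> be e0 mn; apply: (jump_resolvent_eq0 HR HA (ltW rho0) rho1 abs_branch HM Hstop (D := D)) => //.
  - by move=> i iN; exact/Dc/leqW.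
  - by move=> z [[|m'] //= mN <-]; split => x h; right; exists m' => //; [left|right].
  - by move=> y /dsD[i iK <-]; exact: e0.
have orb psi := average_orbit HR HA slope_neq0 abs_branch (psi := psi).
have primB psi i : test_fun psi -> (i < K)%N ->
    prim psi (ds i.+1) - prim psi (ds i) = iint psi (ds i) (ds i.+1).
  move=> tp iK; rewrite primitiveB//; [exact/ds_in/ltnW|exact: ds_in|].
  exact/ltW/ds_lt.
have bumps i : (i < K)%N -> exists P C e, [/\ transfer_orbit Omega p c k d P C,
  e != 0 & forall j, (j < K)%N -> P 0%N (ds j.+1) - P 0%N (ds j) = (j == i)%:R * e].
  (* The indicator of a cell: its primitive grows over that cell only. *)
  move=> iK; pose B := `]ds i, ds i.+1]%classic : set (measurableTypeR R).
  have mB : measurable B by exact: measurable_itv.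
  exists (fun t => prim (iter t avg (\1_B))), (c n.+1 - c 0%N), (ds i.+1 - ds i).
  split; [exact/orb/test_indic|by rewrite subr_eq0 gt_eqF// ds_lt|].
  move=> j jK; rewrite primB//; last exact: test_indic.
  apply: EFin_inj; rewrite iint_indic//.
  have [->|ji] := eqVneq j i.
    rewrite setIid mul1r lebesgue_measure_itv /= lte_fin ds_lt//.
  rewrite mul0r (_ : _ `&` _ = set0) ?measure0//; apply/seteqP; split => x //=.
  rewrite !in_itv /= => -[/andP[x1 x2] /andP[x3 x4]].
  case: (ltngtP j i) => [lt|lt|/eqP]; last by rewrite (negbTE ji).
    have : ds j.+1 <= ds i.
      move: lt; rewrite leq_eqVlt => /predU1P[->//|lt].
      by apply/ltW/(ds_mono ds_lt); rewrite lt ltnW.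
    by move=> h; move: (le_lt_trans h x1); rewrite ltNge x4.
  have : ds i.+1 <= ds j.
    move: lt; rewrite leq_eqVlt => /predU1P[->//|lt].
    by apply/ltW/(ds_mono ds_lt); rewrite lt ltnW.
  by move=> h; move: (le_lt_trans h x3); rewrite ltNge (x2 : x <= ds i.+1).
have dec := orbit_decomposition HR HA (ltW rho0) rho1 abs_branch ds0 ds_lt ds_in
  ds_crit jump_res0 bumps.
exists K, ds; split => //.
(* The weight comes from decomposing the evaluation at c_N. For psi = 1 every primitive in the orbit
   takes the value c_N - c_0 there, so if [F] were 0 on all cells, N (c_N - c_0) would stay
   bounded. *)
- have IN : I (c n.+1) by apply/IdomE; rewrite lexx ltW.
  have [kap kA [B B0 hB]] := dec _ IN.
  pose F i := density_at Omega p c k d kap (ds i).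
  have FE psi : comb (grid_comb Omega p c k d K ds kap) (prim psi) =
      \sum_(i < K) F i * (prim psi (ds i.+1) - prim psi (ds i)) by exact: comb_grid.
  exists F; split; last first.
    move=> psi tp; have op := orb psi tp.
    have := grid_comb_invariant HR HA (ltW rho0) rho1 abs_branch ds0 ds_lt
      jump_res0 0 kA op.
    rewrite /= !FE => h.
    have sE phi : test_fun phi -> \sum_(i < K) F i * iint phi (ds i) (ds i.+1) =
        \sum_(i < K) F i * (prim phi (ds i.+1) - prim phi (ds i)).
      by move=> tf; apply: eq_bigr => i _; rewrite primB.
    by rewrite !sE//; exact: (test_average k d HR).
  apply: contrapT => noF.
  have F0 i : (i < K)%N -> F i = 0.
    by move=> iK; apply/eqP/negPn/negP => Fi; apply: noF; exists i.
  have t1 := test_cst1 R.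
  have it1 t : iter t avg (fun=> 1) = (fun=> 1 : R).
    by elim: t => //= t ->; exact: (average_cst1 k d HR).
  have : c n.+1 - c 0%N = 0.
    apply: (@bounded_multiples_eq0 _ _ (B * (c n.+1 - c 0%N))) => N.
    apply: le_trans (hB _ _ N (orb _ t1)); rewrite FE.
    rewrite [X in _ - _ * X]big1 ?mulr0 ?subr0; last by move=> i _; rewrite F0// mul0r.
    rewrite (eq_bigr (fun=> c n.+1 - c 0%N)) ?sumr_const ?card_ord ?mulr_natl//.
    by move=> t _; rewrite it1 /prim primitiveE// iint_cst1// ltW.
  by move/eqP; rewrite subr_eq0 gt_eqF.
- move=> psi1 psi2 t1 t2 e12 y Iy.
  have [kap kA [B B0 hB]] := dec _ Iy.
  exists (B * (c n.+1 - c 0%N) + B * (c n.+1 - c 0%N)) => N.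
  have h1 := hB _ _ N (orb _ t1); have h2 := hB _ _ N (orb _ t2).
  have E : comb (grid_comb Omega p c k d K ds kap) (prim psi1) =
           comb (grid_comb Omega p c k d K ds kap) (prim psi2).
    rewrite !comb_grid; apply: eq_bigr => i _.
    by rewrite !e12// ltnW.
  rewrite sumrB; apply: le_trans (lerD h1 h2); rewrite /= E.
  set a := \sum_(t < N) _; set b := \sum_(t < N) _; set x := N%:R * _.
  have -> : a - b = (a - x) - (b - x) by lra.
  exact: ler_normB.
Qed.

End MatchingGrid.

Lemma eq_measure_off d (X : measurableType d) (R : realType)
    (mu : {measure set X -> \bar R}) (A B N : set X) :
  measurable A -> measurable B -> measurable N -> mu N = 0%E ->
  (forall x, ~ N x -> A x <-> B x) -> mu A = mu B.
Proof.
move=> mA mB mN N0 h.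
have key C : measurable C -> mu C = mu (C `\` N).
  move=> mC; have CN0 : mu (C `&` N) = 0%E.
    have mCN : measurable (C `&` N) by exact: measurableI.
    apply/eqP; rewrite -measure_le0 -N0 le_measure ?inE//; exact: subIsetr.
  have : mu ((C `&` N) `|` (C `\` N)) = (mu (C `&` N) + mu (C `\` N))%E.
    apply: measureU; [exact: measurableI|exact: measurableD|].
    by apply/seteqP; split => x // [[_ Nx] [_ nNx]].
  by rewrite CN0 add0e => <-; rewrite setUIDK.
rewrite (key A)// (key B)//; congr (mu _).
by apply/seteqP; split => x [Cx nNx]; split => //; apply/(h x nNx).
Qed.

(** * Stationarity in terms of integrals of test functions *)

Section StationaryMeasures.
Variables (R : realType) (Omega : set nat) (p : nat -> R) (n : nat).
Variables (c : nat -> R) (T : nat -> R -> R) (k d : 'I_n.+1 -> nat -> R).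
Hypothesis HR : random_map Omega p n.+1 c T.
Hypothesis HA : class_RA Omega p c T k d.

Let I : set R := Idom n.+1 c.
Let avg := average Omega p c k d.
Let st := left_step c k d.
Let E0 : set (measurableTypeR R) := [set x | exists2 i, (i <= n.+1)%N & c i = x].
Let p0 j : Omega j -> 0 <= p j.
Proof. by move=> Oj; rewrite ltW// (weight_gt0 HR). Qed.

Lemma measurable_Idom : measurable (I : set (measurableTypeR R)).
Proof. exact: measurable_itv. Qed.

Lemma measurable_finite (A : set (measurableTypeR R)) : finite_set A -> measurable A.
Proof.
move=> /finite_seqP[s ->]; elim: s => [|x s IH].
  by rewrite (_ : [set` [::]] = set0)//; apply/seteqP; split.
rewrite (_ : [set` x :: s] = [set x] `|` [set` s]).
  by apply: measurableU => //; exact: measurable_set1.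
apply/seteqP; split => y /=; rewrite inE.
  by move=> /predU1P[->|ys]; [left|right].
by case=> [->|ys]; rewrite ?eqxx// ys orbT.
Qed.

Let finE0 : finite_set E0.
Proof.
apply: (sub_finite_set _ (finite_image c (finite_II n.+2))) => _ [i iN <-].
by exists i.
Qed.

Let stE j x : Omega j -> I x -> ~ E0 x -> T j x = st x j.
Proof.
move=> Oj Ix nE; have bN := branch_le n c (x, false).
have /andP[h1 h2] := branch_bounds HR (x := (x, false)) Ix.
rewrite (affine_branch HA bN Oj)//; apply/andP; split; rewrite lt_neqAle ?h1 ?h2 andbT.
  by apply/eqP => e; apply: nE; eexists; [exact: leqW bN|exact: e].
by apply/eqP => e; apply: nE; eexists; [|exact: esym e].
Qed.

Lemma measurable_preimage_map j (B : set (measurableTypeR R)) : Omega j ->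
  measurable B -> measurable (I `&` T j @^-1` B : set (measurableTypeR R)).
Proof.
move=> Oj mB.
have mst : measurable (st^~ j @^-1` B : set (measurableTypeR R)).
  by rewrite -[X in measurable X]setTI; apply: (measurable_left_step k d HR j).
rewrite (_ : _ `&` _ = ((I `&` st^~ j @^-1` B) `\` E0) `|` (I `&` T j @^-1` B `&` E0)).
  apply: measurableU.
    apply: measurableD; last exact: measurable_finite.
    by apply: measurableI => //; exact: measurable_Idom.
  by apply: measurable_finite; apply: sub_finite_set finE0 => x [].
apply/seteqP; split => x.
  move=> [Ix Bx]; have [Ex|nEx] := pselect (E0 x); first by right.
  by left; split => //; split => //=; rewrite -stE.
by case=> [[[Ix Bx] nEx]|[]//]; split => //=; rewrite stE.
Qed.

Variable mu : probability (measurableTypeR R) R.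
Hypothesis mu_ac : mu `<< (@lebesgue_measure R).
Hypothesis mu_I : mu I = 1%E.

Let mu_nI : mu (~` I) = 0%E.
Proof. by rewrite probability_setC ?mu_I ?subee//; exact: measurable_Idom. Qed.

Let mu_E0 : mu E0 = 0%E.
Proof.
have E0l : lebesgue_measure E0 = 0%E.
  by apply: countable_lebesgue_measure0; exact: finite_set_countable.
have null : (@lebesgue_measure R).-null_set E0.
  by apply/measure0_null_setP => //; exact: measurable_finite.
exact: (mu_ac null (measurable_finite finE0)).
Qed.

Let mN : measurable (~` I `|` E0 : set (measurableTypeR R)).
Proof.
apply: measurableU; last exact: measurable_finite.
by apply: measurableC; exact: measurable_Idom.
Qed.

Let mu_N : mu (~` I `|` E0) = 0%E.
Proof.
apply/eqP; rewrite -measure_le0 (le_trans (measureU2 _ _ _))//.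
- by apply: measurableC; exact: measurable_Idom.
- exact: measurable_finite.
by rewrite [X in (X + _)%E]mu_nI [X in (_ + X)%E]mu_E0 adde0.
Qed.

Let measurable_step_preimage j (B : set (measurableTypeR R)) : measurable B ->
  measurable (st^~ j @^-1` B : set (measurableTypeR R)).
Proof.
by move=> mB; rewrite -[X in measurable X]setTI; exact: (measurable_left_step k d HR j).
Qed.

Lemma measure_preimage_map j (B : set (measurableTypeR R)) : Omega j -> measurable B ->
  mu (I `&` T j @^-1` B) = mu (st^~ j @^-1` B).
Proof.
move=> Oj mB; apply: (@eq_measure_off _ _ _ mu _ _ (~` I `|` E0)) => //.
- exact: measurable_preimage_map.
- exact: measurable_step_preimage.
move=> x /not_orP[/contrapT Ix nE]; split => /= [[_]|]; first by rewrite stE.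
by rewrite -stE.
Qed.

(** [mu] charges neither the complement of I nor the points c_i, and elsewhere T_j is [left_step].
    Stationarity therefore says that [mu] equals the series of its weighted images on all Borel
    sets, and integrals follow; conversely, test functions include indicators. *)
Lemma stationary_test : stationary Omega p n.+1 c T mu <->
  forall psi, test_fun psi ->
    (\int[mu]_x (psi x)%:E = \int[mu]_x (avg psi x)%:E)%E.
Proof.
have stE' (B : set (measurableTypeR R)) : measurable B ->
    (\esum_(j in Omega) ((p j)%:E * mu (I `&` T j @^-1` B)) =
     \int[mu]_x (avg (\1_B) x)%:E)%E.
  move=> mB; rewrite (integral_average k d HR)//; last exact: test_indic.
  apply: eq_esum => j Oj; congr (_ * _)%E; rewrite measure_preimage_map//.
  have -> : (fun x => ((\1_B : R -> R) (left_step c k d x j))%:E) =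
            (fun x => (\1_(st^~ j @^-1` B) x)%:E) by [].
  by rewrite integral_indic// ?setIT//; exact: measurable_step_preimage.
split=> [stat psi tp|h B mB BI]; last first.
  by rewrite stE'// -h ?integral_indic// ?setIT//; exact: test_indic.
have w0 j : 0 <= if j \in Omega then p j else 0.
  by case: ifPn => // /set_mem; exact: p0.
pose w j := NngNum (w0 j).
pose m j := mscale (w j) (pushforward mu (st^~ j : measurableTypeR R -> measurableTypeR R))
  : {measure set (measurableTypeR R) -> \bar R}.
pose nu := mseries (m (measurable_left_step k d HR)) 0.
have nuE (B : set (measurableTypeR R)) : measurable B -> mu B = nu B.
  move=> mB; rewrite (_ : mu B = mu (I `&` B)); last first.
    apply: (@eq_measure_off _ _ _ mu _ _ (~` I `|` E0)) => //.
      by apply: measurableI => //; exact: measurable_Idom.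
    by move=> x /not_orP[/contrapT Ix nE]; split => // -[].
  rewrite stat//; last by apply: measurableI => //; exact: measurable_Idom.
  rewrite (esum_nneseries (Omega := Omega)); last first.
    by move=> j Oj; rewrite mule_ge0 ?lee_fin ?p0.
  rewrite /nu /mseries; apply: congr_lim; apply/funext => N; apply: eq_bigr => j _.
  rewrite -[RHS]/((if j \in Omega then p j else 0)%:E * mu (st^~ j @^-1` B))%E.
  case: ifPn => [/set_mem Oj|_]; last by rewrite mul0e.
  congr (_ * _)%E; apply: (@eq_measure_off _ _ _ mu _ _ (~` I `|` E0)) => //.
  - apply: measurable_preimage_map => //.
    by apply: measurableI => //; exact: measurable_Idom.
  - exact: measurable_step_preimage.
  move=> x /not_orP[/contrapT Ix nE]; rewrite /= stE//; split => [[_ []]//|Bx].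
  split => //; split => //; exact: (left_step_into HR HA).
have mpsi := @test_fun_measurable _ psi setT tp.
have psi0 x : setT x -> (0 <= (psi x)%:E)%E by move=> _; rewrite lee_fin test_fun_ge0.
rewrite (@eq_measure_integral _ _ _ setT nu mu); last by move=> A mA _; exact: nuE.
rewrite ge0_integral_measure_series//.
rewrite (integral_average k d HR)// esum_nneseries; last first.
  move=> j Oj; rewrite mule_ge0 ?lee_fin ?p0// test_integral_ge0//.
  exact: (test_fun_step k d HR).
apply: congr_lim; apply/funext => N; apply: eq_bigr => j _.
rewrite ge0_integral_mscale//=; case: ifPn => _; last exact: mul0e.
have mst : measurable_fun setT (st^~ j : measurableTypeR R -> measurableTypeR R).
  exact: (measurable_left_step k d HR j).
rewrite (ge0_integral_pushforward mst)//; last by move=> y _; exact: psi0.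
Qed.

End StationaryMeasures.

(** * Probabilities with a step density *)

Section StepProbability.
Variable R : realType.
Notation leb := (@lebesgue_measure R).
Variables (K : nat) (ds g : nat -> R).
Hypothesis ds_le : forall i, (i < K)%N -> ds i <= ds i.+1.
Hypothesis g0 : forall i, 0 <= g i.
Hypothesis g1 : \sum_(i < K) g i * (ds i.+1 - ds i) = 1.

Let cell i : set (measurableTypeR R) := `]ds i, ds i.+1]%classic.
Let mcell i : measurable (cell i). Proof. exact: measurable_itv. Qed.

Let m i : {measure set (measurableTypeR R) -> \bar R} :=
  mscale (NngNum (g0 i)) (mrestr leb (mcell i)).
Let mtot := msum m K.

Let mtotE B : mtot B = (\sum_(i < K) (g i)%:E * leb (B `&` cell i))%E.
Proof. by []. Qed.

Let mtot1 : mtot setT = 1%E.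
Proof.
rewrite mtotE -[1%E]/(1%:E) -g1 -sumEFin; apply: eq_bigr => i _.
rewrite setTI /cell lebesgue_measure_itv /= lte_fin EFinM; congr (_ * _)%E.
have := ds_le (ltn_ord i); rewrite le_eqVlt => /predU1P[->|->//].
by rewrite ltxx subrr.
Qed.

Let mprob := Measure_isProbability.Build _ _ _ mtot mtot1.
Let P : probability (measurableTypeR R) R := HB.pack (msum m K) mprob.

Lemma step_probability : exists mu : probability (measurableTypeR R) R,
  (forall B, mu B = \sum_(i < K) (g i)%:E * leb (B `&` `]ds i, ds i.+1]%classic))%E /\
  forall psi, test_fun psi -> (\int[mu]_x (psi x)%:E)%E =
    (\sum_(i < K) g i * iint psi (ds i) (ds i.+1))%:E.
Proof.
exists P; split=> // psi tp.
have psi0 x : setT x -> (0 <= (psi x)%:E)%E by move=> _; rewrite lee_fin test_fun_ge0.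
have mpsi D := @test_fun_measurable _ psi D tp.
transitivity (\int[mtot]_x (psi x)%:E)%E; first by [].
rewrite (ge0_integral_measure_sum m measurableT psi0 (mpsi setT)) -sumEFin; apply: eq_bigr => i _.
rewrite (@ge0_integral_mscale _ _ R (mrestr leb (mcell i)) setT measurableT (NngNum (g0 i)) _ (mpsi setT) psi0) EFinM; congr (_ * _)%E.
have mC : measurable (~` cell i) := measurableC (mcell i).
rewrite -iintE// -(setUv (cell i)) (ge0_integral_setU _ (mcell i) mC) //.
- rewrite [X in (_ + X)%E]null_set_integral//; last by rewrite /= /mrestr setICl measure0.
  rewrite adde0; apply: eq_measure_integral => A mA AD.
  by rewrite /= /mrestr (setIidl AD).
- exact: mpsi.
- exact: mpsi.
- by move=> x _; exact: psi0.
- by apply/disj_setPCl.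
Qed.

End StepProbability.

(** * The grid cells as a partition of I *)

Section Cells.
Variables (R : realType) (n : nat) (c : nat -> R) (K : nat) (ds : nat -> R).
Hypothesis ds0 : ds 0%N = c 0%N.
Hypothesis dsK : ds K = c n.+1.
Hypothesis ds_lt : forall i, (i < K)%N -> ds i < ds i.+1.

Lemma cell_unique i j x : (i < K)%N -> (j < K)%N ->
  ds i < x <= ds i.+1 -> ds j < x <= ds j.+1 -> i = j.
Proof.
move=> iK jK /andP[i1 i2] /andP[j1 j2].
have le a b : (a < b)%N -> (b <= K)%N -> ds a.+1 <= ds b.
  rewrite leq_eqVlt => /predU1P[->//|ab] bK.
  by apply/ltW/(ds_mono ds_lt); rewrite ab.
case: (ltngtP i j) => // h.
  by have := le_lt_trans (le _ _ h (ltnW jK)) j1; rewrite ltNge i2.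
by have := le_lt_trans (le _ _ h (ltnW iK)) i1; rewrite ltNge j2.
Qed.

Lemma cell_cover x : c 0%N < x <= c n.+1 ->
  exists2 i, (i < K)%N & ds i < x <= ds i.+1.
Proof.
rewrite -ds0 -dsK => /andP[]; elim: (K) => [h1 h2|m IH h1 h2].
  by have := lt_le_trans h1 h2; rewrite ltxx.
have [xm|mx] := leP x (ds m); last by exists m => //; rewrite mx.
by have [i im ix] := IH h1 xm; exists i => //; exact: leqW.
Qed.

Lemma cell_in i x : (i < K)%N -> ds i < x <= ds i.+1 -> c 0%N < x <= c n.+1.
Proof.
move=> iK /andP[h1 h2]; rewrite -ds0 -dsK; apply/andP; split.
  apply: le_lt_trans h1; case: i iK {h2} => [//|i iK].
  by apply/ltW/(ds_mono ds_lt); rewrite /= ltnW.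
apply: le_trans h2 _; move: iK; rewrite leq_eqVlt => /predU1P[->//|iK].
by apply/ltW/(ds_mono ds_lt); rewrite iK leqnn.
Qed.

Lemma piecewise_constant_cells (f : R -> R) (a : nat -> R) :
  (forall i, (i < K)%N -> {ae lebesgue_measure,
     forall x, x \in `]ds i, ds i.+1] -> f x = a i}) ->
  piecewise_constant n.+1 c f.
Proof.
move=> fa; have c0N : c 0%N <= c n.+1.
  rewrite -ds0 -dsK; case: (posnP K) => [->//|K0].
  by apply/ltW/(ds_mono ds_lt); rewrite K0 leqnn.
(* The half-open cells miss c_0, which is added as a degenerate interval with index 0. *)
pose J (i : 'I_K.+1) : interval R :=
  if nat_of_ord i is i'.+1 then `]ds i', ds i'.+1] else `[c 0%N, c 0%N].
exists K.+1, J, (fun i => if nat_of_ord i is i'.+1 then a i' else f (c 0%N)); split.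
- move=> [i iK] [j jK] _ _ [x [/= xi xj]]; apply: val_inj => /=.
  move: xi xj; rewrite /J /=; case: i iK => [|i] iK; case: j jK => [|j] jK //=; rewrite !in_itv /=.
  + move=> h1 h2; have /andP[h3 _] := cell_in jK h2.
    by move: h1; rewrite -eq_le => /eqP e; move: h3; rewrite e ltxx.
  + move=> h2 h1; have /andP[h3 _] := cell_in iK h2.
    by move: h1; rewrite -eq_le => /eqP e; move: h3; rewrite e ltxx.
  + by move=> h1 h2; congr S; exact: (cell_unique (x := x)).
- apply/seteqP; split => x.
    move=> [[i iK] _]; rewrite /J /=; case: i iK => [|i] iK /=; rewrite !in_itv /=.
      by move=> h; apply/IdomE; rewrite -eq_le in h; rewrite -(eqP h) lexx.
    by move=> /(cell_in iK)/andP[h1 h2]; apply/IdomE; rewrite ltW.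
  move=> /IdomE/andP[]; rewrite le_eqVlt => /predU1P[<- _|].
    by exists ord0 => //=; rewrite /J /= in_itv /= lexx.
  move=> x0 xN; have [|i iK ix] := @cell_cover x; first by rewrite x0.
  by exists (Ordinal (iK : (i.+1 < K.+1)%N)) => //=; rewrite /J /= in_itv.
- move=> [[|i] iK]; rewrite /J /=; last exact: fa.
  apply: aeW => x; rewrite in_itv /= => h.
  by rewrite -eq_le in h; rewrite -(eqP h).
Qed.

End Cells.

(** * Invariance of the absolute value of an invariant step function *)

Section StepAbsoluteValue.
Variables (R : realType) (Omega : set nat) (p : nat -> R) (n : nat).
Variables (c : nat -> R) (T : nat -> R -> R) (k d : 'I_n.+1 -> nat -> R).
Hypothesis HR : random_map Omega p n.+1 c T.
Let avg := average Omega p c k d.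
Variables (K : nat) (ds F : nat -> R).
Hypothesis ds_lt : forall i, (i < K)%N -> ds i < ds i.+1.
Hypothesis F_inv : forall psi, test_fun psi ->
  \sum_(i < K) F i * iint (avg psi) (ds i) (ds i.+1) =
  \sum_(i < K) F i * iint psi (ds i) (ds i.+1).

Let M psi := \sum_(i < K) `|F i| * iint psi (ds i) (ds i.+1).

Let cellU (A : set nat) : set (measurableTypeR R) :=
  \bigcup_(i in [set i | (i < K)%N /\ A i]) `]ds i, ds i.+1]%classic.

Let cut (A : set nat) (psi : R -> R) x := psi x * \1_(cellU A) x.

Let test_cut A psi : test_fun psi -> test_fun (cut A psi).
Proof.
move=> [mp hp]; split.
  apply: measurable_funM => //; apply: measurable_indic.
  by apply: bigcup_measurable => i _; exact: measurable_itv.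
move=> x; rewrite /cut indicE; have /andP[h0 h1] := hp x.
by case: (x \in _); rewrite ?mulr1 ?mulr0 ?h0 ?h1 ?lexx ?ler01.
Qed.

Let iint_cut A psi i : (i < K)%N -> test_fun psi ->
  iint (cut A psi) (ds i) (ds i.+1) = if `[< A i >] then iint psi (ds i) (ds i.+1) else 0.
Proof.
move=> iK tp; rewrite /iint; case: asboolP => Ai.
  congr fine; apply: eq_integral => x; rewrite inE /= => xi.
  by rewrite /cut indicE mem_set ?mulr1//; exists i.
rewrite (eq_integral (cst 0%E)) ?integral0// => x; rewrite inE /= => xi.
rewrite /cut indicE memNset ?mulr0// => -[j [jK Aj] /= xj]; apply: Ai.
rewrite !in_itv /= in xi xj.
by rewrite (cell_unique ds_lt iK jK xi xj).
Qed.

(** Cut psi into its parts on the cells with F > 0 and with F < 0. Then M psi is the difference of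
    the F-integrals of the two parts, which invariance lets one replace by their averages; since
    averaging is positive, the result is at most M of the average of psi. *)
Let M_le psi : test_fun psi -> M psi <= M (avg psi).
Proof.
move=> tp; pose pos : set nat := [set i | 0 < F i]; pose neg : set nat := [set i | F i < 0].
pose psi1 := cut pos psi; pose psi2 := cut neg psi.
have t1 : test_fun psi1 by exact: test_cut.
have t2 : test_fun psi2 by exact: test_cut.
pose chi x := psi1 x + psi2 x.
have chi_le x : chi x <= psi x.
  have pn : ~ (cellU pos x /\ cellU neg x).
    move=> [[i [iK Pi] /= xi] [j [jK Nj] /= xj]]; rewrite !in_itv /= in xi xj.
    have ij := cell_unique ds_lt iK jK xi xj.
    by move: Pi Nj; rewrite /pos /neg /= ij => /lt_trans h /h; rewrite ltxx.
  rewrite /chi /psi1 /psi2 /cut !indicE; have p0 := test_fun_ge0 x tp.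
  case: (boolP (x \in cellU pos)) => hp; case: (boolP (x \in cellU neg)) => hn;
    rewrite ?mulr1 ?mulr0 ?addr0 ?add0r//.
  by case: pn; split; exact/set_mem.
have tchi : test_fun chi.
  split; first by apply: measurable_funD; [case: t1|case: t2].
  move=> x; rewrite addr_ge0 ?test_fun_ge0//= (le_trans (chi_le x))//.
  by case: tp => _ /(_ x)/andP[].
have E : M psi = \sum_(i < K) F i * iint psi1 (ds i) (ds i.+1)
               - \sum_(i < K) F i * iint psi2 (ds i) (ds i.+1).
  rewrite -sumrB; apply: eq_bigr => i _; rewrite !iint_cut//.
  case: (ltgtP 0 (F i)) => Fi.
  - by rewrite asboolT// asboolF ?mulr0 ?subr0 ?gtr0_norm// /neg /=; apply/negP; rewrite -leNgt ltW.
  - rewrite asboolF; last by apply/negP; rewrite -leNgt ltW.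
    by rewrite asboolT// mulr0 sub0r ltr0_norm// mulNr.
  - by rewrite -Fi normr0 !mul0r subr0.
rewrite E -(F_inv t1) -(F_inv t2) -sumrB; apply: ler_sum => i _.
have ta psi0 : test_fun psi0 -> test_fun (avg psi0) by exact: (test_average k d HR).
have iD : iint (avg chi) (ds i) (ds i.+1) =
    iint (avg psi1) (ds i) (ds i.+1) + iint (avg psi2) (ds i) (ds i.+1).
  apply: iintD_fun; [exact: ta|exact: ta|] => x.
    exact: (averageD k d HR x t1 t2 (fun=> erefl)).
have le : iint (avg chi) (ds i) (ds i.+1) <= iint (avg psi) (ds i) (ds i.+1).
  apply: iint_le_fun; [exact: ta|exact: ta|] => x.
    exact: (average_le k d HR x tchi tp chi_le).
rewrite -mulrBr (le_trans (ler_norm _))// normrM ler_wpM2l//.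
rewrite (le_trans _ le)// iD (le_trans (ler_normB _ _))//.
by rewrite !ger0_norm// iint_ge0//; exact: ta.
Qed.

(** The inequality holds for psi and for 1 - psi, and the two left-hand sides have the same sum as
    the two right-hand sides, namely M 1. Hence both are equalities. *)
Lemma abs_step_invariant psi : test_fun psi ->
  \sum_(i < K) `|F i| * iint (avg psi) (ds i) (ds i.+1) =
  \sum_(i < K) `|F i| * iint psi (ds i) (ds i.+1).
Proof.
move=> tp; apply/eqP; rewrite eq_le M_le// andbT.
pose psi' x := 1 - psi x.
have tp' : test_fun psi'.
  split; first by apply: measurable_funB => //; case: tp.
  by move=> x; case: tp => _ /(_ x) /andP[h0 h1]; apply/andP; rewrite /psi'; split; lra.
have one x : 1 = psi x + psi' x by rewrite /psi'; lra.
have t1 := test_cst1 R.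
have MD (phi phi' : R -> R) : test_fun phi -> test_fun phi' -> (forall x, 1 = phi x + phi' x) ->
    M (fun=> 1) = M phi + M phi'.
  move=> tf tf' h; rewrite /M -big_split; apply: eq_bigr => i _.
  by rewrite (iintD_fun _ _ tf tf' h) mulrDr.
have ta psi0 : test_fun psi0 -> test_fun (avg psi0) by exact: (test_average k d HR).
have e1 := MD _ _ tp tp' one.
have e2 : M (fun=> 1) = M (avg psi) + M (avg psi').
  apply: MD; [exact: ta|exact: ta|] => x.
  rewrite -(averageD k d HR (chi := fun=> 1) x tp tp' one).
  exact/esym/(congr1 (fun f => f x) (average_cst1 k d HR)).
have := M_le tp'; rewrite -/(M (avg psi)) -/(M psi).
by move: (M psi) (M psi') (M (avg psi)) (M (avg psi')) (M (fun=> 1)) e1 e2 => a b a' b' u; lra.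
Qed.

End StepAbsoluteValue.

(** * The invariant probability obtained by normalising the step function *)

Section StepDensity.
Variables (R : realType) (Omega : set nat) (p : nat -> R) (n : nat).
Variables (c : nat -> R) (T : nat -> R -> R) (k d : 'I_n.+1 -> nat -> R).
Hypothesis HR : random_map Omega p n.+1 c T.
Hypothesis HA : class_RA Omega p c T k d.
Let avg := average Omega p c k d.
Let I : set R := Idom n.+1 c.
Variables (K : nat) (ds F : nat -> R).
Hypothesis ds0 : ds 0%N = c 0%N.
Hypothesis dsK : ds K = c n.+1.
Hypothesis ds_lt : forall i, (i < K)%N -> ds i < ds i.+1.
Hypothesis F_neq0 : exists2 i, (i < K)%N & F i != 0.
Hypothesis F_inv : forall psi, test_fun psi ->
  \sum_(i < K) F i * iint (avg psi) (ds i) (ds i.+1) =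
  \sum_(i < K) F i * iint psi (ds i) (ds i.+1).
Notation leb := (@lebesgue_measure R).

Let Z := \sum_(i < K) `|F i| * (ds i.+1 - ds i).

Let Z_gt0 : 0 < Z.
Proof.
have [i iK Fi] := F_neq0; rewrite /Z (bigD1 (Ordinal iK))//=.
apply: ltr_wpDr; last by rewrite mulr_gt0 ?normr_gt0// subr_gt0 ds_lt.
by apply: sumr_ge0 => j _; rewrite mulr_ge0// subr_ge0 ltW// ds_lt.
Qed.

Let g i := `|F i| / Z.

Let g_ge0 i : 0 <= g i.
Proof. by rewrite /g divr_ge0// ltW. Qed.

Let g_sum1 : \sum_(i < K) g i * (ds i.+1 - ds i) = 1.
Proof.
rewrite (eq_bigr (fun i : 'I_K => `|F i| * (ds i.+1 - ds i) / Z)); last first.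
  by move=> i _; rewrite /g mulrAC.
by rewrite -mulr_suml divff// gt_eqF.
Qed.

Let f (x : R) : R := \sum_(i < K) g i * \1_(`]ds i, ds i.+1]%classic) x.

Let f_ge0 x : 0 <= f x.
Proof. by apply: sumr_ge0 => i _; rewrite mulr_ge0// indicE ler0n. Qed.

Let measurable_f : measurable_fun setT f.
Proof.
by apply: measurable_sum => i; apply: measurable_funM.
Qed.

Let integral_f (B : set (measurableTypeR R)) : measurable B ->
  (\int[leb]_(x in B) (f x)%:E =
   \sum_(i < K) (g i)%:E * leb (B `&` `]ds i, ds i.+1]%classic))%E.
Proof.
move=> mB; under eq_integral do rewrite -sumEFin.
have mi i : measurable_fun B (fun x => (g i * \1_(`]ds i, ds i.+1]%classic) x)%:E).
  by apply/measurable_EFinP; apply: measurable_funTS; apply: measurable_funM.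
rewrite ge0_integral_sum//; last first.
  by move=> i x _; rewrite lee_fin mulr_ge0// indicE ler0n.
apply: eq_bigr => i _; under eq_integral do rewrite EFinM.
rewrite ge0_integralZl_EFin//.
- by rewrite integral_indic// setIC.
- by apply/measurable_EFinP; apply: measurable_funTS; exact: measurable_indic.
Qed.

Lemma exists_step_acim : exists (mu : probability (measurableTypeR R) R) (h : R -> R),
  [/\ stationary_acim Omega p n.+1 c T mu, density_of n.+1 c mu h &
      piecewise_constant n.+1 c h].
Proof.
have ds_le i : (i < K)%N -> ds i <= ds i.+1 by move=> iK; exact/ltW/ds_lt.
have [mu [muE mu_test]] := step_probability ds_le g_ge0 g_sum1.
have mI : measurable (I : set (measurableTypeR R)) := measurable_Idom n c.
have cellI i : (i < K)%N -> I `&` `]ds i, ds i.+1]%classic = `]ds i, ds i.+1]%classic.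
  move=> iK; apply/setIidr => x /=; rewrite in_itv /= => xi; apply/IdomE.
  by have /andP[h ->] := cell_in ds0 dsK ds_lt iK xi; rewrite ltW.
have mu_I : mu I = 1%E.
  rewrite muE -[1%E]/(1%:E) -g_sum1 -sumEFin; apply: eq_bigr => i _.
  by rewrite cellI// lebesgue_measure_itv /= lte_fin ds_lt.
have mu_ac : mu `<< leb.
  move=> N N0 A mA AN; rewrite muE big1// => i _.
  rewrite N0 ?mule0//.
    by apply: measurableI => //; exact: measurable_itv.
  by move=> x [/AN].
exists mu, f; split.
- split=> //; apply/(stationary_test HR HA mu_ac mu_I) => psi tp.
  rewrite !mu_test//; last exact: (test_average k d HR).
  congr EFin.
  have E phi : \sum_(i < K) g i * iint phi (ds i) (ds i.+1) =
      (\sum_(i < K) `|F i| * iint phi (ds i) (ds i.+1)) / Z.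
    by rewrite mulr_suml; apply: eq_bigr => i _; rewrite /g mulrAC.
  by rewrite !E (abs_step_invariant HR ds_lt F_inv tp).
- split; last first.
    by move=> B mB BI; rewrite integral_f.
  apply/integrableP; split; first by apply/measurable_EFinP; exact: measurable_funTS.
  under eq_integral do rewrite gee0_abs ?lee_fin//.
  by rewrite integral_f// -muE mu_I ltry.
- apply: (piecewise_constant_cells ds0 dsK ds_lt (a := g)) => i iK.
  apply: aeW => x xi; rewrite /f (bigD1 (Ordinal iK))//= big1 => [|j ji].
    by rewrite indicE mem_set ?mulr1 ?addr0.
  rewrite indicE memNset ?mulr0// => xj; move/eqP: ji; apply; apply: val_inj => /=.
  rewrite !in_itv /= in xi xj; exact: (cell_unique ds_lt _ iK xj xi).
Qed.

End StepDensity.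

(** * Uniform approximation of continuous functions by step functions *)

Section StepApproximation.
Variable R : realType.
Notation leb := (@lebesgue_measure R).

Lemma uniformly_continuous_itv (g : R -> R) (a b e : R) : continuous g -> 0 < e ->
  exists2 dl, 0 < dl & forall x y, a <= x <= b -> `|x - y| < dl -> `|g x - g y| < e.
Proof.
move=> cg e0; have := @segment_compact R a b.
move=> /compact_near_coveringP /(_ R (0^'+)
  (fun dl x => forall y, `|x - y| < dl -> `|g x - g y| < e) _).
case=> [x _|r /= r0 h].
  have := cg x; move/cvgrPdist_lt => /(_ (e / 2)); rewrite divr_gt0// => /(_ isT).
  move=> /nbhs_ballP[r /= r0 hr].
  exists (ball x (r / 2), [set dl | 0 < dl < r / 2]) => /=.
    split; first by apply: nbhsx_ballx; rewrite divr_gt0.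
    exists (r / 2); first by rewrite /= divr_gt0.
    by move=> dl /=; rewrite sub0r normrN => h dl0; rewrite dl0 (le_lt_trans (ler_norm _) h).
  move=> [x' dl] /= [xx' /andP[dl0 dlr]] y x'y.
  have h1 : `|g x - g x'| < e / 2.
    by apply: hr; rewrite /ball /= in xx' *; rewrite (lt_le_trans xx')// ler_pdivrMr//; lra.
  have h2 : `|g x - g y| < e / 2.
    apply: hr; rewrite /ball /= in xx' *; rewrite -(subrK x' x) -addrA.
    by rewrite (le_lt_trans (ler_normD _ _))//; lra.
  rewrite -(subrK (g x) (g x')) -addrA (le_lt_trans (ler_normD _ _))// distrC; lra.
exists (r / 2); first by rewrite divr_gt0.
move=> x y xab xy; apply: (h (r / 2)) => //=.
- by rewrite sub0r normrN gtr0_norm ?divr_gt0//; lra.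
- by rewrite divr_gt0.
Qed.

Lemma step_approximation (g : R -> R) (a b e : R) : continuous g -> 0 < e -> a < b ->
  exists (m : nat) (y co : nat -> R), [/\ y 0%N = a, y m = b,
    forall l, (l < m)%N -> y l <= y l.+1 &
    forall l x, (l < m)%N -> y l < x <= y l.+1 -> `|g x - co l| <= e].
Proof.
move=> cg e0 ab; have [dl dl0 hd] := uniformly_continuous_itv a b cg e0.
pose m := (Num.bound ((b - a) / dl)).+1.
have m0 : 0 < m%:R :> R by rewrite ltr0n.
pose s := (b - a) / m%:R.
have s0 : 0 < s by rewrite divr_gt0// subr_gt0.
have sd : s < dl.
  rewrite /s ltr_pdivrMr// -ltr_pdivrMl// mulrC.
  apply: lt_trans (archi_boundP _) _; first by rewrite divr_ge0 ?subr_ge0// ltW.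
  by rewrite ltr_nat.
pose y l := a + l%:R * s.
have yS l : y l.+1 = y l + s by rewrite /y -natr1 mulrDl mul1r addrA.
have ym : y m = b by rewrite /y /s mulrCA divff ?gt_eqF// mulr1 addrC subrK.
have ymono l : (l <= m)%N -> a <= y l <= b.
  move=> lm; apply/andP; split; first by rewrite lerDl mulr_ge0// ltW.
  by rewrite -[leRHS]ym lerD2l ler_wpM2r ?ler_nat// ltW.
exists m, y, (fun l => g (y l.+1)); split => //.
- by rewrite /y mul0r addr0.
- by move=> l _; rewrite yS lerDl ltW.
move=> l x lm /andP[x1 x2]; apply: ltW; rewrite distrC; apply: hd; first exact: ymono.
by rewrite ger0_norm ?subr_ge0// (le_lt_trans _ sd)//; have := yS l; lra.
Qed.

End StepApproximation.

(** * Approximation of an absolutely continuous probability by step densities *)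

Section WeakApproximation.
Variable R : realType.
Notation leb := (@lebesgue_measure R).
Local Open Scope charge_scope.
Variables (mu : probability (measurableTypeR R) R) (a b : R).
Hypothesis mu_ac : mu `<< leb.
Hypothesis ab : a < b.

Let D (u v : R) : set (measurableTypeR R) := `]u, v]%classic.
Let mD u v : measurable (D u v). Proof. exact: measurable_itv. Qed.
Let rn (x : R) : R := fine (('d (charge_of_finite_measure mu) '/d leb) x).

Let rnE x : (rn x)%:E = ('d (charge_of_finite_measure mu) '/d leb) x.
Proof. by rewrite /rn fineK// Radon_Nikodym_fin_num. Qed.

Let rn_int u v : leb.-integrable (D u v) (EFin \o rn).
Proof.
apply: (integrableS measurableT) => //.
rewrite (_ : EFin \o rn = 'd (charge_of_finite_measure mu) '/d leb).
  exact: Radon_Nikodym_integrable.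
by apply/funext => x; rewrite /= rnE.
Qed.

Let test_mul_int psi w u v : test_fun psi -> leb.-integrable (D u v) (EFin \o w) ->
  leb.-integrable (D u v) (EFin \o (fun x => psi x * w x)).
Proof.
move=> [mp hp] iw; apply: (le_integrable _ _ _ iw) => //.
  apply/measurable_EFinP; apply: measurable_funM; first exact: measurable_funTS.
  by apply/measurable_EFinP; case/integrableP: iw.
move=> x _; rewrite /= lee_fin normrM ler_piMl//.
by have /andP[h0 h1] := hp x; rewrite ger0_norm.
Qed.

Let Rint u v (w : R -> R) : R := Rintegral leb (D u v) w.

Let test_integral psi u v : test_fun psi ->
  fine (\int[mu]_(x in D u v) (psi x)%:E)%E = Rint u v (fun x => psi x * rn x).
Proof.
move=> tp; congr fine.
rewrite -(Radon_Nikodym_change_of_variables mu_ac)//.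
  by apply: eq_integral => x _; rewrite EFinM rnE.
apply/integrableP; split; first exact: test_fun_measurable.
under eq_integral do rewrite gee0_abs ?lee_fin ?test_fun_ge0//.
by apply: le_lt_trans (test_integral_le mu tp (mD _ _)) _; rewrite ltey_eq fin_num_measure.
Qed.

Let RintD u v z w : u <= v -> v <= z -> leb.-integrable (D u z) (EFin \o w) ->
  Rint u z w = Rint u v w + Rint v z w.
Proof.
move=> uv vz iw; have E : D u z = D u v `|` D v z.
  by rewrite /D (@itv_bndbnd_setU _ _ _ (BRight v)) ?bnd_simp.
rewrite /Rint E Rintegral_setU//; first by rewrite -E.
apply/disj_setPS => x []; rewrite /D /= !in_itv /= => /andP[_ xv] /andP[vx _].
by move: vx; rewrite ltNge xv.
Qed.

Let Rint_sum (m : nat) (y : nat -> R) w : (forall l, (l < m)%N -> y l <= y l.+1) ->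
  leb.-integrable (D (y 0%N) (y m)) (EFin \o w) ->
  Rint (y 0%N) (y m) w = \sum_(l < m) Rint (y l) (y l.+1) w.
Proof.
elim: m => [|m IH] ym iw.
  by rewrite big_ord0 /Rint /D set_itv_ge ?Rintegral_set0// bnd_simp ltxx.
have y0m : y 0%N <= y m.
  elim: m {iw IH} ym => [//|m IH] ym; apply: le_trans (ym m (ltnW _)) => //.
  by apply: IH => l lm; apply: ym; exact: leqW.
have iw' : leb.-integrable (D (y 0%N) (y m)) (EFin \o w).
  apply: integrableS iw => //; apply: subset_itvl; rewrite bnd_simp; exact: ym.
rewrite big_ord_recr -IH//=; last by move=> l lm; apply: ym; exact: leqW.
by apply: RintD => //; exact: ym.
Qed.

(** The Radon-Nikodym density is approximated in L1 by a continuous function, and that function by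
    steps. Since 0 <= psi <= 1, the error is bounded by an L1 distance and is thus uniform in
    psi. *)
Lemma measure_step_approximation e : 0 < e ->
  exists (m : nat) (y co : nat -> R),
  (forall l, (l <= m)%N -> a <= y l <= b) /\
  (forall l, (l < m)%N -> y l <= y l.+1) /\
  forall psi, test_fun psi ->
    `|fine (\int[mu]_(x in `]a, b]%classic) (psi x)%:E)%E
      - \sum_(l < m) co l * iint psi (y l) (y l.+1)| <= e.
Proof.
(* One [e1] pays for the L1 distance to the continuous function and [e1 * (b - a)] for replacing
   that function by steps. *)
move=> e0; pose e1 := e / (1 + (b - a)).
have ba : 0 < 1 + (b - a) by rewrite addr_gt0 ?subr_gt0.
have e10 : 0 < e1 by rewrite divr_gt0.
have Dfin : (leb (D a b) < +oo)%E.
  by rewrite lebesgue_measure_itv /= lte_fin ab -EFinB ltry.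
have [gn [gc gi gcv]] := approximation_continuous_integrable (mD a b) Dfin (rn_int a b).
have [N hN] : exists N, (\int[leb]_(z in D a b) `|(rn z - gn N z)%:E| < e1%:E)%E.
  have /(_ [set z | z < e1%:E]%E) := gcv; case.
    by apply: open_nbhs_nbhs; split; [exact: open_ereal_lt_ereal | rewrite /= lte_fin].
  by move=> N _ h; exists N; exact: (h N (leqnn N)).
pose g := gn N.
have [m [y [co [y0 ym ymono yco]]]] := step_approximation (gc N) e10 ab.
have yle l : (l <= m)%N -> a <= y l /\ forall q, (q <= l)%N -> y q <= y l.
  elim: l => [|l IH] lm.
    by split; [rewrite y0 | move=> q; rewrite leqn0 => /eqP->].
  have [al ql] := IH (ltnW lm); have := ymono l lm => yl.
  split; first exact: le_trans al yl.
  move=> q; rewrite leq_eqVlt => /orP[/eqP->//|]; rewrite ltnS => /ql.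
  by move/le_trans; apply.
have yab l : (l <= m)%N -> a <= y l <= b.
  by move=> lm; rewrite -ym (yle l lm).1 (yle m (leqnn m)).2.
exists m, y, co; split => //; split => // psi tp.
have rnD u v := rn_int u v.
have gD : leb.-integrable (D a b) (EFin \o g) by exact: gi.
have subD l : (l < m)%N -> D (y l) (y l.+1) `<=` D a b.
  move=> lm; apply: subset_itv; rewrite bnd_simp.
    by have /andP[] := yab l (ltnW lm).
  by have /andP[] := yab l.+1 lm.
have idiff u v : D u v `<=` D a b ->
    leb.-integrable (D u v) (EFin \o (fun x => `|rn x - g x|)).
  move=> s; have := integrable_abse (integrableB (mD u v) (rnD u v) (integrableS (mD a b) (mD u v) s gD)).
  by apply: eq_integrable => // x _; rewrite /= -EFinB.
rewrite test_integral// -{1}y0 -ym Rint_sum//; last exact: test_mul_int.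
rewrite -sumrB.
have cell (l : 'I_m) : `|Rint (y l) (y l.+1) (fun x => psi x * rn x)
    - co l * iint psi (y l) (y l.+1)|
    <= Rint (y l) (y l.+1) (fun x => `|rn x - g x|) + e1 * (y l.+1 - y l).
  have lm := ltn_ord l.
  set u := y l; set v := y l.+1.
  have uv : u <= v by exact: ymono.
  have lebD : leb (D u v) = (v - u)%:E.
    rewrite /D lebesgue_measure_itv /= lte_fin; case: ltP => [_|vu]; rewrite ?EFinB//.
    by rewrite (le_anti (introT andP (conj uv vu))) subee.
  have cst r : leb.-integrable (D u v) (EFin \o (fun=> r)).
    apply/integrableP; split; first by apply/measurable_EFinP.
    under eq_integral do rewrite /= ?abse_EFin.
    by rewrite integral_cst// [X in (_ * X)%E]lebD -EFinM ltry.
  have tpD := test_mul_int tp (cst 1).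
  have tpD' : leb.-integrable (D u v) (EFin \o psi).
    by apply: eq_integrable tpD => // x _; rewrite /= mulr1.
  have icp : leb.-integrable (D u v) (EFin \o (fun x => co l * psi x)).
    by apply: eq_integrable (integrableZl _ (co l) tpD') => // x _; rewrite /= EFinM.
  have -> : co l * iint psi u v = Rint u v (fun x => co l * psi x).
    by rewrite /Rint RintegralZl.
  have ip := test_mul_int tp (rnD u v).
  have id := idiff u v (subD l lm).
  rewrite /Rint -RintegralB//.
  have ipc : leb.-integrable (D u v) (EFin \o (fun x => psi x * rn x - co l * psi x)).
    by apply: eq_integrable (integrableB (mD u v) ip icp) => // x _; rewrite /= EFinB.
  apply: (le_trans (le_normr_Rintegral _ ipc)) => //.
  have -> : e1 * (v - u) = Rintegral leb (D u v) (fun=> e1).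
    by rewrite Rintegral_cst//; congr (_ * _); move: lebD => /(congr1 fine) ->.
  rewrite -RintegralD//; apply: le_Rintegral => //.
  - by apply: eq_integrable (integrable_abse ipc).
  - by apply: eq_integrable (integrableD (mD u v) id (cst e1)) => // x _; rewrite /= EFinD.
  move=> x; rewrite /D /= in_itv /= => xuv.
  have /andP[p0 p1] := tp.2 x.
  have -> : psi x * rn x - co l * psi x = psi x * (rn x - co l).
    by rewrite mulrBr [co l * _]mulrC.
  rewrite normrM (ger0_norm p0); apply: le_trans (ler_piMl (normr_ge0 _) p1) _.
  have -> : rn x - co l = (rn x - g x) + (g x - co l) by rewrite addrA subrK.
  by apply: le_trans (ler_normD _ _) _; rewrite lerD2l; exact: yco.
apply: le_trans (ler_norm_sum _ _ _) _.
apply: le_trans (ler_sum _ (fun l _ => cell l)) _.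
rewrite big_split /= -mulr_sumr.
have -> : \sum_(l < m) (y l.+1 - y l) = b - a.
  by rewrite -(big_mkord xpredT (fun l => y l.+1 - y l)) telescope_sumr// ym y0.
have -> : e = e1 + e1 * (b - a) by rewrite -{1}[e1]mulr1 -mulrDr /e1 divfK// gt_eqF.
rewrite lerD2r -Rint_sum//; last by rewrite y0 ym; exact: idiff.
rewrite y0 ym -lee_fin; apply: le_trans _ (ltW hN).
rewrite /Rint /Rintegral fineK; last first.
  by apply: integrable_fin_num => //; exact: idiff.
exact: lexx.
Qed.

End WeakApproximation.

(** * Stationary densities are constant on the cells of the grid *)

Section StationaryDensity.
Variables (R : realType) (Omega : set nat) (p : nat -> R) (n : nat).
Variables (c : nat -> R) (T : nat -> R -> R) (k d : 'I_n.+1 -> nat -> R).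
Hypothesis HR : random_map Omega p n.+1 c T.
Hypothesis HA : class_RA Omega p c T k d.
Let avg := average Omega p c k d.
Let prim := primitive n c.
Let I : set R := Idom n.+1 c.
Variables (K : nat) (ds : nat -> R).
Hypothesis ds0 : ds 0%N = c 0%N.
Hypothesis dsK : ds K = c n.+1.
Hypothesis ds_lt : forall i, (i < K)%N -> ds i < ds i.+1.
Hypothesis ds_I : forall i, (i <= K)%N -> I (ds i).
Hypothesis bounded_sums : forall psi1 psi2, test_fun psi1 -> test_fun psi2 ->
  (forall i, (i <= K)%N -> prim psi1 (ds i) = prim psi2 (ds i)) ->
  forall y, I y -> exists B, forall N,
    `|\sum_(t < N) (prim (iter t avg psi1) y - prim (iter t avg psi2) y)| <= B.
Variable mu : probability (measurableTypeR R) R.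
Hypothesis mu_acim : stationary_acim Omega p n.+1 c T mu.
Notation leb := (@lebesgue_measure R).

Let E psi := fine (\int[mu]_x (psi x)%:E)%E.

Let mu_ac : mu `<< leb. Proof. by case: mu_acim. Qed.
Let mu_I : mu I = 1%E. Proof. by case: mu_acim. Qed.

Let EE psi : test_fun psi -> (\int[mu]_x (psi x)%:E)%E = (E psi)%:E.
Proof.
move=> tp; rewrite /E fineK// ge0_fin_numE; last exact: test_integral_ge0.
by apply: le_lt_trans (test_integral_le mu tp measurableT) _; rewrite ltey_eq fin_num_measure.
Qed.

Let H : set (measurableTypeR R) := `]c 0%N, c n.+1]%classic.

Let mu_H0 : mu (~` H) = 0%E.
Proof.
have mH : measurable H := measurable_itv _.
have mI : measurable (I : set (measurableTypeR R)) := measurable_Idom n c.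
have mu_c0 : mu [set c 0%N] = 0%E.
  have null : leb.-null_set [set c 0%N : measurableTypeR R].
    by apply/measure0_null_setP; [exact: measurable_set1|exact: lebesgue_measure_set1].
  exact: (mu_ac null (measurable_set1 _)).
have <- : mu (~` I) = 0%E by rewrite probability_setC ?mu_I ?subee.
apply: (@eq_measure_off _ _ _ mu _ _ [set c 0%N]) => //.
- exact: measurableC.
- exact: measurableC.
move=> x; rewrite /H /I /Idom /= !in_itv /= => xc; split; apply: contra_not.
  by move=> /andP[h ->]; rewrite andbT lt_neqAle h andbT; apply/eqP => e; apply: xc.
by move=> /andP[/ltW -> ->].
Qed.

Let E_H psi : test_fun psi ->
  fine (\int[mu]_(x in `]c 0%N, c n.+1]%classic) (psi x)%:E)%E = E psi.
Proof.
move=> tp; congr fine.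
have mH : measurable H := measurable_itv _.
rewrite -(setUv H) (ge0_integral_setU _ mH (measurableC mH)).
- rewrite [X in (_ + X)%E]null_set_integral//; first by rewrite adde0.
  - exact: measurableC.
  - exact: test_fun_measurable.
- exact: test_fun_measurable.
- by move=> x _; rewrite lee_fin test_fun_ge0.
- by apply/disj_setPCl.
Qed.

Let E_iter psi t : test_fun psi -> E (iter t avg psi) = E psi.
Proof.
move=> tp; elim: t => // t <-; rewrite /E iterS.
have [_ _ st] := mu_acim.
have := (stationary_test HR HA mu_ac mu_I).1 st (iter t avg psi).
by move=> ->//; exact: (test_iter_average k d HR t tp).
Qed.

(* The sums of the differences E (psi1 o W^t) - E (psi2 o W^t) grow at most
   like 2 e N for every e > 0, while each of their terms is E psi1 - E psi2. *)
Lemma stationary_integral_eq psi1 psi2 : test_fun psi1 -> test_fun psi2 ->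
  (forall i, (i <= K)%N -> prim psi1 (ds i) = prim psi2 (ds i)) ->
  (\int[mu]_x (psi1 x)%:E = \int[mu]_x (psi2 x)%:E)%E.
Proof.
move=> t1 t2 e12; rewrite !EE//; congr EFin; apply/eqP; rewrite -subr_eq0.
rewrite -normr_le0; apply/ler_addgt0Pr => e e0; rewrite add0r.
have c0N : c 0%N < c n.+1 by rewrite (points_lt HR)// leqnn.
have e20 : 0 < e / 2 by rewrite divr_gt0.
(* The same nodes and coefficients serve all test functions, hence all iterates at once. The bounded
   sums are thus used at finitely many points, and the bound [C] below does not depend on N. *)
have [m [y [co [yb [ymono h]]]]] := measure_step_approximation mu_ac c0N e20.
have Iy l : (l <= m)%N -> I (y l) by move=> lm; apply/IdomE; exact: yb.
have /choice[B hB] : forall l, exists B, (l <= m)%N -> forall N,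
    `|\sum_(t < N) (prim (iter t avg psi1) (y l) - prim (iter t avg psi2) (y l))| <= B.
  move=> l; have [lm|_] := boolP (l <= m)%N; last by exists 0.
  by have [B hB] := bounded_sums t1 t2 e12 (Iy _ lm); exists B.
pose C := \sum_(l < m) `|co l| * (B l.+1 + B l).
have key N : N%:R * (`|E psi1 - E psi2| - e) <= C.
  have tt psi t : test_fun psi -> test_fun (iter t avg psi) := @test_iter_average _ _ _ _ _ _ k d HR psi t.
  pose S t := \sum_(l < m) co l * iint (iter t avg psi1) (y l) (y l.+1)
            - \sum_(l < m) co l * iint (iter t avg psi2) (y l) (y l.+1).
  have near t : `|(E psi1 - E psi2) - S t| <= e.
    rewrite -(E_iter t t1) -(E_iter t t2) /S -!E_H; [|exact: tt..].
    have := h _ (tt _ t t1); have := h _ (tt _ t t2).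
    set a1 := fine _; set b1 := \sum_(l < m) _; set a2 := fine _; set b2 := \sum_(l < m) _.
    move=> h2 h1.
    have -> : a2 - a1 - (b2 - b1) = (a2 - b2) - (a1 - b1) by lra.
    by apply: le_trans (ler_normB _ _) _; lra.
  have SC : `|\sum_(t < N) S t| <= C.
    rewrite (_ : \sum_(t < N) S t = \sum_(l < m) co l *
      (\sum_(t < N) (prim (iter t avg psi1) (y l.+1) - prim (iter t avg psi2) (y l.+1))
      - \sum_(t < N) (prim (iter t avg psi1) (y l) - prim (iter t avg psi2) (y l)))).
      apply: le_trans (ler_norm_sum _ _ _) _; apply: ler_sum => l _.
      rewrite normrM ler_wpM2l//; apply: le_trans (ler_normB _ _) _.
      by apply: lerD; apply: hB => //; exact: ltnW.
    under eq_bigr do rewrite /S -sumrB.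
    rewrite exchange_big /=; apply: eq_bigr => l _; rewrite -sumrB mulr_sumr.
    apply: eq_bigr => t _; rewrite -mulrBr; congr (_ * _).
    have lm := ltn_ord l.
    have b psi : test_fun psi -> prim psi (y l.+1) - prim psi (y l) = iint psi (y l) (y l.+1).
      by move=> tp; apply: (primitiveB tp (Iy _ (ltnW lm)) (Iy _ lm) (ymono _ lm)).
    by rewrite -!b; [lra|exact: tt..].
  have : N%:R * `|E psi1 - E psi2| <= C + N%:R * e.
    rewrite -[X in X * _](normr_nat R) -normrM.
    have -> : N%:R * (E psi1 - E psi2) = \sum_(t < N) S t + \sum_(t < N) ((E psi1 - E psi2) - S t).
      by rewrite -big_split /=; under eq_bigr do rewrite addrC subrK; rewrite sumr_const card_ord mulr_natl.
    apply: le_trans (ler_normD _ _) _; apply: lerD => //.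
    apply: le_trans (ler_norm_sum _ _ _) _.
    apply: le_trans (ler_sum _ (fun (t : 'I_N) _ => near t)) _.
    by rewrite sumr_const card_ord mulr_natl.
  by rewrite mulrBr lerBlDr.
rewrite leNgt; apply/negP => lt; move: key.
set a := _ - e; have a0 : 0 < a by rewrite subr_gt0.
move=> /(_ (Num.bound `|C / a|)); apply/negP; rewrite -ltNge.
rewrite -ltr_pdivrMr//; apply: le_lt_trans (ler_norm _) _.
exact: archi_boundP (normr_ge0 _).
Qed.

Let cell i : set (measurableTypeR R) := `]ds i, ds i.+1]%classic.

Let iint_cell i j (B : set (measurableTypeR R)) : (i < K)%N -> (j <= K)%N ->
  measurable B -> B `<=` cell i ->
  (iint (\1_B : R -> R) (c 0%N) (ds j))%:E = if (i < j)%N then leb B else 0%E.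
Proof.
move=> iK jK mB Bi; rewrite iint_indic//; case: ltnP => ij.
  rewrite setIidl// => x /Bi; rewrite /cell /= !in_itv /= => xi.
  have /andP[-> _] := cell_in ds0 dsK ds_lt iK xi.
  have /andP[_ xi1] := xi; apply: le_trans xi1 _.
  move: ij; rewrite leq_eqVlt => /predU1P[->//|ij].
  by apply/ltW/(ds_mono ds_lt); rewrite ij.
rewrite (_ : B `&` _ = set0) ?measure0//; apply/seteqP; split => // x [/Bi].
rewrite /cell /= !in_itv /= => /andP[ix _] /andP[_ xj].
suff : ds j <= ds i by rewrite leNgt (lt_le_trans ix xj).
move: ij; rewrite leq_eqVlt => /predU1P[->//|ij].
by apply/ltW/(ds_mono ds_lt); rewrite ij ltnW.
Qed.

Let mu_cell i (B : set (measurableTypeR R)) : (i < K)%N -> measurable B ->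
  B `<=` cell i ->
  mu B = ((fine (mu (cell i)) / (ds i.+1 - ds i))%:E * leb B)%E.
Proof.
move=> iK mB Bi; set L := ds i.+1 - ds i.
have L0 : 0 < L by rewrite subr_gt0 ds_lt.
have mC : measurable (cell i) := measurable_itv _.
have lebC : leb (cell i) = L%:E.
  by rewrite /cell lebesgue_measure_itv /= lte_fin ds_lt.
have lebB : (leb B <= L%:E)%E by rewrite -lebC le_measure// inE.
have [b bE] : exists b, leb B = b%:E.
  by exists (fine (leb B)); rewrite fineK// ge0_fin_numE// (le_lt_trans lebB)// ltry.
have b0 : 0 <= b by rewrite -lee_fin -bE.
have bL : b <= L by rewrite -lee_fin -bE.
(* The factor for which [th] times the indicator of the cell has the same integral as the indicator
   of [B]; both primitives then agree at every grid point. *)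
pose th := b / L.
have th0 : 0 <= th by rewrite divr_ge0// ltW.
have th1 : th <= 1 by rewrite ler_pdivrMr// mul1r.
pose psi x : R := th * \1_(cell i) x.
have t1 : test_fun (\1_B : R -> R) := test_indic mB.
have tC : test_fun (\1_(cell i) : R -> R) := test_indic mC.
have t2 : test_fun psi.
  split; first by apply: measurable_funM => //; case: tC.
  move=> x; have /andP[h0 h1] := tC.2 x.
  by rewrite /psi mulr_ge0//= -[1]mulr1 ler_pM.
have psiE : (\int[mu]_x (psi x)%:E = th%:E * mu (cell i))%E.
  under eq_integral do rewrite EFinM.
  rewrite ge0_integralZl_EFin//; first by rewrite integral_indic// setIT.
  exact: test_fun_measurable.
have e12 j : (j <= K)%N -> prim (\1_B : R -> R) (ds j) = prim psi (ds j).
  move=> jK; rewrite /prim !primitiveE//; try exact: ds_I.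
  apply: EFin_inj; rewrite (iint_cell iK)// -iintE//.
  under eq_integral do rewrite EFinM.
  rewrite ge0_integralZl_EFin//; last exact: test_fun_measurable.
  rewrite iintE// (iint_cell iK)//; case: ifP => _; last by rewrite mule0.
  by rewrite lebC bE -EFinM /th divfK// gt_eqF.
have := stationary_integral_eq t1 t2 e12; rewrite psiE integral_indic// setIT => ->.
rewrite bE -EFinM -[X in (_ * X)%E](@fineK _ (mu (cell i))) ?fin_num_measure//.
by rewrite -EFinM; congr EFin; rewrite /th mulrC -[RHS]mulrA [_^-1 * b]mulrC.
Qed.

Lemma stationary_density_constant f : density_of n.+1 c mu f ->
  piecewise_constant n.+1 c f.
Proof.
move=> [fi muf].
apply: (piecewise_constant_cells ds0 dsK ds_lt
  (a := fun i => fine (mu (cell i)) / (ds i.+1 - ds i))) => i iK.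
have mC : measurable (cell i) := measurable_itv _.
have cI : cell i `<=` I.
  move=> x; rewrite /cell /= in_itv /= => /(cell_in ds0 dsK ds_lt iK)/andP[h1 h2].
  by apply/IdomE; rewrite (ltW h1).
have fC : leb.-integrable (cell i) (EFin \o f).
  by apply: integrableS fi => //; exact: measurable_Idom.
set a := _ / _.
have ma : measurable_fun (cell i) (EFin \o (fun=> a)) by apply/measurable_EFinP.
have fa : ae_eq leb (cell i) (EFin \o f) (EFin \o (fun=> a)).
  apply: integral_ae_eq => // B Bi mB.
  have BI : B `<=` I by move=> x /Bi/cI.
  by rewrite integral_cst// -/a -(mu_cell iK mB Bi) muf.
by apply: filterS fa => x h xi; have [] := h xi.
Qed.

End StationaryDensity.

(** * Bernoulli measures on sequences *)

Section BernoulliMeasures.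
Variables (R : realType) (Omega : set nat) (p : nat -> R).
Hypothesis p0 : forall j, Omega j -> 0 <= p j.
Hypothesis p1 : (\esum_(j in Omega) (p j)%:E = 1)%E.
Variable m : probability seqType R.
Hypothesis Hm : bernoulli_measure Omega p m.

Lemma measurable_cylinder u : measurable (cylinder u : set seqType).
Proof. by apply: sub_sigma_algebra; exists u. Qed.

Lemma measurable_letter i j : measurable ([set w | w i = j] : set seqType).
Proof.
(* The default [j.+1] differs from [j], so only words with more than i letters contribute. *)
rewrite (_ : [set w | _] = \bigcup_(u : seq nat)
    (if nth j.+1 u i == j then cylinder u else set0 : set seqType)).
  apply: countable_bigcupT_measurable; first exact: countableP.
  by move=> u; case: ifP => _; [exact: measurable_cylinder|exact: measurable0].
apply/seteqP; split => [w /= wi|w /= [u _]].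
  exists (mkseq w i.+1) => //; rewrite nth_mkseq// wi eqxx.
  by apply: congr1; rewrite size_mkseq.
case: ifP => // /eqP ui; rewrite /cylinder /= => wu; rewrite -ui -[X in nth _ X _]wu.
rewrite nth_mkseq// ltnNge; apply/negP => si; move: ui; rewrite nth_default//.
by move/eqP; rewrite eqn_leq ltnn.
Qed.

Lemma measurable_letters i (A : set nat) :
  measurable ([set w | A (w i)] : set seqType).
Proof.
rewrite (_ : [set w | _] = \bigcup_(j in A) ([set w | w i = j] : set seqType)).
  by apply: bigcup_measurable => j _; exact: measurable_letter.
by apply/seteqP; split => [w /= Aw|w /= [j Aj ->]] //; exists (w i).
Qed.

Lemma measurable_seqs : measurable (seqs Omega : set seqType).
Proof.
rewrite (_ : seqs Omega = \bigcap_i ([set w | Omega (w i)] : set seqType)).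
  by apply: bigcapT_measurable => i; exact: measurable_letters.
by apply/seteqP; split => [w Ow i _|w Ow i]; [exact: Ow|exact: (Ow i)].
Qed.

Lemma esum_measure_bigcup d (X : measurableType d) (mu : {measure set X -> \bar R})
    (F : nat -> set X) : (forall j, Omega j -> measurable (F j)) ->
  trivIset Omega F ->
  (mu (\bigcup_(j in Omega) F j) = \esum_(j in Omega) mu (F j))%E.
Proof.
move=> mF tF; rewrite measure_bigcup// nneseries_esum//; congr esum.
by apply/seteqP; split => j /=; rewrite inE.
Qed.

Lemma word_weight_rcons u j : word_weight p (rcons u j) = word_weight p u * p j.
Proof. by rewrite /word_weight -cats1 big_cat /= big_seq1. Qed.

Lemma cylinder_rcons u j :
  cylinder (rcons u j) = cylinder u `&` [set w | w (size u) = j].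
Proof.
apply/seteqP; split => w; rewrite /cylinder /= size_rcons.
  rewrite /mkseq -addn1 iotaD map_cat /= cats1 => e.
  by have [-> ->] := rcons_inj e.
by case=> e <-; rewrite /mkseq -addn1 iotaD map_cat /= cats1; congr rcons.
Qed.

(** The extensions of [u] by a letter of Omega have total mass [word_weight p u] times the sum of
    the weights, which already exhausts the cylinder. *)
Lemma bernoulli_next_letter u : words Omega u ->
  m (cylinder u `\` [set w | Omega (w (size u))]) = 0%E.
Proof.
move=> Ou; set N := _ `\` _.
have mO := measurable_letters (size u) Omega.
have mu_ := measurable_cylinder u.
have p0u : 0 <= word_weight p u.
  by rewrite /word_weight big_seq; apply: prodr_ge0 => j /Ou; exact: p0.
have E : m (cylinder u `&` [set w | Omega (w (size u))]) = m (cylinder u).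
  rewrite (_ : _ `&` _ = \bigcup_(j in Omega) cylinder (rcons u j)).
    rewrite esum_measure_bigcup; first last.
    - move=> i j _ _ [w []]; rewrite !cylinder_rcons => -[_ /= <-] [_ /= ->//].
    - by move=> j _; exact: measurable_cylinder.
    rewrite Hm// (eq_esum (b := fun j => (word_weight p u * p j)%:E)) => [|j Oj].
      under eq_esum do rewrite mulrC.
      by rewrite esum_mulr// p1 mul1e.
    apply: (etrans (Hm _)); last by rewrite word_weight_rcons.
    move=> i; rewrite mem_rcons inE => /predU1P[->//|].
    exact: Ou.
  apply/seteqP; split => [w [wu Ow]|w [j Oj]]; first by exists (w (size u)); rewrite ?cylinder_rcons.
  by rewrite cylinder_rcons => -[wu /= wj]; split => //=; rewrite wj.
rewrite /N measureD//; last by rewrite ltey_eq fin_num_measure.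
by rewrite [X in (_ - X)%E]E subee// fin_num_measure.
Qed.

(** A sequence outside [seqs Omega] has a first letter outside Omega, preceded by a word over Omega.
    The complement is therefore covered by null sets indexed by the countably many words. *)
Lemma bernoulli_seqsC : m (~` seqs Omega) = 0%E.
Proof.
apply/eqP; rewrite -measure_le0.
pose F (k : nat) : set seqType := if unpickle k is Some u then
  if `[< words Omega u >] then cylinder u `\` [set w | Omega (w (size u))] else set0
  else set0.
have F0 k : m.-negligible (F k).
  rewrite /F; case: unpickle => [u|]; last exact: negligible_set0.
  case: asboolP => Ou; last exact: negligible_set0.
  apply/negligibleP; last exact: bernoulli_next_letter.
  by apply: measurableD; [exact: measurable_cylinder|exact: measurable_letters].
have := negligible_bigcup F0.
move=> /(negligibleS _) h.
have /h/negligibleP-> // : ~` seqs Omega `<=` \bigcup_k F k; last first.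
  by apply: measurableC; exact: measurable_seqs.
move=> w /existsNP[i wi]; have [q [/asboolPn wq min]] : exists q, ~~ `[< Omega (w q) >] /\
    forall r, (r < q)%N -> Omega (w r).
  have ex : exists q, ~~ `[< Omega (w q) >] by exists i; apply/asboolPn.
  exists (ex_minn ex); case: ex_minnP => q wq qmin; split=> // r rq.
  by apply: contrapT => /asboolPn/qmin; rewrite leqNgt rq.
exists (pickle (mkseq w q)) => //; rewrite /F pickleK; case: asboolP => [_|[]].
  by split; rewrite /= ?/cylinder /= size_mkseq.
by move=> j /mapP[r]; rewrite mem_iota add0n => /andP[_ rq] ->; exact: min.
Qed.

Lemma bernoulli_cons j u : Omega j -> m (cylinder (j :: u)) = ((p j)%:E * m (cylinder u))%E.
Proof.
move=> Oj; have [Ou|nOu] := pselect (words Omega u).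
  rewrite !Hm//; first by rewrite /word_weight big_cons EFinM.
  by move=> i; rewrite inE => /predU1P[->//|]; exact: Ou.
have c0 v : ~ words Omega v -> m (cylinder v) = 0%E.
  move=> nOv; apply/eqP; rewrite -measure_le0 -bernoulli_seqsC le_measure ?inE//.
  - exact: measurable_cylinder.
  - by apply: measurableC; exact: measurable_seqs.
  - move=> w wv Ow; apply: nOv => i; rewrite -wv => /mapP[r _ ->]; exact: Ow.
rewrite !c0 ?mule0// => Oju; apply: nOu => i iu; apply: Oju.
by rewrite inE iu orbT.
Qed.

End BernoulliMeasures.

Lemma mkseq_cons (A : Type) (f : nat -> A) l :
  mkseq f l.+1 = f 0%N :: mkseq (fun i => f i.+1) l.
Proof.
by rewrite /mkseq /=; have := iotaDl 1 0 l; rewrite addn0 => ->; rewrite -map_comp.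
Qed.

(** * Invariance of the product measure under the skew product *)

Section ProductInvariance.
Variables (R : realType) (Omega : set nat) (p : nat -> R) (n : nat).
Variables (c : nat -> R) (T : nat -> R -> R) (k d : 'I_n.+1 -> nat -> R).
Hypothesis HR : random_map Omega p n.+1 c T.
Hypothesis HA : class_RA Omega p c T k d.
Variable m : probability seqType R.
Hypothesis Hm : bernoulli_measure Omega p m.
Variable mu : probability (measurableTypeR R) R.
Hypothesis mu_I : mu (Idom n.+1 c) = 1%E.
Hypothesis mu_st : stationary Omega p n.+1 c T mu.

Let I : set (measurableTypeR R) := Idom n.+1 c.
Let p0 j : Omega j -> 0 <= p j.
Proof. by move=> Oj; rewrite ltW// (weight_gt0 HR). Qed.
Let mI : measurable I := measurable_Idom n c.

Let shift (w : seqType) : seqType := fun i => w i.+1.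

Let preimage_shift u : shift @^-1` (cylinder u) = \bigcup_j cylinder (j :: u).
Proof.
apply/seteqP; split => w; rewrite /cylinder /shift /=.
  by move=> e; exists (w 0%N); rewrite //= mkseq_cons e.
by case=> j _ /=; rewrite mkseq_cons => -[].
Qed.

Let measurable_shift : measurable_fun setT shift.
Proof.
apply: (@measurability _ _ seqType seqType setT shift (range cylinder) erefl).
move=> _ [_ [u _ <-] <-].
rewrite setTI preimage_shift; apply: bigcupT_measurable => j.
exact: measurable_cylinder.
Qed.

(* Outside [seqs Omega `*` I] the skew product need not be measurable. *)
Let map' j (x : R) : R := if `[< Omega j /\ I x >] then T j x else c 0%N.

Let measurable_map' j (B : set (measurableTypeR R)) : measurable B ->
  measurable (map' j @^-1` B : set (measurableTypeR R)).
Proof.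
move=> mB; have mc (A : Prop) : measurable ([set x : measurableTypeR R | A]).
  have [a|a] := pselect A.
    by rewrite (_ : [set _ | _] = setT)//; apply/seteqP; split.
  by rewrite (_ : [set _ | _] = set0)//; apply/seteqP; split.
have [Oj|nOj] := pselect (Omega j); last first.
  rewrite (_ : _ @^-1` _ = [set x | B (c 0%N)]); first exact: mc.
  by apply/seteqP; split => x; rewrite /= /map' asboolF// => -[].
rewrite (_ : _ @^-1` _ = (I `&` T j @^-1` B) `|` (~` I `&` [set x | B (c 0%N)])).
  apply: measurableU; first exact: (measurable_preimage_map HR HA Oj mB).
  by apply: measurableI; [exact: measurableC|exact: mc].
apply/seteqP; split => x; rewrite /= /map'.
  by case: asboolP => [[_ Ix] ?|h ?]; [left|right]; split => // Ix; apply: h.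
by case: asboolP => [[_ Ix]|nI] [] [Ix' Bx] //; case: nI.
Qed.

Let skew' (wx : seqType * measurableTypeR R) : seqType * measurableTypeR R :=
  (shift wx.1, map' (wx.1 0%N) wx.2).

Let measurable_skew' : measurable_fun setT skew'.
Proof.
apply: measurable_fun_pair.
  exact: measurableT_comp measurable_shift measurable_fst.
move=> _ B mB; rewrite setTI.
rewrite (_ : _ @^-1` _ = \bigcup_j ([set w : seqType | w 0%N = j] `*` (map' j @^-1` B))).
  apply: bigcupT_measurable => j; apply: measurableX; last exact: measurable_map'.
  exact: measurable_letter.
by apply/seteqP; split => -[w x] /=; [exists (w 0%N)|case=> j _ [/= <-]].
Qed.

(** Constraining the first letter is enough for T_j to act, and it keeps the preimage of a cylinder
    rectangle a countable union of cylinder rectangles. Passing to all of [seqs Omega] changes a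
    null set only. *)
Let X1 : set (seqType * measurableTypeR R) := [set w | Omega (w 0%N)] `*` I.

Let mX1 : measurable X1.
Proof. by apply: measurableX => //; exact: measurable_letters. Qed.

Let P : {measure set (seqType * measurableTypeR R) -> \bar R} := (m \x mu)%E.

Let nu : {measure set (seqType * measurableTypeR R) -> \bar R} :=
  ltac:(refine (pushforward (mrestr P mX1) skew' : {measure set _ -> \bar R});
        exact: measurable_skew').

Let nuE A : nu A = P (skew' @^-1` A `&` X1). Proof. by []. Qed.

(** Summation over the first letter j: the cylinder of [j :: u] contributes the factor p_j, and the
    sum of p_j mu(T_j^-1 B) is mu(B) by stationarity. *)
Let nu_cylinder u (B : set (measurableTypeR R)) : measurable B ->
  nu (cylinder u `*` B) = (m (cylinder u) * mu B)%E.
Proof.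
move=> mB; have mc v := measurable_cylinder v.
have mT j : Omega j -> measurable (I `&` T j @^-1` B : set (measurableTypeR R)).
  by move=> Oj; exact: (measurable_preimage_map HR HA Oj mB).
rewrite nuE (_ : _ `&` _ = \bigcup_(j in Omega) (cylinder (j :: u) `*` (I `&` T j @^-1` B))).
  rewrite esum_measure_bigcup; first last.
  - move=> i j _ _ [[w x]] [[]] /= e _ [] e' _; move: e e'; rewrite /cylinder /=.
    by case=> <- _ [<-].
  - by move=> j Oj; apply: measurableX => //; exact: mT.
  have mBI : mu B = mu (B `&` I).
    apply: (@eq_measure_off _ _ _ mu _ _ (~` I)) => //.
    - exact: measurableI.
    - exact: measurableC.
    - by apply: (etrans (probability_setC mu mI)); rewrite mu_I subee.
    - by move=> x /contrapT Ix; split => [|[]].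
  have sumB : (\esum_(j in Omega) (p j * fine (mu (I `&` T j @^-1` B)))%:E = mu B)%E.
    rewrite mBI (mu_st (measurableI _ _ mB mI) (@subIsetr _ _ _)).
    apply: eq_esum => j Oj; rewrite EFinM fineK; last by rewrite fin_num_measure//; exact: (mT _ Oj).
    congr (_ * mu _)%E; apply/seteqP; split => x [Ix] /=; last by case.
    by move=> Bx; split => //; split => //; exact: (maps_into HR).
  have [a a0 aE] : exists2 a : R, 0 <= a & m (cylinder u) = a%:E.
    exists (fine (m (cylinder u))); first by rewrite fine_ge0.
    by rewrite fineK//; apply: fin_num_measure; exact: mc.
  rewrite -sumB muleC [X in (_ * X)%E]aE -esum_mulr//; last first.
    by move=> j Oj; rewrite mulr_ge0 ?p0// fine_ge0.
  apply: eq_esum => j Oj.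
  apply: (etrans (product_measure1E m mu (mc (j :: u)) (mT _ Oj))).
  rewrite [X in (X * _)%E](bernoulli_cons p0 (weight_sum HR) Hm)// [X in (_ * X * _)%E]aE.
  rewrite -[X in (_ * X)%E = _]fineK; last by apply: fin_num_measure; exact: (mT _ Oj).
  by rewrite -!EFinM mulrAC.
apply/seteqP; split => -[w x] /=; rewrite /X1 /cylinder /=.
  rewrite /map' => -[[wu Bx] [Ow Ix]]; move: Bx; rewrite asboolT// => Bx.
  by exists (w 0%N) => //=; rewrite mkseq_cons wu.
case=> j Oj [] /=; rewrite mkseq_cons => -[w0 wu] [Ix Bx].
by split; [split => //; rewrite /map' w0 asboolT|rewrite w0].
Qed.

(** Two cylinders are nested or disjoint, so together with the empty set they form a pi-system. For
    fixed [B] both sides are finite measures in [A] that agree on it. *)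
Let nu_rect (A : set seqType) (B : set (measurableTypeR R)) :
  measurable A -> measurable B -> nu (A `*` B) = (m A * mu B)%E.
Proof.
move=> mA mB; pose G : set (set seqType) := range cylinder `|` [set set0].
have Gm : G `<=` measurable.
  by move=> _ [[u _ <-]|->]; [exact: measurable_cylinder|exact: measurable0].
have mTB : measurable ((setT : set seqType) `*` B) by exact: measurableX.
have b0 : 0 <= fine (mu B) by rewrite fine_ge0.
pose nu1 : {measure set seqType -> \bar R} :=
  ltac:(refine (pushforward (mrestr nu mTB) fst : {measure set seqType -> \bar R});
        exact: measurable_fst).
pose nu2 : {measure set seqType -> \bar R} := mscale (NngNum b0) m.
have nu1E A' : nu1 A' = nu (A' `*` B).
  rewrite /nu1 /= /pushforward /mrestr; congr (nu _).
  by apply/seteqP; split => -[w x] /=; [case=> ? [_ ?]|case].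
have nu2E A' : nu2 A' = (m A' * mu B)%E.
  by rewrite /nu2 /= /mscale /= fineK; [rewrite muleC|apply: fin_num_measure].
rewrite -nu1E -nu2E.
apply: (@g_sigma_algebra_measure_unique _ _ _ G Gm (fun=> cylinder [::])).
- by move=> _; left; exists [::].
- by apply/seteqP; split => // w _; exists 0%N.
- have le u v : (size u <= size v)%N -> G (cylinder u `&` cylinder v).
    move=> uv; have [e|e] := eqVneq (take (size u) v) u.
      left; exists v => //; apply/seteqP; split => [w wv|w []//]; split => //.
      by rewrite /cylinder /= -[RHS]e -wv -map_take take_iota (minn_idPl uv).
    right; apply/seteqP; split => // w []; rewrite /cylinder /= => wu wv.
    by move/eqP: e; apply; rewrite -wv -[RHS]wu -map_take take_iota (minn_idPl uv).
  move=> _ _ [[u _ <-]|->] [[v _ <-]|->]; rewrite ?setI0 ?set0I; try by right.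
  have [uv|/ltnW uv] := leqP (size u) (size v); first exact: le.
  rewrite setIC; exact: le.
- move=> _ [[u _ <-]|->]; last by rewrite !measure0.
  by rewrite nu1E nu2E nu_cylinder.
- by move=> _; rewrite nu1E nu_cylinder// ltey_eq fin_numM ?orbT//; apply: fin_num_measure; rewrite ?inE//; exact: measurable_cylinder.
by apply: sub_sigma_algebra2 mA => u Gu; left.
Qed.

(** [nu] agrees with the product measure on rectangles, hence on all measurable sets, and off a null
    set [skew'] restricted to [X1] is the skew product on [seqs Omega] times I. *)
Lemma product_invariant : R_invariant Omega n.+1 c T m mu.
Proof.
move=> A mA AX.
have mS : measurable (~` (seqs Omega `*` setT) : set (seqType * measurableTypeR R)).
  by apply: measurableC; apply: measurableX => //; exact: measurable_seqs.
have S0 : (m \x mu)%E (~` (seqs Omega `*` setT) : set (seqType * measurableTypeR R)) = 0%E.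
  rewrite (_ : ~` _ = (~` seqs Omega) `*` setT).
    rewrite product_measure1E//; last by apply: measurableC; exact: measurable_seqs.
    by rewrite [X in (X * _)%E](bernoulli_seqsC p0 (weight_sum HR) Hm) mul0e.
  apply/seteqP; split => -[w x] /=; last by case=> h _ [/h].
  by move=> h; split=> // Ow; apply: h.
have E w x : seqs Omega w -> I x -> skew_product T (w, x) = skew' (w, x).
  by move=> Ow Ix; rewrite /skew_product /skew' /map' asboolT//; split=> //; exact: Ow.
rewrite [RHS](@product_measure_unique _ _ _ _ _ m mu nu nu_rect _ mA).
have mpre : measurable (skew' @^-1` A `&` X1).
  by apply: measurableI => //; rewrite -[X in measurable X]setTI; exact: measurable_skew'.
have off wx : ~ (~` (seqs Omega `*` setT)) wx ->
    ((seqs Omega `*` I) `&` skew_product T @^-1` A) wx <-> (skew' @^-1` A `&` X1) wx.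
  case: wx => w x /contrapT[/= Ow _]; split => /=.
    by move=> [[_ Ix]]; rewrite E//; split=> //; split=> //=; exact: Ow.
  by move=> [Aw [_ Ix]]; rewrite E.
(* Gives the measurability of the preimage under the skew product, which is not a measurable map as
   it stands. *)
have e : (seqs Omega `*` I) `&` skew_product T @^-1` A =
    (skew' @^-1` A `&` X1) `&` (seqs Omega `*` setT).
  apply/seteqP; split => -[w x].
    by move=> h; have [[Ow _] _] := h; split; [apply/off => // -[]; split|].
  by move=> [h Ow]; apply/off => // nOw; exact: nOw Ow.
rewrite nuE; apply: (@eq_measure_off _ _ _ P _ _ _ _ _ mS S0 off) => //.
by rewrite e; apply: measurableI => //; apply: measurableX => //; exact: measurable_seqs.
Qed.

End ProductInvariance.

Theorem theorem2p5 (R : realType) (Omega : set nat) (p : nat -> R)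
    (N : nat) (c : nat -> R) (T : nat -> R -> R) (k d : 'I_N -> nat -> R)
    (HR : random_map Omega p N c T)
    (HA : class_RA Omega p c T k d)
    (M : R -> nat) (Y : R -> set R) (kc lc : R -> (nat -> nat) -> nat)
    (HM : strong_random_matching Omega p N c T M Y kc lc)
    (Hstop : forall z, crit N c z ->
       stopping_rule Omega (kc z) /\ stopping_rule Omega (lc z))
    (Hfin : forall z, crit N c z ->
       finite_set (prematching_orbit Omega T z^'- (kc z)) /\
       finite_set (prematching_orbit Omega T z^'+ (lc z))) :
  (exists (mu : probability (measurableTypeR R) R) (f : R -> R),
     [/\ stationary_acim Omega p N c T mu,
         forall m : probability seqType R,
           bernoulli_measure Omega p m -> R_invariant Omega N c T m mu,
         density_of N c mu f &
         piecewise_constant N c f]) /\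
  ((forall (i : 'I_N) j, Omega j -> 1 < `|k i j|) ->
   forall f : R -> R, invariant_density Omega p N c T f ->
     piecewise_constant N c f).
Proof.
case: N k d HR HA HM Hstop Hfin => [|n] k d HR HA HM Hstop Hfin.
  by have := interval_nondegenerate HR.
have [K [ds [[ds0 dsK ds_lt ds_I] [F [F_neq0 F_inv]] bounded_sums]]] :=
  matching_grid HR HA HM Hstop Hfin.
split; last first.
  move=> _ f [mu mu_acim muf].
  exact: (stationary_density_constant HR HA ds0 dsK ds_lt ds_I bounded_sums mu_acim muf).
have [mu [f [mu_acim muf fpc]]] := exists_step_acim HR HA ds0 dsK ds_lt F_neq0 F_inv.
exists mu, f; split => // m Hm; have [mu_I _ mu_st] := mu_acim.
exact: (product_invariant HR HA Hm mu_I mu_st).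
Qed.
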